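(* Assume that $b=b_0\chi_{(b_1,b_2)}$, $c=c_0\chi_{(c_1,c_2)}$, $d=0$ with $0<b_1<b_2<c_1<c_2<L$, that $a=1$, and that $|c_0|<\frac{1}{c_2-c_1}$. Then there exists a constant $C>0$ such that for all $U_0\in D(\mathcal{A})$ ($C$ being independent of $U_0$), the energy of the solution $U(t)=(u,u_t,y,y_t)^\top=e^{t\mathcal{A}}U_0$ satisfies $$E(t)\le\frac{C}{t}\|U_0\|^2_{D(\mathcal{A})},\qquad t>0.$$
   Context: All functions are complex valued. $L>0$, $a>0$, $b_0>0$ and $c_0\in\mathbb{R}\setminus\{0\}$ are constants; $\chi_{(\alpha,\beta)}$ is the indicator function of $(\alpha,\beta)$. The energy space is $\mathcal{H}=(H_0^1(0,L)\times L^2(0,L))^2$ with inner product $(U,U_1)_{\mathcal{H}}=\int_0^L v\overline{v_1}\,dx+a\int_0^L u_x\overline{(u_1)_x}\,dx+\int_0^L z\overline{z_1}\,dx+\int_0^L y_x\overline{(y_1)_x}\,dx$ for $U=(u,v,y,z)^\top$, $U_1=(u_1,v_1,y_1,z_1)^\top$. The operator $\mathcal{A}$ has domain $D(\mathcal{A})=\{(u,v,y,z)^\top\in\mathcal{H}: v,z\in H_0^1(0,L),\ (au_x+bv_x)_x\in L^2(0,L),\ (y_x+dz_x)_x\in L^2(0,L)\}$, endowed with the graph norm $\|\cdot\|_{D(\mathcal{A})}$, and is given by $\mathcal{A}(u,v,y,z)^\top=(v,\ (au_x+bv_x)_x-cz,\ z,\ (y_x+dz_x)_x+cv)^\top$;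 it generates a $C_0$-semigroup of contractions $(e^{t\mathcal{A}})_{t\ge0}$ on $\mathcal{H}$. The equation $U_t=\mathcal{A}U$ is the first order form, with $U=(u,u_t,y,y_t)^\top$, of $u_{tt}-(au_x+bu_{tx})_x+cy_t=0$, $y_{tt}-(y_x+dy_{tx})_x-cu_t=0$ on $(0,L)\times(0,\infty)$ with $u=y=0$ at $x=0,L$. The energy is $E(t)=\frac12\int_0^L(|u_t|^2+a|u_x|^2+|y_t|^2+|y_x|^2)\,dx$. *)

(* Defs.v *)
From HB Require Import structures.
From mathcomp Require Import all_boot all_order all_algebra.
From mathcomp Require Import all_classical all_reals all_analysis.
From mathcomp Require Import complex.
Set Implicit Arguments.
Unset Strict Implicit.
Unset Printing Implicit Defensive.
Import Order.TTheory GRing.Theory Num.Theory.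
Import numFieldNormedType.Exports.
Local Open Scope classical_set_scope.
Local Open Scope ring_scope.
Local Open Scope complex_scope.

(* Functions on (0, L) are represented by functions on R of which only the
   restriction to (0, L), up to a.e. equality, is ever used: elements of L^2,
   H^1, H^1_0 and of the energy space are representatives, and equality in the
   energy space is [energy_eq] below.  The alias R[i]^o makes R[i] a module
   over itself, so that +, -, *: on functions and tuples are the pointwise,
   componentwise, complex-linear operations. *)
Definition cfun (R : realType) := R -> R[i]^o.

Section Sobolev.
Context {R : realType}.
Variable L : R.
Implicit Types f g u : cfun R.

Definition modulus (z : R[i]) : R := Normc.normc z.

Definition real_integral (f : R -> R) : R :=
  \int[lebesgue_measure]_(x in `]0, L[) f x.

Definition complex_integral f : R[i] :=
  real_integral (fun x => complex.Re (f x))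
  +i* real_integral (fun x => complex.Im (f x)).

Definition inL2 f : Prop :=
  [/\ measurable_fun `]0, L[ (fun x => complex.Re (f x)),
      measurable_fun `]0, L[ (fun x => complex.Im (f x)) &
      (@lebesgue_measure R).-integrable `]0, L[
        (fun x => (modulus (f x) ^+ 2)%:E)].

Definition C1 (f : R -> R) : Prop :=
  (forall x, derivable f x 1) /\ continuous (derive1 f).

(* Complex valued C^1 functions with compact support in (0, L). *)
Definition test_function (phi : cfun R) : Prop :=
  [/\ C1 (fun x => complex.Re (phi x)), C1 (fun x => complex.Im (phi x)) &
      exists alpha beta : R, [/\ 0 < alpha, beta < L &
        forall x, x \notin `[alpha, beta] -> phi x = 0]].

Definition cderive (phi : cfun R) : cfun R := fun x =>
  derive1 (fun s => complex.Re (phi s)) x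
  +i* derive1 (fun s => complex.Im (phi s)) x.

Definition weak_derivative f g : Prop :=
  forall phi, test_function phi ->
    complex_integral (fun x => f x * cderive phi x)
    = - complex_integral (fun x => g x * phi x).

Definition has_L2_derivative f : Prop :=
  exists g, inL2 g /\ weak_derivative f g.

(* A chosen representative of the weak derivative (0 if f has no weak
   derivative in L^2). *)
Definition wderiv f : cfun R :=
  xget 0 [set g : cfun R | inL2 g /\ weak_derivative f g].

Definition inH1 f : Prop := inL2 f /\ has_L2_derivative f.

Definition H1norm f : R :=
  Num.sqrt (real_integral (fun x => modulus (f x) ^+ 2)
            + real_integral (fun x => modulus (wderiv f x) ^+ 2)).

(* The closure of the test functions in H^1(0, L). *)
Definition inH10 f : Prop :=
  inH1 f /\ forall eps : R, 0 < eps ->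
    exists phi, test_function phi /\ H1norm (f - phi) < eps.

End Sobolev.

Definition state (R : realType) := (cfun R * cfun R * cfun R * cfun R)%type.

Section EnergySpace.
Context {R : realType}.
Variables L a : R.
Implicit Types U V F : state R.

Definition inEnergySpace U : Prop :=
  let: (u, v, y, z) := U in
  [/\ inH10 L u, inL2 L v, inH10 L y & inL2 L z].

Definition energy_dot U U1 : R[i] :=
  let: (u, v, y, z) := U in
  let: (u1, v1, y1, z1) := U1 in
  complex_integral L (fun x => v x * conjc (v1 x))
  + a%:C * complex_integral L (fun x => wderiv L u x * conjc (wderiv L u1 x))
  + complex_integral L (fun x => z x * conjc (z1 x))
  + complex_integral L (fun x => wderiv L y x * conjc (wderiv L y1 x)).

Definition energy_norm U : R := Num.sqrt (complex.Re (energy_dot U U)).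

Definition energy_eq U V : Prop := energy_norm (U - V) = 0.

(* The energy of U = (u, u_t, y, y_t). *)
Definition energy U : R :=
  let: (u, v, y, z) := U in
  2^-1 * real_integral L (fun x =>
    modulus (v x) ^+ 2 + a * modulus (wderiv L u x) ^+ 2
    + modulus (z x) ^+ 2 + modulus (wderiv L y x) ^+ 2).

(* Only the values S t for t >= 0 matter. *)
Definition C0_contraction_semigroup (S : R -> state R -> state R) : Prop :=
  (forall (t : R) U, 0 <= t -> inEnergySpace U -> inEnergySpace (S t U)) /\
  (forall (t : R) (k : R[i]) U V, 0 <= t -> inEnergySpace U -> inEnergySpace V ->
     energy_eq (S t (k *: U + V)) (k *: S t U + S t V)) /\
  (forall U, inEnergySpace U -> energy_eq (S 0 U) U) /\
  (forall (s t : R) U, 0 <= s -> 0 <= t -> inEnergySpace U ->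
     energy_eq (S (s + t) U) (S s (S t U))) /\
  (forall (t : R) U, 0 <= t -> inEnergySpace U ->
     energy_norm (S t U) <= energy_norm U) /\
  (forall U, inEnergySpace U ->
     energy_norm (S t U - U) @[t --> 0^'+] --> (0 : R)).

(* The operator A with domain [dom] is the infinitesimal generator of S. *)
Definition generates (dom : state R -> Prop) (A : state R -> state R)
    (S : R -> state R -> state R) : Prop :=
  forall U F, inEnergySpace U -> inEnergySpace F ->
    ((energy_norm ((h^-1)%:C *: (S h U - U) - F) @[h --> 0^'+] --> (0 : R))
     <-> (dom U /\ energy_eq F (A U))).

End EnergySpace.

Section WaveOperator.
Context {R : realType}.
Variables (L a : R) (b c d : R -> R).

(* a u_x + b v_x *)
Definition stress_u (u v : cfun R) : cfun R := fun x =>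
  a%:C * wderiv L u x + (b x)%:C * wderiv L v x.

(* y_x + d z_x *)
Definition stress_y (y z : cfun R) : cfun R := fun x =>
  wderiv L y x + (d x)%:C * wderiv L z x.

Definition domA (U : state R) : Prop :=
  let: (u, v, y, z) := U in
  inEnergySpace L U /\
  [/\ inH10 L v, inH10 L z,
      has_L2_derivative L (stress_u u v) & has_L2_derivative L (stress_y y z)].

Definition opA (U : state R) : state R :=
  let: (u, v, y, z) := U in
  (v,
   (fun x => wderiv L (stress_u u v) x - (c x)%:C * z x) : cfun R,
   z,
   (fun x => wderiv L (stress_y y z) x + (c x)%:C * v x) : cfun R).

Definition graph_norm (U : state R) : R :=
  energy_norm L a U + energy_norm L a (opA U).

End WaveOperator.

(* Main.v *)
(** A solution is differentiated and integrated in time until it belongs to a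
    chain of levels l_i = A^i X_0, i = 0, ..., 5, where the solution itself is
    level 3; real and imaginary parts evolve separately.  Multipliers supported
    in the damped interval, then a piecewise linear multiplier reaching across
    the coupling interval, then the products u_t y_t and u_x y_x, and finally
    multipliers vanishing at 0 and L, show that
      |l_3|^2 <= C (dissipation of the levels 2 to 5) + d/dt F,
    with F quadratic in the levels 1 to 4.  The condition |c_0| (c_2 - c_1) < 1
    is what allows the velocities of the two waves on the coupling interval to
    be controlled together.  The dissipation is minus one half of the derivative
    of the sum of the energies of the levels 1 to 4, and A^-1 is bounded, so
    integrating over (t/2, t), where the energy decreases, gives
    t |l_3(t)|^2 <= K (|l_3|^2 + |l_4|^2)(t/2).
    For U_0 in D(A) this is applied to (S(h) - 1)/h A^-1 U_0, which lies in
    D(A^2), and h tends to 0. *)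
Require Import Defs.
From mathcomp Require Import all_boot all_order all_algebra.
From mathcomp Require Import all_classical all_reals all_analysis.
From mathcomp Require Import complex ring lra measurable_realfun.
Set Implicit Arguments.
Unset Strict Implicit.
Unset Printing Implicit Defensive.
Import Order.TTheory GRing.Theory Num.Theory.
Import numFieldNormedType.Exports.
Local Open Scope classical_set_scope.
Local Open Scope ring_scope.

(** * Square-integrable real functions on (0, L) *)

(** The damping acts on [u] alone, on an interval disjoint from the coupling, so [y] is seen only
    through the coupling terms. The cross products make the integral of [c (y_t^2 - u_t^2)]
    negligible, which by itself bounds neither velocity. The multiplier equal to [c2 - x] on the
    coupling interval bounds [u_t^2] there by [(c0 (c2 - c1))^2] times [y_t^2], and a factor below 1
    closes the loop. Since [b] jumps, [u_x] need not be in H1; only the stress [u_x + b u_tx] is.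
    The multipliers for [u] therefore use the stress, and each use costs a viscous term of a higher
    level, which is why the levels reach 5. A level stores [u_x] and not [u]: the displacement of
    level i+1 is the velocity of level i, and level 0 supplies the displacement of level 1. States
    are representatives and [wderiv] is a choice, so linearity, the semigroup law and the equation
    hold only up to norm 0. *)

Section RealL2.
Context {R : realType} (L : R).
Implicit Types (f g h m : R -> R) (k : R).

Local Notation mu := (@lebesgue_measure R).
Local Notation D := (`]0, L[%classic : set (measurableTypeR R)).
Local Notation I := (real_integral L).

Definition meas f := measurable_fun D f.
Definition itg f := mu.-integrable D (fun x => (f x)%:E).
Definition L2 f := meas f /\ itg (fun x => f x * f x).
Definition bdd m := meas m /\ exists M, forall x : R, D x -> `|m x| <= M.
Definition normL2 f := Num.sqrt (I (fun x => f x * f x)).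

Let mD : measurable D. Proof. exact: measurable_itv. Qed.

Lemma itg_meas f : itg f -> meas f.
Proof. by case/integrableP => /measurable_EFinP. Qed.

Lemma eq_itg f g : (forall x : R, D x -> f x = g x) -> itg f -> itg g.
Proof. by move=> fg; apply: eq_integrable => // x /set_mem xD; rewrite fg. Qed.

Lemma eq_int f g : (forall x : R, D x -> f x = g x) -> I f = I g.
Proof. by move=> fg; apply: eq_Rintegral => x /set_mem; exact: fg. Qed.

Lemma itgD f g : itg f -> itg g -> itg (fun x => f x + g x).
Proof.
by move=> hf hg; exact: (integrableD mD hf hg).
Qed.

Lemma itgZ k f : itg f -> itg (fun x => k * f x).
Proof.
by move=> hf; exact: (integrableZl mD k hf).
Qed.

Lemma itgN f : itg f -> itg (fun x => - f x).
Proof. by move=> /(itgZ (-1)); apply: eq_itg => x _; rewrite mulN1r. Qed.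

Lemma itgB f g : itg f -> itg g -> itg (fun x => f x - g x).
Proof. by move=> hf /itgN; exact: itgD. Qed.

Lemma intD f g : itg f -> itg g -> I (fun x => f x + g x) = I f + I g.
Proof. by move=> hf hg; apply: RintegralD. Qed.

Lemma intZ k f : itg f -> I (fun x => k * f x) = k * I f.
Proof. by move=> hf; apply: RintegralZl. Qed.

Lemma intN f : itg f -> I (fun x => - f x) = - I f.
Proof.
by move=> hf; rewrite -mulN1r -intZ//; apply: eq_int => x _; rewrite mulN1r.
Qed.

Lemma intB f g : itg f -> itg g -> I (fun x => f x - g x) = I f - I g.
Proof. by move=> hf hg; rewrite intD ?intN//; exact: itgN. Qed.

Lemma int_le f g : itg f -> itg g -> (forall x : R, D x -> f x <= g x) ->
  I f <= I g.
Proof. by move=> hf hg fg; apply: le_Rintegral. Qed.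

Lemma int_ge0 f : (forall x : R, D x -> 0 <= f x) -> 0 <= I f.
Proof. by move=> f0; apply: Rintegral_ge0. Qed.

Lemma int0 : I (fun=> 0) = 0.
Proof. by rewrite /real_integral Rintegral_cst// mul0r. Qed.

Lemma itg_abs f : itg f -> itg (fun x => `|f x|).
Proof. by move=> hf; apply: (integrable_norm hf). Qed.

Lemma itg_le f g : meas f -> itg g -> (forall x : R, D x -> `|f x| <= g x) -> itg f.
Proof.
have mE h : meas h -> measurable_fun D (fun x => (h x)%:E).
  by move=> mh; apply/measurable_EFinP.
move=> mf hg fg; have mg := itg_meas hg.
have e h : (fun x => (h x)%:E) \_ D = (fun x => ((h \_ D) x)%:E).
  by apply/funext => x; rewrite /patch; case: ifP.
apply/(integrable_mkcond _ mD); move: hg => /(integrable_mkcond _ mD).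
apply: le_integrable => //.
- by apply/(measurable_restrictT _ mD); exact: mE.
- move=> x _; rewrite !e lee_fin /patch; case: ifPn => // /set_mem xD.
  exact: le_trans (fg _ xD) (ler_norm _).
Qed.

Lemma itg_cst k : itg (fun=> k).
Proof.
apply: measurable_bounded_integrable => //.
- by rewrite [X in (X < _)%E](lebesgue_measure_itv `]0, L[)/=; case: ifP => _;
    rewrite ?ltry// -EFinB ltry.
- exact: bounded_cst.
Qed.

Lemma measM f g : meas f -> meas g -> meas (fun x => f x * g x).
Proof. exact: measurable_funM. Qed.
Lemma measD f g : meas f -> meas g -> meas (fun x => f x + g x).
Proof. exact: measurable_funD. Qed.
Lemma measN f : meas f -> meas (fun x => - f x).
Proof. by move=> hf; apply: measurableT_comp. Qed.
Lemma measB f g : meas f -> meas g -> meas (fun x => f x - g x).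
Proof. by move=> hf hg; apply: measurable_funB. Qed.
Lemma meas_cst k : meas (fun=> k).
Proof. exact: measurable_cst. Qed.
Lemma eq_meas f g : (forall x : R, D x -> f x = g x) -> meas f -> meas g.
Proof. by move=> fg; apply: eq_measurable_fun => x /set_mem /fg. Qed.

Lemma L2_meas f : L2 f -> meas f. Proof. by case. Qed.

Lemma itgM f g : L2 f -> L2 g -> itg (fun x => f x * g x).
Proof.
move=> [mf hf] [mg hg]; apply: (itg_le _ (itgD hf hg)); first exact: measM.
move=> x _; rewrite normrM.
have := normr_ge0 (f x); have := normr_ge0 (g x).
rewrite -[f x * f x]ger0_norm -?expr2 ?sqr_ge0// normrX.
rewrite -[g x ^+ 2]ger0_norm ?sqr_ge0// normrX.
move: `|f x| `|g x| => a b; nra.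
Qed.

Lemma eq_L2 f g : (forall x : R, D x -> f x = g x) -> L2 f -> L2 g.
Proof.
move=> fg [mf hf]; split; first exact: eq_meas mf.
by apply: eq_itg hf => x xD; rewrite fg.
Qed.

Lemma L2D f g : L2 f -> L2 g -> L2 (fun x => f x + g x).
Proof.
move=> hf hg; split; first by apply: measD; apply: L2_meas.
have := itgD (itgD (itgM hf hf) (itgM hg hg)) (itgZ 2 (itgM hf hg)).
by apply: eq_itg => x _; ring.
Qed.

Lemma bddM_L2 m f : bdd m -> L2 f -> L2 (fun x => m x * f x).
Proof.
move=> [mm [M hM]] [mf hf]; split; first exact: measM.
apply: (itg_le _ (itgZ (M ^+ 2) hf)); first by do 2 apply: measM.
move=> x xD; have := hM _ xD; have := normr_ge0 (m x) => m0 mM.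
rewrite (_ : m x * f x * (m x * f x) = `|m x| ^+ 2 * (f x * f x)); last first.
  by rewrite real_normK ?num_real//; ring.
rewrite ger0_norm; last by rewrite -expr2 mulr_ge0 ?sqr_ge0.
rewrite -expr2.
by rewrite ler_wpM2r ?sqr_ge0// lerXn2r ?nnegrE// (le_trans m0).
Qed.

Lemma bdd_cst k : bdd (fun=> k).
Proof. by split; [exact: meas_cst|exists `|k|]. Qed.

Lemma bddD m f : bdd m -> bdd f -> bdd (fun x => m x + f x).
Proof.
move=> [mm [M hM]] [mf [N hN]]; split; first exact: measD.
exists (M + N) => x xD; apply: (le_trans (ler_normD _ _)).
by rewrite lerD ?hM ?hN.
Qed.

Lemma bddM m f : bdd m -> bdd f -> bdd (fun x => m x * f x).
Proof.
move=> [mm [M hM]] [mf [N hN]]; split; first exact: measM.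
by exists (M * N) => x xD; rewrite normrM ler_pM ?hM ?hN.
Qed.

Lemma bddN m : bdd m -> bdd (fun x => - m x).
Proof.
move=> [mm [M hM]]; split; first exact: measN.
by exists M => x xD; rewrite normrN hM.
Qed.

Lemma bdd_L2 m : bdd m -> L2 m.
Proof.
move=> hm; apply: (@eq_L2 (fun x => m x * 1)); first by move=> x; rewrite mulr1.
apply: bddM_L2 => //; split; first exact: meas_cst.
exact: itg_cst.
Qed.

Lemma L2Z k f : L2 f -> L2 (fun x => k * f x).
Proof. by apply: bddM_L2; exact: bdd_cst. Qed.

Lemma L2N f : L2 f -> L2 (fun x => - f x).
Proof. by move=> /(L2Z (-1)); apply: eq_L2 => x _; rewrite mulN1r. Qed.

Lemma L2B f g : L2 f -> L2 g -> L2 (fun x => f x - g x).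
Proof. by move=> hf /L2N; exact: L2D. Qed.

Lemma L2_cst k : L2 (fun=> k).
Proof. exact/bdd_L2/bdd_cst. Qed.

Lemma L2_itg f : L2 f -> itg f.
Proof.
move=> hf; apply: eq_itg (itgM (L2_cst 1) hf) => x _; exact: mul1r.
Qed.

Lemma bdd_indic (a b : R) : bdd (\1_(`]a, b[) : R -> R).
Proof.
split; first by apply: measurable_indic.
by exists 1 => x _; rewrite indicE; case: (_ \in _); rewrite ?normr1 ?normr0.
Qed.

Lemma meas_cont f : continuous f -> meas f.
Proof.
move=> cf; apply: measurable_funTS.
exact: continuous_measurable_fun.
Qed.

Lemma bdd_cont f : continuous f -> bdd f.
Proof.
move=> cf; split; first exact: meas_cont.
have : bounded_set (f @` `[0, L]%classic).
  apply: compact_bounded; apply: continuous_compact; last exact: segment_compact.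
  exact: continuous_subspaceT.
move=> /pinfty_ex_gt0[M M0 hM]; exists M => x xD.
by apply: (hM (f x)); exists x => //; apply: subset_itv_oo_cc xD.
Qed.

Lemma L2_cont f : continuous f -> L2 f.
Proof. by move/bdd_cont/bdd_L2. Qed.

Lemma int_sq_ge0 f : 0 <= I (fun x => f x * f x).
Proof. by apply: int_ge0 => x _; rewrite -expr2 sqr_ge0. Qed.

Lemma normL2_ge0 f : 0 <= normL2 f.
Proof. exact: sqrtr_ge0. Qed.

Lemma normL2_sq f : normL2 f ^+ 2 = I (fun x => f x * f x).
Proof. by rewrite sqr_sqrtr ?int_sq_ge0. Qed.

Lemma eq_normL2 f g : (forall x : R, D x -> f x = g x) -> normL2 f = normL2 g.
Proof. by move=> fg; congr Num.sqrt; apply: eq_int => x xD; rewrite fg. Qed.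

(** The integral of [(f - s g)^2] is nonnegative for every [s]; one well chosen [s] per case
    replaces the discriminant. *)
Lemma cauchy_schwarz f g : L2 f -> L2 g ->
  I (fun x => f x * g x) <= normL2 f * normL2 g.
Proof.
move=> hf hg; set p := I _.
have key (s : R) : 0 <= normL2 f ^+ 2 - 2 * s * p + s ^+ 2 * normL2 g ^+ 2.
  rewrite !normL2_sq /p -!intZ//; first last.
  - exact: itgM.
  - exact: itgM.
  rewrite -intB; first last.
  - exact/itgZ/itgM.
  - exact: itgM.
  rewrite -intD; first last.
  - exact/itgZ/itgM.
  - by apply: itgB; [|apply: itgZ]; exact: itgM.
  apply: int_ge0 => x _.
  rewrite (_ : _ + _ = (f x - s * g x) ^+ 2) ?sqr_ge0//; ring.
have f0 := normL2_ge0 f; have g0 := normL2_ge0 g.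
have [g1|g1] := eqVneq (normL2 g) 0.
  rewrite g1 mulr0 leNgt; apply/negP => p0.
  (* For this [s] the quadratic equals -1. *)
  have := key ((normL2 f ^+ 2 + 1) / (2 * p)).
  rewrite g1 expr0n/= mulr0 addr0.
  rewrite (_ : 2 * _ * p = normL2 f ^+ 2 + 1); last by field; rewrite gt_eqF.
  lra.
have {}g0 : 0 < normL2 g by rewrite lt_neqAle eq_sym g1.
(* Here the quadratic has the factor [|f| |g| - p], but its other factor vanishes with [|f|]. In
   that case [s = p / |g|^2] below forces [p = 0]. *)
have := key (normL2 f / normL2 g).
rewrite (_ : _ + _ = 2 * normL2 f / normL2 g * (normL2 f * normL2 g - p)); last first.
  by field.
have [f1|f1] := eqVneq (normL2 f) 0; last first.
  by rewrite pmulr_rge0 ?subr_ge0// divr_gt0// mulr_gt0// lt_neqAle eq_sym f1.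
move=> _; have := key (p / normL2 g ^+ 2).
rewrite f1 expr0n/= mul0r.
rewrite (_ : _ + _ = - (p / normL2 g) ^+ 2); last by field.
rewrite oppr_ge0 => h.
have : (p / normL2 g) ^+ 2 = 0 by apply/eqP; rewrite eq_le sqr_ge0 andbT.
by move/eqP; rewrite sqrf_eq0 mulf_eq0 invr_eq0 (negbTE g1) orbF => /eqP ->.
Qed.

Lemma normL2Z k f : L2 f -> normL2 (fun x => k * f x) = `|k| * normL2 f.
Proof.
move=> hf; rewrite /normL2 -sqrtr_sqr -sqrtrM ?sqr_ge0//; congr Num.sqrt.
rewrite -intZ; last exact: itgM.
by apply: eq_int => x _; ring.
Qed.

Lemma normL2N f : L2 f -> normL2 (fun x => - f x) = normL2 f.
Proof.
by move=> _; rewrite /normL2; congr Num.sqrt; apply: eq_int => x _; rewrite mulrNN.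
Qed.

Lemma normL2D f g : L2 f -> L2 g ->
  normL2 (fun x => f x + g x) <= normL2 f + normL2 g.
Proof.
move=> hf hg; rewrite -[leRHS]ger0_norm ?addr_ge0 ?normL2_ge0//.
rewrite -sqrtr_sqr ler_wsqrtr//.
have := cauchy_schwarz hf hg.
have -> : I (fun x => (f x + g x) * (f x + g x)) =
    normL2 f ^+ 2 + 2 * I (fun x => f x * g x) + normL2 g ^+ 2.
  rewrite !normL2_sq -intZ -?intD; try by do ?[apply: itgD|apply: itgZ|apply: itgM].
  by apply: eq_int => x _; ring.
by move=> ?; rewrite sqrrD !lerD2r lerD2l mulr2n -mulr2n -mulr_natl ler_pM2l.
Qed.

Lemma normL2B f g : L2 f -> L2 g ->
  normL2 (fun x => f x - g x) <= normL2 f + normL2 g.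
Proof. by move=> hf hg; rewrite -(normL2N hg); apply: normL2D => //; exact: L2N. Qed.

Lemma normL2_bddM m f M : bdd m -> 0 <= M -> (forall x : R, D x -> `|m x| <= M) ->
  L2 f -> normL2 (fun x => m x * f x) <= M * normL2 f.
Proof.
move=> hm M0 hM hf; rewrite -[M]ger0_norm// -normL2Z// ler_wsqrtr//.
apply: int_le.
- by apply: itgM; exact: bddM_L2.
- by apply: itgM; exact: L2Z.
move=> x xD; rewrite mulrACA [leRHS]mulrACA -!expr2 ler_wpM2r ?sqr_ge0//.
by rewrite -(real_normK (num_real (m x))) lerXn2r ?nnegrE ?hM.
Qed.

Lemma abs_int_le m f g M : bdd m -> 0 <= M -> (forall x : R, D x -> `|m x| <= M) ->
  L2 f -> L2 g -> `|I (fun x => m x * f x * g x)| <= M * normL2 f * normL2 g.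
Proof.
move=> hm M0 hM hf hg.
have hmf := bddM_L2 hm hf.
have key : forall h, L2 h -> I (fun x => m x * f x * h x) <= M * normL2 f * normL2 h.
  move=> h hh; apply: (le_trans (cauchy_schwarz hmf hh)).
  by rewrite ler_wpM2r ?normL2_ge0// normL2_bddM.
rewrite ler_norml key// andbT lerNl.
rewrite -(normL2N hg) -intN; last exact: itgM.
apply: le_trans (key _ (L2N hg)).
by rewrite le_eqVlt; apply/orP; left; apply/eqP/eq_int => x _; ring.
Qed.

Lemma normL2_cst k : 0 < L -> normL2 (fun=> k) = `|k| * Num.sqrt L.
Proof.
move=> L0; rewrite /normL2 /real_integral Rintegral_cst//.
rewrite [X in fine X](lebesgue_measure_itv `]0, L[)/= lte_fin L0 /= subr0.
by rewrite sqrtrM -?expr2 ?sqr_ge0// sqrtr_sqr.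
Qed.

Lemma normL2_eq0_int f g : L2 f -> L2 g -> normL2 f = 0 -> I (fun x => f x * g x) = 0.
Proof.
move=> hf hg f0; apply/eqP; rewrite -normr_le0.
rewrite (@eq_int _ (fun x => 1 * f x * g x)); last by move=> x _; rewrite mul1r.
apply: le_trans (abs_int_le (bdd_cst 1) ler01 _ hf hg) _.
  by move=> x _; rewrite normr1.
by rewrite f0 mulr0 mul0r.
Qed.

End RealL2.

(** * Density in L2 of continuous functions with compact support *)

Section Density.
Context {R : realType} (L : R).
Implicit Types (f g h m : R -> R) (k e x y M : R).

Local Notation mu := (@lebesgue_measure R).
Local Notation D := (`]0, L[%classic : set (measurableTypeR R)).
Local Notation I := (real_integral L).
Local Notation L2 := (L2 L).
Local Notation normL2 := (normL2 L).
Local Notation meas := (meas L).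

Let mD : measurable D. Proof. exact: measurable_itv. Qed.

(** Dominated convergence applied to the squares. The density arguments need a single good index,
    hence the existential form. *)
Lemma dominated_cvg0 (h : nat -> R -> R) g e :
  (forall n, meas (h n)) -> L2 g ->
  (forall n x, D x -> `|h n x| <= `|g x|) ->
  (forall x : R, D x -> h n x @[n --> \oo] --> (0 : R)) ->
  0 < e -> exists n, L2 (h n) /\ normL2 (h n) < e.
Proof.
move=> mh [mg hg] hle h0 e0.
have le2 n x : D x -> `|h n x * h n x| <= g x * g x.
  move=> xD; rewrite normrM -[leRHS]ger0_norm -?expr2 ?sqr_ge0//.
  by rewrite normrX lerXn2r ?nnegrE ?hle.
have hL n : L2 (h n).
  by split=> //; apply: (itg_le _ hg); [exact: measM|exact: le2].
have [|||||_ _] := @dominated_convergence _ _ _ mu D mD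
    (fun n x => (h n x * h n x)%:E) (cst 0%E) (fun x => (g x * g x)%:E).
- by move=> n; apply/measurable_EFinP; exact: measM.
- exact: measurable_cst.
- apply/aeW => x xD; apply: cvg_EFin; first by near=> n.
  by rewrite -[X in _ --> X](mulr0 (0 : R)); apply: cvgM; exact: h0.
- exact: hg.
- by apply/aeW => x n xD /=; rewrite lee_fin le2.
rewrite integral0 => /fine_cvgP[_] /cvgr0_norm_lt /(_ (e ^+ 2)).
rewrite exprn_gt0// => /(_ isT)[n _ /(_ n (leqnn n))] /= hn.
exists n; split => //; rewrite -(ltr_pXn2r (ltn0Sn 1)) ?nnegrE ?normL2_ge0 ?ltW//.
by rewrite normL2_sq; apply: le_lt_trans hn; exact: ler_norm.
Unshelve. all: by end_near. Qed.

Definition clip (M x : R) := Num.max (- M) (Num.min M x).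

Lemma clip_id M x : `|x| <= M -> clip M x = x.
Proof.
by rewrite ler_norml => /andP[h1 h2]; rewrite /clip min_r// max_r.
Qed.

Lemma clip_le M x : 0 <= M -> `|clip M x| <= M.
Proof.
move=> M0; rewrite ler_norml /clip le_max lexx /= ge_max ge_min lexx.
by rewrite andbT (le_trans _ M0)// oppr_le0.
Qed.

Lemma clip_lip M x y : 0 <= M -> `|x| <= M -> `|x - clip M y| <= `|x - y|.
Proof.
move=> M0; rewrite ler_norml => /andP[h1 h2]; rewrite /clip.
case: (leP M y) => hy.
  by rewrite max_r; [rewrite !ler0_norm|]; lra.
case: (leP (- M) y) => hy2; first exact: lexx.
by rewrite !ger0_norm; lra.
Qed.

Lemma clip_sub M x : 0 <= M -> `|x - clip M x| <= `|x|.
Proof.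
move=> M0; rewrite /clip.
case: (leP M x) => hy.
  by rewrite max_r; [rewrite !ger0_norm|]; lra.
case: (leP (- M) x) => hy2; first by rewrite subrr normr0.
by rewrite !ler0_norm; lra.
Qed.

Lemma continuous_clip M : continuous (clip M).
Proof.
move=> x; apply: (@continuous_max _ _ (cst (- M)) (fun y => Num.min M y)).
  exact: cst_continuous.
by apply: (@continuous_min _ _ (cst M) id); [exact: cst_continuous|].
Qed.

Lemma meas_clip M f : meas f -> meas (fun x => clip M (f x)).
Proof.
move=> mf; apply: (@measurableT_comp _ _ _ _ _ _ (clip M) _ f) => //.
by apply: continuous_measurable_fun; exact: continuous_clip.
Qed.

Lemma approx_bounded f e : L2 f -> 0 < e -> exists M,
  [/\ 0 <= M, L2 (fun x => clip M (f x)) & normL2 (fun x => f x - clip M (f x)) < e].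
Proof.
move=> hf e0; have mf := L2_meas hf.
have [|||||n [hn hne]] := @dominated_cvg0 (fun n x => f x - clip n%:R (f x)) f e.
- by move=> n; apply: measB => //; exact: meas_clip.
- by [].
- by move=> n x _; rewrite clip_sub.
- move=> x xD; apply: cvg_near_cst; near=> n; rewrite clip_id ?subrr//.
  by near: n; exact: nbhs_infty_ger.
- by [].
exists n%:R; split=> //.
by apply: (eq_L2 _ (L2B hf hn)) => x _ /=; ring.
Unshelve. all: by end_near. Qed.

(** The starting approximation is in L1. Truncating it at the bound [M] of [f] does not increase the
    error and keeps it below [2 M], so the squared L2 error is at most [2 M] times the L1 error. *)
Lemma approx_continuous_bounded f M e : 0 <= M -> meas f ->
  (forall x : R, `|f x| <= M) -> 0 < e ->
  exists g, continuous g /\ normL2 (fun x => f x - g x) < e.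
Proof.
move=> M0 mf fM e0.
have bf : bdd L f by split => //; exists M.
have hf := bdd_L2 bf.
have [] := @approximation_continuous_integrable R D f mD _ (L2_itg hf).
  by rewrite [X in (X < _)%E](lebesgue_measure_itv `]0, L[)/=; case: ifP => _;
      rewrite ?ltry// -EFinB ltry.
move=> g_ [cg ig] /fine_cvgP[_] /cvgr0_norm_lt /(_ (e ^+ 2 / (2 * M + 1))).
rewrite divr_gt0 ?exprn_gt0 ?ltr_wpDl ?mulr_ge0// => /(_ isT)[n _ /(_ n (leqnn n))] /= hn.
exists (fun x => clip M (g_ n x)).
have cc : continuous (fun x => clip M (g_ n x)).
  by move=> x; apply: continuous_comp; [exact: cg|exact: continuous_clip].
split => //.
have hfc : L2 (fun x => f x - clip M (g_ n x)) by apply: L2B => //; exact: L2_cont.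
have ifg : itg L (fun x => `|f x - g_ n x|).
  by apply: itg_abs; apply: itgB; [exact: L2_itg|exact: ig].
rewrite -(ltr_pXn2r (ltn0Sn 1)) ?nnegrE ?normL2_ge0 ?ltW// normL2_sq.
apply: (@le_lt_trans _ _ (I (fun x => 2 * M * `|f x - g_ n x|))).
  apply: int_le; [exact: itgM|exact: itgZ|move=> x xD].
  rewrite -[leLHS]ger0_norm -?expr2 ?sqr_ge0// expr2 normrM.
  rewrite ler_pM ?clip_lip ?fM//.
  rewrite (le_trans (ler_normB _ _))// mulr_natl mulr2n lerD ?fM//.
  exact: clip_le.
rewrite intZ//.
have M1 : 0 < 2 * M + 1 by rewrite ltr_wpDl ?mulr_ge0.
rewrite ltr_pdivlMr// in hn; apply: le_lt_trans hn.
rewrite mulrC ler_pM ?mulr_ge0 ?int_ge0//; last by lra.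
exact: ler_norm.
Qed.

(** A trapezoid whose sides lie between the distances [1/(n+1)] and [2/(n+1)] from the ends. *)
Definition cutoff (n : nat) (x : R) := clip 1 (Num.max 0 (n.+1%:R * Num.min x (L - x) - 1)).

Lemma continuous_cutoff n : continuous (cutoff n).
Proof.
move=> x; rewrite (_ : cutoff n = clip 1 \o (fun x => Num.max 0 (n.+1%:R * Num.min x (L - x) -
    1)))//.
apply: continuous_comp; last exact: continuous_clip.
apply: (@continuous_max _ _ (cst 0) _); first exact: cst_continuous.
apply: cvgB; last exact: cvg_cst.
apply: cvgM; first exact: cvg_cst.
apply: (@continuous_min _ _ id (fun x => L - x)); first by [].
by apply: cvgB => //; exact: cvg_cst.
Qed.

Lemma cutoff_le n x : 0 <= cutoff n x <= 1.
Proof.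
rewrite /cutoff /clip; set y := Num.max 0 _.
have y0 : 0 <= y by rewrite /y le_max lexx.
by rewrite ge_max le_max !le_min y0 ler01 orbT/= ge_min lexx andbT; lra.
Qed.

Lemma cutoff_out n x : x \notin `[n.+1%:R^-1, L - n.+1%:R^-1] -> cutoff n x = 0.
Proof.
have n0 : 0 < n.+1%:R^-1 :> R by rewrite invr_gt0.
move=> hx; rewrite /cutoff max_l ?clip_id ?normr0//.
rewrite subr_le0 mulrC -ler_pdivlMr// mul1r ge_min; move: hx.
move: n0; move: (n.+1%:R^-1) => k k0.
by rewrite in_itv/= negb_and -!ltNge => /orP[h|h]; apply/orP; [left|right]; lra.
Qed.

Lemma cutoff_in n x : 2 * n.+1%:R^-1 <= x <= L - 2 * n.+1%:R^-1 -> cutoff n x = 1.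
Proof.
have n0 : 0 < n.+1%:R^-1 :> R by rewrite invr_gt0.
move=> /andP[h1 h2]; rewrite /cutoff.
have h : 2 <= n.+1%:R * Num.min x (L - x).
  rewrite mulrC -ler_pdivrMr// le_min; move: n0 h1 h2; move: (n.+1%:R^-1) => k *.
  by apply/andP; split; lra.
rewrite max_r; last by lra.
by rewrite /clip min_l ?max_r//; lra.
Qed.

Definition cc g := continuous g /\ exists alpha beta : R,
  [/\ 0 < alpha, beta < L & forall x, x \notin `[alpha, beta] -> g x = 0].

(** Three errors of at most [e / 3]: truncation, continuous approximation, cutting off near the
    ends. *)
Lemma dense_cc f e : L2 f -> 0 < e -> exists g, cc g /\ normL2 (fun x => f x - g x) < e.
Proof.
move=> hf e0; have e3 : 0 < e / 3 by rewrite divr_gt0.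
have [M [M0 hM hMe]] := approx_bounded hf e3.
have [g [cg hg]] := approx_continuous_bounded M0 (L2_meas hM) (fun x => clip_le _ M0) e3.
have hL := L2_cont L cg.
have [|||||n [hn hne]] := @dominated_cvg0 (fun n x => g x - cutoff n x * g x) g (e / 3).
- move=> n; apply: measB; first exact: L2_meas.
  apply: measM; last exact: L2_meas.
  by apply: meas_cont; exact: continuous_cutoff.
- by [].
- move=> n x _; rewrite -{1}[g x]mul1r -mulrBl normrM ler_piMl//.
  by have /andP[h1 h2] := cutoff_le n x; rewrite ger0_norm; lra.
- move=> x; rewrite /= in_itv/= => /andP[x0 xL].
  have m0 : 0 < Num.min x (L - x) / 2 by rewrite divr_gt0// lt_min x0 subr_gt0.
  have : \forall n \near \oo, n.+1%:R^-1 < Num.min x (L - x) / 2 :> R.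
    by near=> n; near: n; exact: near_infty_natSinv_lt (PosNum m0).
  move=> nn; apply: cvg_near_cst; move: nn; apply: filterS => n hn;
      rewrite cutoff_in ?mul1r ?subrr//.
  move: hn; move: (n.+1%:R^-1) => k.
  by rewrite ltr_pdivlMr// lt_min => /andP[h1 h2]; apply/andP; split; lra.
- by [].
exists (fun x => cutoff n x * g x); split; first split.
- by move=> x; apply: (@continuousM _ _ (cutoff n)); [exact: continuous_cutoff|exact: cg].
- exists n.+1%:R^-1, (L - n.+1%:R^-1); split; first by rewrite invr_gt0.
    by rewrite gtrBl invr_gt0.
  by move=> x /cutoff_out ->; rewrite mul0r.
have -> : normL2 (fun x => f x - cutoff n x * g x) =
    normL2 (fun x => (f x - clip M (f x)) + ((clip M (f x) - g x) + (g x - cutoff n x * g x))).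
  by apply: eq_normL2 => x _; ring.
apply: le_lt_trans (normL2D (L2B hf hM) (L2D (L2B hM hL) hn)) _.
have := normL2D (L2B hM hL) hn.
move: (normL2 _) (normL2 _) hMe (normL2 _) hg (normL2 _) hne => a b c d h1 h2 h3; lra.
Unshelve. all: by end_near. Qed.

End Density.

(** * Calculus of C1 functions *)

Section C1.
Context {R : realType}.
Implicit Types (f g : R -> R) (k x : R).

Lemma C1_is_derive f x : C1 f -> is_derive x 1 f (derive1 f x).
Proof. by move=> [df _]; rewrite derive1E; apply: derivableP; exact: df. Qed.

Lemma C1_of f g : continuous g -> (forall x, is_derive x 1 f (g x)) ->
  C1 f /\ derive1 f = g.
Proof.
move=> cg df; have e : derive1 f = g.
  by apply/funext => x; rewrite derive1E; exact: (@derive_val _ _ _ _ _ _ _ (df x)).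
split=> //; split; last by rewrite e.
by move=> x; have [] := df x.
Qed.

Lemma C1_cont f : C1 f -> continuous f.
Proof.
move=> [df _] x; apply: differentiable_continuous.
by apply/derivable1_diffP; exact: df.
Qed.

Lemma C1_dcont f : C1 f -> continuous (derive1 f). Proof. by case. Qed.

Lemma C1D f g : C1 f -> C1 g -> C1 (fun x => f x + g x) /\
  derive1 (fun x => f x + g x) = (fun x => derive1 f x + derive1 g x).
Proof.
move=> hf hg; apply: C1_of => x.
  by apply: cvgD; apply: C1_dcont.
by apply: is_deriveD; exact: C1_is_derive.
Qed.

Lemma C1M f g : C1 f -> C1 g -> C1 (fun x => f x * g x) /\
  derive1 (fun x => f x * g x) = (fun x => derive1 f x * g x + f x * derive1 g x).
Proof.
move=> hf hg; apply: C1_of => x.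
  by apply: cvgD; apply: cvgM; do ?[exact: C1_dcont|exact: C1_cont].
apply: (@is_derive_eq _ _ _ _ _ _ _ _ (is_deriveM (C1_is_derive x hf) (C1_is_derive x hg))).
by rewrite addrC /GRing.scale/= [g x * _]mulrC.
Qed.

Lemma C1_cst k : C1 (fun=> k) /\ derive1 (fun=> k) = (fun=> 0 : R).
Proof. by apply: C1_of => x; exact: cvg_cst. Qed.

Lemma C1_id : C1 (fun x => x) /\ derive1 (fun x : R => x) = (fun=> 1).
Proof. by apply: C1_of => x; exact: cvg_cst. Qed.

Lemma C1Z k f : C1 f -> C1 (fun x => k * f x) /\
  derive1 (fun x => k * f x) = (fun x => k * derive1 f x).
Proof.
move=> hf; have [h1 h2] := C1_cst k; have [h3 h4] := C1M h1 hf.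
by split => //; rewrite h4 h2; apply/funext => x; rewrite mul0r add0r.
Qed.

End C1.

(** * The fundamental theorem of calculus and piecewise linear weights *)

Section FTC.
Context {R : realType} (L : R).
Implicit Types (f g h m : R -> R) (k e x y a b : R).

Local Notation mu := (@lebesgue_measure R).
Local Notation D := (`]0, L[%classic : set (measurableTypeR R)).
Local Notation I := (real_integral L).
Local Notation L2 := (L2 L).
Local Notation normL2 := (normL2 L).
Local Notation meas := (meas L).

Lemma integrable_cont f a b : continuous f -> mu.-integrable `[a, b] (EFin \o f).
Proof.
move=> cf; apply: continuous_compact_integrable; first exact: segment_compact.
exact: continuous_subspaceT.
Qed.

Lemma ftc_cc f a b : C1 f -> a < b ->
  \int[mu]_(x in `[a, b]) derive1 f x = f b - f a.
Proof.
move=> hf ab; rewrite /Rintegral (@continuous_FTC2 _ _ f)//.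
- exact/continuous_subspaceT/C1_dcont.
- split; [|apply: cvg_at_right_filter|apply: cvg_at_left_filter].
  + by move=> x _; case: hf.
  + exact: C1_cont.
  + exact: C1_cont.
Qed.

Lemma ftc_oo f a b : C1 f -> a <= b ->
  \int[mu]_(x in `]a, b[) derive1 f x = f b - f a.
Proof.
move=> hf; rewrite le_eqVlt => /predU1P[->|ab].
  by rewrite set_itv_ge ?bnd_simp ?ltxx// Rintegral_set0 subrr.
rewrite -ftc_cc// /Rintegral (integral_itv_bndoo true false)//.
apply/measurable_EFinP; apply: measurable_funTS; apply: continuous_measurable_fun.
exact: C1_dcont.
Qed.

Lemma ftc f : 0 <= L -> C1 f -> I (derive1 f) = f L - f 0.
Proof. by move=> L0 hf; exact: ftc_oo. Qed.

Lemma int_split f a : itg L f -> 0 <= a -> a < L ->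
  I f = \int[mu]_(x in `]0, a[) f x + \int[mu]_(x in `]a, L[) f x.
Proof.
move=> hf a0 aL; have h1 : mu.-integrable `]0, a] (EFin \o f).
  by apply: integrableS hf => //; apply: subset_itvl; rewrite bnd_simp.
rewrite -(@Rintegral_itvB _ f (BRight 0) (BLeft L) a)// addrC.
rewrite -(@Rintegral_itv_bndo_bndc _ _ _ _ _) ?subrK//.
by apply: integrableS h1 => //; apply: subset_itvl; rewrite bnd_simp.
Qed.

Lemma int_split3 f a b : itg L f -> 0 <= a -> a <= b -> b < L ->
  I f = \int[mu]_(x in `]0, a[) f x + \int[mu]_(x in `]a, b[) f x
        + \int[mu]_(x in `]b, L[) f x.
Proof.
move=> hf a0 ab bL.
have b0 := le_trans a0 ab; have aL := le_lt_trans ab bL.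
have ha : mu.-integrable `]a, L[ (EFin \o f).
  by apply: integrableS hf => //; apply: subset_itvr; rewrite bnd_simp.
have hb : mu.-integrable `]a, b] (EFin \o f).
  by apply: integrableS ha => //; apply: subset_itvl; rewrite bnd_simp.
rewrite (int_split hf a0 aL) -addrA; congr (_ + _).
rewrite -(@Rintegral_itvB _ f (BRight a) (BLeft L) b)// addrC.
rewrite -(@Rintegral_itv_bndo_bndc _ _ _ _ _) ?subrK//.
by apply: integrableS hb => //; apply: subset_itvl; rewrite bnd_simp.
Qed.

Lemma eq_Rint f g a b : (forall x, a < x < b -> f x = g x) ->
  \int[mu]_(x in `]a, b[) f x = \int[mu]_(x in `]a, b[) g x.
Proof. by move=> fg; apply: eq_Rintegral => x; rewrite inE/= in_itv/= => /fg. Qed.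

Lemma int_oo0 a b : \int[mu]_(x in `]a, b[) (0 : R) = 0.
Proof. by rewrite Rintegral_cst ?mul0r//; exact: measurable_itv. Qed.

Lemma ftc_indic f x : C1 f -> 0 < x < L ->
  I (fun y => \1_(`]0, x[) y * derive1 f y) = f x - f 0.
Proof.
move=> hf /andP[x0 xL]; rewrite (int_split _ (ltW x0) xL); last first.
  by apply: itgM; [exact/bdd_L2/bdd_indic|exact/L2_cont/C1_dcont].
rewrite (eq_Rint (a := 0) (g := derive1 f)); last first.
  by move=> y hy; rewrite indicE mem_set ?mul1r//= in_itv/= hy.
rewrite (eq_Rint (a := x) (g := fun=> 0)) ?int_oo0 ?addr0 ?ftc_oo// ?ltW//.
move=> y /andP[hy _]; rewrite indicE memNset ?mul0r//= in_itv/=.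
by apply/negP; rewrite negb_and -!leNgt (ltW hy) orbT.
Qed.

Definition ramp a b x : R := Num.min (Num.max x a) b.

Lemma continuous_ramp a b : continuous (ramp a b).
Proof.
move=> x; apply: (@continuous_min _ _ (fun x => Num.max x a) (fun=> b)).
  by apply: (@continuous_max _ _ id (fun=> a)) => //; exact: cvg_cst.
exact: cvg_cst.
Qed.

Lemma rampl a b x : a <= b -> x <= a -> ramp a b x = a.
Proof. by move=> ab xa; rewrite /ramp max_r// min_l. Qed.
Lemma rampm a b x : a <= x <= b -> ramp a b x = x.
Proof. by move=> /andP[ax xb]; rewrite /ramp max_l// min_l. Qed.
Lemma rampr a b x : a <= b -> b <= x -> ramp a b x = b.
Proof. by move=> ab bx; rewrite /ramp max_l ?min_r// (le_trans ab). Qed.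

(** On the three subintervals the integrand is the derivative of [a f], [x f] and [b f]; the inner
    boundary values telescope. *)
Lemma ramp_ibp f a b : C1 f -> 0 <= a -> a <= b -> b < L ->
  I (fun x => ramp a b x * derive1 f x + \1_(`]a, b[) x * f x) = b * f L - a * f 0.
Proof.
move=> hf a0 ab bL; have cf := C1_cont hf; have cdf := C1_dcont hf.
rewrite (int_split3 _ a0 ab bL); last first.
  apply: itgD; apply: itgM; do ?exact: L2_cont.
    by apply/L2_cont; exact: continuous_ramp.
  exact/bdd_L2/bdd_indic.
have [ha da] := C1Z a hf; have [hb db] := C1Z b hf.
have [hi di] := @C1_id R; have [hm dm] := C1M hi hf.
rewrite (eq_Rint (a := 0) (g := derive1 (fun x => a * f x))); last first.
  move=> x /andP[_ xa]; rewrite da rampl// ?ltW// indicE memNset ?mul0r ?addr0//=.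
  by rewrite in_itv/=; apply/negP; rewrite ltNge (ltW xa).
rewrite [X in _ + X + _](eq_Rint (g := derive1 (fun x => x * f x))); last first.
  move=> x /andP[ax xb]; rewrite dm di rampm ?indicE ?mem_set/= ?in_itv/= ?ax ?xb ?(ltW ax) ?ltW//.
  by rewrite addrC.
rewrite [X in _ + X](eq_Rint (g := derive1 (fun x => b * f x))); last first.
  move=> x /andP[bx _]; rewrite db rampr// ?ltW// indicE memNset ?mul0r ?addr0//=.
  by rewrite in_itv/=; apply/negP; rewrite [x < b]ltNge (ltW bx) andbF.
by rewrite !ftc_oo ?(ltW bL)//; ring.
Qed.

(* [g] is the weak derivative of [f], boundary values included. *)
Definition weight f g := [/\ bdd L f, bdd L g &
  forall h, C1 h -> I (fun x => f x * derive1 h x + g x * h x) = f L * h L - f 0 * h 0].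

Lemma weight_ramp a b : 0 <= a -> a <= b -> b < L -> weight (ramp a b) (\1_(`]a, b[)).
Proof.
move=> a0 ab bL; split; [exact/bdd_cont/continuous_ramp|exact: bdd_indic|].
by move=> h hh; rewrite ramp_ibp// (@rampl a b 0)// (@rampr a b L)// ltW.
Qed.

Lemma weight_id : 0 <= L -> weight (fun x => x) (fun=> 1).
Proof.
move=> L0; split; [by apply: bdd_cont => x|exact: bdd_cst|move=> h hh].
have [hi di] := @C1_id R; have [hm dm] := C1M hi hh.
rewrite -(ftc L0 hm) dm di; apply: eq_int => x _; ring.
Qed.

Lemma weight_cst k : 0 <= L -> weight (fun=> k) (fun=> 0).
Proof.
move=> L0; split; [exact: bdd_cst|exact: bdd_cst|move=> h hh].
have [hm dm] := C1Z k hh.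
rewrite -(ftc L0 hm) dm; apply: eq_int => x _; ring.
Qed.

(** Together with constants, the identity and ramps this yields all the piecewise linear multipliers
    used later. *)
Lemma weight_comb k f f' g g' : weight f f' -> weight g g' ->
  weight (fun x => f x + k * g x) (fun x => f' x + k * g' x).
Proof.
move=> [bf bf' hf] [bg bg' hg].
split; [by apply: bddD => //; apply: bddM => //; exact: bdd_cst..|move=> h hh].
have ch := L2_cont L (C1_cont hh); have cdh := L2_cont L (C1_dcont hh).
have i1 : itg L (fun x => f x * derive1 h x + f' x * h x).
  by apply: itgD; apply: itgM => //; exact: bdd_L2.
have i2 : itg L (fun x => g x * derive1 h x + g' x * h x).
  by apply: itgD; apply: itgM => //; exact: bdd_L2.
transitivity (I (fun x => (f x * derive1 h x + f' x * h x)
    + k * (g x * derive1 h x + g' x * h x))); first by apply: eq_int => x _; ring.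
by rewrite intD ?intZ ?hf ?hg//; [ring|exact: itgZ].
Qed.

End FTC.

(** * Weak derivatives in one variable *)

Section WeakDerivative.
Context {R : realType} (L : R).
Implicit Types (f g h m u p s t phi psi : R -> R) (k e x y a b : R).

Local Notation mu := (@lebesgue_measure R).
Local Notation D := (`]0, L[%classic : set (measurableTypeR R)).
Local Notation I := (real_integral L).
Local Notation L2 := (L2 L).
Local Notation normL2 := (normL2 L).
Local Notation meas := (meas L).

Lemma eq0_of_le_eps k a : (forall e, 0 < e -> `|a| <= k * e) -> a = 0.
Proof.
move=> h; apply/eqP/negPn/negP => a0.
have {}a0 : 0 < `|a| by rewrite normr_gt0.
have k1 : 0 < 2 * (`|k| + 1) by rewrite mulr_gt0// ltr_wpDl.
have := h (`|a| / (2 * (`|k| + 1))) (divr_gt0 a0 k1).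
rewrite leNgt => /negP; apply; rewrite mulrCA gtr_pMr// ltr_pdivrMr//.
by have := ler_norm k; have := normr_ge0 k; lra.
Qed.

Definition rtest phi := C1 phi /\ exists alpha beta : R,
  [/\ 0 < alpha, beta < L & forall x, x \notin `[alpha, beta] -> phi x = 0].

Definition wd f g := forall phi, rtest phi ->
  I (fun x => f x * derive1 phi x) = - I (fun x => g x * phi x).

Definition H1 f g := [/\ L2 f, L2 g & wd f g].

(** The pair is approximated, not only [f]; that [g] is then the weak derivative of [f] is
    [H10_H1]. *)
Definition H10 f g := [/\ L2 f, L2 g & forall e, 0 < e ->
  exists phi, [/\ rtest phi, normL2 (fun x => f x - phi x) < e &
    normL2 (fun x => g x - derive1 phi x) < e]].

Lemma out_itv x a b : (x < a) || (b < x) -> x \notin `[a, b].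
Proof. by rewrite in_itv/= negb_and -!ltNge. Qed.

Lemma rtest0 phi : rtest phi -> phi 0 = 0.
Proof. by move=> [_ [a [b [a0 bL ->]]]]//; apply: out_itv; rewrite a0. Qed.

Lemma rtestL phi : rtest phi -> phi L = 0.
Proof. by move=> [_ [a [b [a0 bL ->]]]]//; apply: out_itv; rewrite bL orbT. Qed.

Lemma rtest_H10 phi : rtest phi -> H10 phi (derive1 phi).
Proof.
move=> hphi; have [h1 _] := hphi.
split; [exact/L2_cont/C1_cont|exact/L2_cont/C1_dcont|move=> e e0; exists phi].
have z g : normL2 (fun x => g x - g x) < e.
  rewrite (@eq_normL2 _ _ _ (fun=> 0 * 0)); last by move=> x _; rewrite subrr mul0r.
  by rewrite normL2Z ?normr0 ?mul0r//; exact: L2_cst.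
by split.
Qed.

(** Starting at [-oo] makes the primitive differentiable on the whole line, as [C1] demands; it is
    used for compactly supported [g]. *)
Definition prim g x := \int[mu]_(t in `]-oo, x]) g t.

Lemma cc_integrable g x : cc L g -> mu.-integrable `]-oo, x] (EFin \o g).
Proof.
move=> [cg [a [b [_ _ h]]]].
apply: (@integrableS _ _ _ mu setT) => //.
have mI : measurable (`[a, b]%classic : set (measurableTypeR R)) by exact: measurable_itv.
have /(integrable_mkcond _ mI) := integrable_cont a b cg.
apply: eq_integrable => // y _; rewrite /patch; case: ifPn => //.
by rewrite notin_setE/= => /negP /h /= ->.
Qed.

Lemma prim_derive g : cc L g -> C1 (prim g) /\ derive1 (prim g) = g.
Proof.
move=> hg; apply: C1_of => [|x]; first by case: hg.
have [] := @continuous_FTC1 R g -oo%O x (x + 1).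
- by rewrite ltrDl.
- exact: cc_integrable.
- by rewrite /Order.lt/=.
- by case: hg => + _; exact.
rewrite -/(prim g) => d1 d2.
by apply: (DeriveDef (f := prim g)); [exact: d1|rewrite -derive1E].
Qed.

Lemma primE0 g a x : (forall x, x < a -> g x = 0) -> x < a -> prim g x = 0.
Proof.
move=> h xa; rewrite /prim (@eq_Rintegral _ _ _ _ _ (fun=> 0)).
  by rewrite Rintegral_cst ?mul0r//; exact: measurable_itv.
by move=> y; rewrite inE/= in_itv/= => yx; rewrite h// (le_lt_trans yx).
Qed.

Lemma primB g x y : cc L g -> x <= y ->
  prim g y - prim g x = \int[mu]_(t in `]x, y[) g t.
Proof. by move=> /prim_derive[h1 {3}<-] xy; rewrite ftc_oo. Qed.

Hypothesis L0 : 0 < L.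

Local Ltac lra_L := have := L0; lra.
Local Ltac nra_L := have := L0; nra.

(** To the right of the support the primitive is constant, and the zero mean makes this constant
    0. *)
Lemma prim_rtest g : cc L g -> I g = 0 -> rtest (prim g).
Proof.
move=> hg g0; have [c1 d1] := prim_derive hg; split => //.
have [cg [a [b [a0 bL h]]]] := hg.
have lt0 x : x < a -> prim g x = 0.
  by apply: primE0 => z za; rewrite h// out_itv// za.
exists a, b; split => // x; rewrite in_itv/= negb_and -!ltNge => /orP[/lt0//|bx].
have gt b' : b < b' -> forall y, b' <= y -> prim g y = prim g b'.
  move=> bb y b'y; apply/eqP; rewrite -subr_eq0 primB// (@eq_Rint _ _ (fun=> 0));
      first by rewrite int_oo0.
  by move=> z /andP[bz _]; rewrite h// out_itv// (lt_trans bb bz) orbT.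
have pL : prim g L = 0.
  by have := primB hg (ltW L0); rewrite (lt0 0 a0) subr0 => ->.
case: (leP x L) => xL; last by rewrite (gt L)// ltW.
by rewrite -(gt x bx L xL).
Qed.

(** A fixed tent of positive integral, subtracted to correct means. *)
Definition bump (x : R) := Num.max 0 (Num.min (x - L / 3) (2 * L / 3 - x)).

Lemma bump_cc : cc L bump.
Proof.
split.
  move=> x; apply: (@continuous_max _ _ (fun=> 0) (fun x => Num.min (x - L / 3) (2 * L / 3 - x))).
    exact: cvg_cst.
  apply: (@continuous_min _ _ (fun x => x - L / 3) (fun x => 2 * L / 3 - x));
    by apply: cvgB => //; exact: cvg_cst.
exists (L / 3), (2 * L / 3); split; [by rewrite divr_gt0|lra_L|move=> x].
rewrite in_itv/= negb_and -!ltNge => h; rewrite /bump max_l// ge_min.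
by case/orP: h => h; apply/orP; [left|right]; lra_L.
Qed.

(** Were the integral 0, the primitive would be monotone and vanish at 0 and [L], hence vanish in
    between, although its derivative at [L / 2] is [L / 6]. *)
Lemma bump_gt0 : 0 < I bump.
Proof.
have [cb _] := bump_cc; have ib := L2_itg (L2_cont L cb).
have b0 x : 0 <= bump x by rewrite /bump le_max lexx.
rewrite lt_neqAle eq_sym int_ge0// andbT; apply/eqP => i0.
have hr : rtest (prim bump) by apply: prim_rtest => //; exact: bump_cc.
have [_ dp] := prim_derive bump_cc; have [hc _] := hr.
have pc y : 0 <= y -> y <= L -> prim bump y = 0.
  have mono x z : x <= z -> prim bump x <= prim bump z.
    move=> xz; rewrite -subr_ge0 primB//; last exact: bump_cc.
    exact: Rintegral_ge0.
  move=> y0 yL; have h1 := mono _ _ y0; have h2 := mono _ _ yL.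
  by apply/eqP; rewrite eq_le -{1}(rtestL hr) h2 /= -{1}(rtest0 hr).
have h2 : L / 2 \in `]0, L[ by rewrite in_itv/=; lra_L.
have : derive1 (prim bump) (L / 2) = 0.
  rewrite -(@derive1_cst R _ (0 : R) (L / 2)) !derive1E; apply: near_eq_derive.
  near=> z; apply: pc; apply: ltW; near: z.
    by apply: lt_nbhsr; lra_L.
  by apply: lt_nbhsl; lra_L.
rewrite dp /bump; rewrite max_r ?le_min; last by apply/andP; split; lra_L.
by rewrite /Num.min; case: ifP => _; lra_L.
Unshelve. all: by end_near. Qed.

Lemma dense_cc0 f e : L2 f -> I f = 0 -> 0 < e ->
  exists g, [/\ cc L g, I g = 0 & normL2 (fun x => f x - g x) < e].
Proof.
move=> hf f0 e0; have [cb hb] := bump_cc; have b0 := bump_gt0.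
have hbL := L2_cont L cb.
(* As [f] has mean 0, [|I g|] is at most [|1| |f - g|]; the second term of [K] is the resulting cost
   of the mean correction. *)
pose K := 1 + normL2 (fun=> 1) * normL2 bump / I bump.
have K1 : 0 < K.
  by rewrite ltr_wpDr// divr_ge0 ?mulr_ge0 ?normL2_ge0// ltW.
have [g [[cg hg] hge]] := dense_cc hf (divr_gt0 e0 K1).
have gL := L2_cont L cg; pose r := I g / I bump.
exists (fun x => g x - r * bump x); split.
- split.
    by move=> x; apply: cvgB; [exact: cg|apply: cvgM; [exact: cvg_cst|exact: cb]].
  have [a [b [a0 bL h]]] := hg; have [a' [b' [a'0 b'L h']]] := hb.
  exists (Num.min a a'), (Num.max b b'); split.
  + by rewrite lt_min a0.
  + by rewrite gt_max bL.
  + move=> x; rewrite in_itv/= negb_and -!ltNge lt_min gt_max => hx.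
    rewrite h ?h' ?mulr0 ?subrr// out_itv//.
      by case/orP: hx => /andP[h1 h2]; rewrite ?h1 ?h2 ?orbT.
    by case/orP: hx => /andP[h1 h2]; rewrite ?h1 ?h2 ?orbT.
- by rewrite intB ?intZ ?/r ?divfK ?subrr ?gt_eqF//; do ?apply: itgZ; exact: L2_itg.
- apply: (@le_lt_trans _ _ (K * normL2 (fun x => f x - g x))); last first.
    by rewrite mulrC -ltr_pdivlMr.
  have -> : normL2 (fun x => f x - (g x - r * bump x)) =
     normL2 (fun x => (f x - g x) + r * bump x) by apply: eq_normL2 => x _; ring.
  have hfg := L2B hf gL.
  apply: (le_trans (normL2D hfg (L2Z r hbL))).
  rewrite /K mulrDl mul1r lerD2l normL2Z//.
  rewrite /r normrM normfV [`|I bump|]gtr0_norm// mulrAC [leRHS]mulrAC.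
  rewrite ler_pM2r ?invr_gt0// mulrAC ler_wpM2r ?normL2_ge0//.
  have -> : I g = - I (fun x => 1 * (f x - g x) * 1).
    rewrite (@eq_int _ L (fun x => 1 * (f x - g x) * 1) (fun x => f x - g x)); last first.
      by move=> x _; rewrite mul1r mulr1.
    by rewrite intB ?f0 ?sub0r ?opprK//; exact: L2_itg.
  rewrite normrN mulrC; have := abs_int_le (bdd_cst L 1) ler01 _ hfg (L2_cst L 1).
  by rewrite mul1r; apply => x _; rewrite normr1.
Qed.

Lemma dense_deriv f e : L2 f -> I f = 0 -> 0 < e ->
  exists phi, rtest phi /\ normL2 (fun x => f x - derive1 phi x) < e.
Proof.
move=> hf f0 e0; have [g [hg g0 hge]] := dense_cc0 hf f0 e0.
exists (prim g); split; first exact: prim_rtest.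
by have [_ ->] := prim_derive hg.
Qed.

(** The du Bois-Reymond lemma. For the mean [k], the function [f - k] is a limit of derivatives of
    test functions, to which [f] is orthogonal; it is also orthogonal to [k], hence to itself. *)
Lemma wd0_cst f : L2 f -> wd f (fun=> 0) ->
  exists k, normL2 (fun x => f x - k) = 0.
Proof.
move=> hf h; pose k := I f / L; exists k.
have hk : L2 (fun x => f x - k) by apply: L2B => //; exact: L2_cst.
have Ik : I (fun=> k) = I f.
  rewrite /real_integral Rintegral_cst; last exact: measurable_itv.
  rewrite [X in fine X](lebesgue_measure_itv `]0, L[)/= lte_fin L0 /= subr0.
  by rewrite /k divfK ?gt_eqF.
have k0 : I (fun x => f x - k) = 0.
  by rewrite intB ?Ik ?subrr//; [exact: L2_itg|exact: itg_cst].
suff h0 : I (fun x => f x * (f x - k)) = 0.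
  apply/eqP; rewrite -sqrf_eq0 normL2_sq.
  rewrite (@eq_int _ _ _ (fun x => f x * (f x - k) - k * (f x - k))); last first.
    by move=> x _; ring.
  by rewrite intB ?intZ ?k0 ?h0 ?mulr0 ?subrr//; do ?apply: itgZ; do ?[exact: itgM|exact: L2_itg].
apply: (@eq0_of_le_eps (normL2 f)) => e e0.
have [phi [ht hphi]] := dense_deriv hk k0 e0; have [hc _] := ht.
have hd := L2_cont L (C1_dcont hc).
have -> : I (fun x => f x * (f x - k)) = I (fun x => 1 * f x * (f x - k - derive1 phi x)).
  rewrite (@eq_int _ _ (fun x => 1 * f x * _) (fun x => f x * (f x - k) - f x * derive1 phi x));
      last first.
    by move=> x _; ring.
  rewrite intB; do ?exact: itgM.
  rewrite h// (@eq_int _ L (fun x => 0 * phi x) (fun=> 0)); last by move=> x _; rewrite mul0r.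
  by rewrite int0 oppr0 subr0.
apply: le_trans (abs_int_le (bdd_cst L 1) ler01 _ hf (L2B hk hd)) _.
  by move=> x _; rewrite normr1.
by rewrite mul1r ler_wpM2l ?normL2_ge0// ltW.
Qed.

(** The primitive from 0 at points of the interval, written as an integral over all of it so that
    Cauchy-Schwarz applies directly. *)
Definition prim0 g x := I (fun y => \1_(`]0, x[) y * g y).

Lemma prim0_le g x : L2 g -> `|prim0 g x| <= Num.sqrt L * normL2 g.
Proof.
move=> hg; rewrite /prim0.
rewrite (@eq_int _ _ _ (fun y => \1_(`]0, x[) y * 1 * g y)); last first.
  by move=> y _; rewrite mulr1.
apply: le_trans (abs_int_le (bdd_indic L 0 x) ler01 _ (L2_cst L 1) hg) _.
  by move=> y _; rewrite indicE; case: (_ \in _); rewrite ?normr1 ?normr0.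
by rewrite mul1r normL2_cst// normr1 mul1r.
Qed.

Lemma itg_indic g x : L2 g -> itg L (fun y => \1_(`]0, x[) y * g y).
Proof. by move=> hg; apply: itgM => //; apply: bdd_L2; exact: bdd_indic. Qed.

Lemma prim0B f g x : L2 f -> L2 g ->
  prim0 (fun x => f x - g x) x = prim0 f x - prim0 g x.
Proof.
move=> hf hg; rewrite /prim0 -intB; do ?exact: itg_indic.
by apply: eq_int => y _; rewrite mulrBr.
Qed.

Lemma prim0_C1 psi x : C1 psi -> 0 < x < L ->
  prim0 (derive1 psi) x = psi x - psi 0.
Proof. by move=> hpsi hx; rewrite /prim0 ftc_indic. Qed.

Lemma bdd_prim0 g : L2 g -> bdd L (prim0 g).
Proof.
move=> hg; split; last by exists (Num.sqrt L * normL2 g) => x _; exact: prim0_le.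
have ex n : exists phi, cc L phi /\ normL2 (fun x => g x - phi x) < n.+1%:R^-1.
  by apply: dense_cc => //; rewrite invr_gt0.
have [F hF] := choice ex.
have hFL n : L2 (F n) by have [[/(L2_cont L)]] := hF n.
(* Measurability is obtained from a pointwise limit of primitives of continuous functions. *)
apply: (@measurable_fun_cvg _ _ _ _ (fun n x => prim (F n) x - prim (F n) 0)).
- move=> n; apply: measB; last exact: meas_cst.
  by apply: meas_cont; apply: C1_cont; have [] := prim_derive (hF n).1.
- move=> x xD; have s0 : 0 < Num.sqrt L by rewrite sqrtr_gt0.
  apply/cvgrPdist_le => e e0; near=> n.
  have [h1 h2] := prim_derive (hF n).1.
  rewrite -prim0_C1// h2 -prim0B//.
  apply: (le_trans (prim0_le x (L2B hg (hFL n)))).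
  rewrite mulrC -ler_pdivlMr//; apply: (le_trans (ltW (hF n).2)); apply: ltW.
  by near: n; exact: near_infty_natSinv_lt (PosNum (divr_gt0 e0 s0)).
Unshelve. all: by end_near. Qed.

(** The pointwise error is at most [sqrt L] times the error of the derivatives; the L2 norm over the
    interval adds another [sqrt L]. *)
Lemma prim0_approx g psi : L2 g -> C1 psi -> psi 0 = 0 ->
  normL2 (fun x => prim0 g x - psi x) <= L * normL2 (fun x => g x - derive1 psi x).
Proof.
move=> hg hpsi p0; have hd := L2_cont L (C1_dcont hpsi).
set K := normL2 (fun x => g x - _).
have -> : L * K = normL2 (fun=> Num.sqrt L * K).
  rewrite normL2_cst// ger0_norm ?mulr_ge0 ?sqrtr_ge0 ?normL2_ge0//.
  by rewrite mulrAC -expr2 sqr_sqrtr ?ltW.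
rewrite -(@ger0_norm _ (Num.sqrt L * K)) ?mulr_ge0 ?sqrtr_ge0 ?normL2_ge0//.
apply: ler_wsqrtr; apply: int_le.
- by apply: itgM; apply: L2B; do ?[exact/bdd_L2/bdd_prim0|exact/L2_cont/C1_cont].
- exact: itg_cst.
- move=> x xD; rewrite -[leLHS]ger0_norm -?expr2 ?sqr_ge0// !normrX.
  rewrite lerXn2r ?nnegrE// -[psi x]subr0 -p0 -prim0_C1// -prim0B//.
  rewrite [leRHS]ger0_norm ?mulr_ge0 ?sqrtr_ge0 ?normL2_ge0//.
  exact: prim0_le (L2B hg hd).
Qed.

Lemma prim0_H10 g : L2 g -> I g = 0 -> H10 (prim0 g) g.
Proof.
move=> hg g0; split => //; first exact/bdd_L2/bdd_prim0.
move=> e e0.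
have L1 : 0 < L + 1 by lra_L.
have [phi [ht hphi]] := dense_deriv hg g0 (divr_gt0 e0 L1); exists phi; split => //.
  apply: (le_lt_trans (prim0_approx hg ht.1 (rtest0 ht))).
  have h0 := normL2_ge0 L (fun x => g x - derive1 phi x).
  by rewrite ltr_pdivlMr// in hphi; nra_L.
apply: (lt_le_trans hphi); rewrite ler_pdivrMr//; nra_L.
Qed.

Lemma C1_ibp psi phi : C1 psi -> rtest phi ->
  I (fun x => psi x * derive1 phi x) = - I (fun x => derive1 psi x * phi x).
Proof.
move=> hpsi ht; have [hphi _] := ht.
have [h1 h2] := C1M hpsi hphi.
apply/eqP; rewrite -addr_eq0 -intD.
- rewrite (@eq_int _ _ _ (derive1 (fun x => psi x * phi x))).
    by rewrite ftc ?ltW//= (rtest0 ht) (rtestL ht) !mulr0 subrr.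
  by move=> x _; rewrite h2 addrC.
- by apply: itgM; apply: L2_cont; [exact: C1_cont|exact: C1_dcont].
- by apply: itgM; apply: L2_cont; [exact: C1_dcont|exact: C1_cont].
Qed.

Lemma normL2_abs_int f g : L2 f -> L2 g ->
  `|I (fun x => f x * g x)| <= normL2 f * normL2 g.
Proof.
move=> hf hg; rewrite (@eq_int _ _ _ (fun x => 1 * f x * g x)); last first.
  by move=> x _; rewrite mul1r.
apply: le_trans (abs_int_le (bdd_cst L 1) ler01 _ hf hg) _.
  by move=> x _; rewrite normr1.
by rewrite mul1r.
Qed.

(** Both sides depend continuously on [g], and for continuous [g] with compact support this is
    integration by parts of C1 functions. *)
Lemma prim0_wd g : L2 g -> wd (prim0 g) g.
Proof.
move=> hg phi ht; have [hphi _] := ht.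
apply/eqP; rewrite -subr_eq0 opprK; apply/eqP.
have cphi := L2_cont L (C1_cont hphi); have dphi := L2_cont L (C1_dcont hphi).
have hP := bdd_L2 (bdd_prim0 hg).
apply: (@eq0_of_le_eps (L * normL2 (derive1 phi) + normL2 phi)) => e e0.
have [h [hh hhe]] := dense_cc hg e0; have [h1 h2] := prim_derive hh.
have hL := L2_cont L hh.1.
pose psi x := prim h x - prim h 0.
have [hpsi dpsi] : C1 psi /\ derive1 psi = h.
  have [c1 c2] := C1_cst (- prim h 0); have [h3 h4] := C1D h1 c1.
  by split=> //; rewrite h4 c2 h2; apply/funext => x; rewrite addr0.
have psiL := L2_cont L (C1_cont hpsi).
have p0 : psi 0 = 0 by rewrite /psi subrr.
have -> : I (fun x => prim0 g x * derive1 phi x) + I (fun x => g x * phi x) =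
  I (fun x => (prim0 g x - psi x) * derive1 phi x) + I (fun x => (g x - h x) * phi x).
  transitivity (I (fun x => prim0 g x * derive1 phi x) + I (fun x => g x * phi x)
     - (I (fun x => psi x * derive1 phi x) + I (fun x => derive1 psi x * phi x))).
    by rewrite (C1_ibp hpsi ht) addNr subr0.
  rewrite dpsi opprD addrACA -!intB; do ?exact: itgM.
  by congr (_ + _); apply: eq_int => x _; ring.
apply: le_trans (ler_normD _ _) _; rewrite mulrDl lerD//.
  apply: le_trans (normL2_abs_int (L2B hP psiL) dphi) _.
  rewrite mulrAC ler_wpM2r ?normL2_ge0//.
  apply: le_trans (prim0_approx hg hpsi p0) _; rewrite dpsi ler_wpM2l// ltW//.
apply: le_trans (normL2_abs_int (L2B hg hL) cphi) _.
by rewrite mulrC ler_wpM2l ?normL2_ge0// ltW.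
Qed.

Lemma wdB f f' g g' : H1 f g -> H1 f' g' ->
  H1 (fun x => f x - f' x) (fun x => g x - g' x).
Proof.
move=> [hf hg h] [hf' hg' h']; split; [exact: L2B..|move=> phi ht].
have [hphi _] := ht.
have cphi := L2_cont L (C1_cont hphi); have dphi := L2_cont L (C1_dcont hphi).
transitivity (I (fun x => f x * derive1 phi x) - I (fun x => f' x * derive1 phi x)).
  by rewrite -intB; do ?exact: itgM; apply: eq_int => x _; ring.
rewrite h// h'// -opprD -intN; last by apply: itgM.
rewrite -intD; [|exact: itgM|by apply: itgN; exact: itgM].
by congr (- _); apply: eq_int => x _; ring.
Qed.

(** The difference of [s] and [prim0 t] has weak derivative 0. *)
Lemma H1_prim s t : H1 s t -> exists k, normL2 (fun x => s x - prim0 t x - k) = 0.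
Proof.
move=> hst; have [hs ht _] := hst; have hp := bdd_L2 (bdd_prim0 ht).
have [h1 _ h3] := wdB hst (And3 hp ht (prim0_wd ht)).
apply: wd0_cst => // phi hphi; rewrite h3//; congr (- _).
by apply: eq_int => x _; rewrite subrr.
Qed.

(** Approximation by functions that may be nonzero at the ends, as the stress requires: it satisfies
    no boundary condition. *)
Lemma H1_approx s t e : H1 s t -> 0 < e -> exists psi,
  [/\ C1 psi, normL2 (fun x => s x - psi x) < e &
    normL2 (fun x => t x - derive1 psi x) < e].
Proof.
move=> hst e0; have [hs ht _] := hst; have [k hk] := H1_prim hst.
have L1 : 0 < L + 1 by lra_L.
have [h [hh hhe]] := dense_cc ht (divr_gt0 e0 L1); have [h1 h2] := prim_derive hh.
have hp := bdd_L2 (bdd_prim0 ht).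
pose psi x := prim h x - prim h 0.
have [hpsi dpsi] : C1 psi /\ derive1 psi = h.
  have [c1 c2] := C1_cst (- prim h 0); have [h3 h4] := C1D h1 c1.
  by split=> //; rewrite h4 c2 h2; apply/funext => x; rewrite addr0.
have psiL := L2_cont L (C1_cont hpsi).
have p0 : psi 0 = 0 by rewrite /psi subrr.
have [c1 c2] := C1_cst k; have [h3 h4] := C1D hpsi c1.
exists (fun x => psi x + k); split => //.
  have -> : normL2 (fun x => s x - (psi x + k)) =
      normL2 (fun x => (s x - prim0 t x - k) + (prim0 t x - psi x)).
    by apply: eq_normL2 => x _; ring.
  apply: (le_lt_trans (normL2D (L2B (L2B hs hp) (L2_cst L k)) (L2B hp psiL))).
  rewrite hk add0r; apply: (le_lt_trans (prim0_approx ht hpsi p0)); rewrite dpsi.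
  have hh0 := normL2_ge0 L (fun x => t x - h x).
  by rewrite ltr_pdivlMr// in hhe; nra_L.
rewrite h4 c2 dpsi (@eq_normL2 _ _ _ (fun x => t x - h x)); last first.
  by move=> x _; rewrite addr0.
apply: (lt_le_trans hhe); rewrite ler_pdivrMr//; nra_L.
Qed.

End WeakDerivative.

(** * Integration by parts against weights *)

Section Ibp.
Context {R : realType} (L : R).
Implicit Types (f g h m u p s t phi psi w : R -> R) (k e x y a b : R).

Local Notation mu := (@lebesgue_measure R).
Local Notation D := (`]0, L[%classic : set (measurableTypeR R)).
Local Notation I := (real_integral L).
Local Notation L2 := (L2 L).
Local Notation normL2 := (normL2 L).
Local Notation meas := (meas L).
Hypothesis L0 : 0 < L.
Local Ltac lra_L := have := L0; lra.
Local Ltac nra_L := have := L0; nra.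

(** The integral of [(w s u)'], with [w'], [t], [p] for the derivatives of [w], [s], [u]. *)
Definition leibniz w w' s t u p :=
  I (fun x => w x * (s x * p x + t x * u x) + w' x * s x * u x).

Lemma leibnizC w w' s t u p : leibniz w w' s t u p = leibniz w w' u p s t.
Proof. by apply: eq_int => x _; ring. Qed.

Lemma itg_leibniz w w' s t u p : bdd L w -> bdd L w' ->
  L2 s -> L2 t -> L2 u -> L2 p ->
  itg L (fun x => w x * (s x * p x + t x * u x) + w' x * s x * u x).
Proof.
move=> hw hw' hs ht hu hp; apply: itgD; last by apply: itgM => //; exact: bddM_L2.
apply: (@eq_itg _ _ (fun x => w x * s x * p x + w x * t x * u x)).
  by move=> x _; ring.
by apply: itgD; apply: itgM => //; exact: bddM_L2.
Qed.

Lemma leibnizB w w' s t s' t' u p : bdd L w -> bdd L w' ->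
  L2 s -> L2 t -> L2 s' -> L2 t' -> L2 u -> L2 p ->
  leibniz w w' (fun x => s x - s' x) (fun x => t x - t' x) u p =
  leibniz w w' s t u p - leibniz w w' s' t' u p.
Proof.
move=> *; rewrite /leibniz -intB; do ?exact: itg_leibniz.
by apply: eq_int => x _; ring.
Qed.

Lemma bdd_bound m : bdd L m -> exists M, 0 <= M /\ forall x : R, D x -> `|m x| <= M.
Proof.
move=> [_ [M hM]]; exists `|M|; split => // x xD.
exact: le_trans (hM _ xD) (ler_norm _).
Qed.

Lemma leibniz_le w w' : bdd L w -> bdd L w' -> exists M, forall s t u p,
  L2 s -> L2 t -> L2 u -> L2 p ->
  `|leibniz w w' s t u p| <= M * (normL2 s + normL2 t) * (normL2 u + normL2 p).
Proof.
move=> hw hw'; have [M [M0 hM]] := bdd_bound hw; have [N [N0 hN]] := bdd_bound hw'.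
exists (M + N) => s t u p hs ht hu hp.
have -> : leibniz w w' s t u p = I (fun x => w x * s x * p x) +
    I (fun x => w x * t x * u x) + I (fun x => w' x * s x * u x).
  rewrite -!intD; do ?[apply: itgD]; do ?[by apply: itgM => //; exact: bddM_L2].
  by apply: eq_int => x _; ring.
have h1 := abs_int_le hw M0 hM hs hp.
have h2 := abs_int_le hw M0 hM ht hu.
have h3 := abs_int_le hw' N0 hN hs hu.
apply: le_trans (ler_normD _ _) _.
apply: le_trans (lerD (ler_normD _ _) (lexx _)) _.
apply: le_trans (lerD (lerD h1 h2) h3) _.
move: (normL2_ge0 L s) (normL2_ge0 L t) (normL2_ge0 L u) (normL2_ge0 L p).
move: (normL2 s) (normL2 t) (normL2 u) (normL2 p) => a b c d a0 b0 c0 d0.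
rewrite -subr_ge0 (_ : _ - _ = M * a * c + M * b * d + N * a * d + N * b * c + N * b * d).
  by rewrite !addr_ge0 ?mulr_ge0.
by ring.
Qed.

(** By [leibniz_le] the form is continuous in the pair [(s, t)], so its vanishing passes to limits,
    one pair at a time. *)
Lemma leibniz_closure w w' s t u p : bdd L w -> bdd L w' ->
  L2 s -> L2 t -> L2 u -> L2 p ->
  (forall e, 0 < e -> exists s' t', [/\ L2 s' /\ L2 t',
     normL2 (fun x => s x - s' x) < e, normL2 (fun x => t x - t' x) < e &
     leibniz w w' s' t' u p = 0]) ->
  leibniz w w' s t u p = 0.
Proof.
move=> hw hw' hs ht hu hp h; have [M hM] := leibniz_le hw hw'.
apply: (@eq0_of_le_eps _ (`|M| * 2 * (normL2 u + normL2 p))) => e e0.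
have [s' [t' [[hs' ht'] h1 h2 h3]]] := h _ e0.
rewrite -[X in `|X|]subr0 -h3 -leibnizB//.
apply: le_trans (hM _ _ _ _ (L2B hs hs') (L2B ht ht') hu hp) _.
rewrite [leRHS]mulrAC ler_wpM2r ?addr_ge0 ?normL2_ge0//.
rewrite -mulrA; apply: (@le_trans _ _ (`|M| * (normL2 (fun x => s x - s' x) + normL2 (fun x => t
    x - t' x)))).
  by rewrite ler_wpM2r ?addr_ge0 ?normL2_ge0 ?ler_norm.
by rewrite ler_wpM2l//; lra.
Qed.

Lemma leibniz_test w w' psi phi : weight L w w' -> C1 psi -> rtest L phi ->
  leibniz w w' psi (derive1 psi) phi (derive1 phi) = 0.
Proof.
move=> [_ _ h] hpsi ht; have [hphi _] := ht; have [h1 h2] := C1M hpsi hphi.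
have := h _ h1; rewrite (rtest0 ht) (rtestL ht) !mulr0 subrr => <-.
by rewrite h2; apply: eq_int => x _; ring.
Qed.

Lemma ibp_C1 w w' psi u p : weight L w w' -> C1 psi -> H10 L u p ->
  leibniz w w' psi (derive1 psi) u p = 0.
Proof.
move=> hw hpsi [hu hp h]; rewrite leibnizC; have [bw bw' _] := hw.
apply: leibniz_closure => //; do ?[exact/L2_cont/C1_cont|exact/L2_cont/C1_dcont].
move=> e e0; have [phi [ht h1 h2]] := h _ e0; have [hphi _] := ht.
exists phi, (derive1 phi); split => //.
  by split; [exact/L2_cont/C1_cont|exact/L2_cont/C1_dcont].
by rewrite leibnizC leibniz_test.
Qed.

(** The boundary terms are killed by [u]; the weight is free at the ends. *)
Lemma ibp w w' s t u p : weight L w w' -> H1 L s t -> H10 L u p ->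
  leibniz w w' s t u p = 0.
Proof.
move=> hw hst hup; have [bw bw' _] := hw; have [hs ht _] := hst.
have [hu hp _] := hup; apply: leibniz_closure => // e e0.
have [psi [hpsi h1 h2]] := H1_approx L0 hst e0.
exists psi, (derive1 psi); split => //.
  by split; [exact/L2_cont/C1_cont|exact/L2_cont/C1_dcont].
exact: ibp_C1.
Qed.

(** Here the weight kills the boundary terms and both functions are free at the ends. *)
Lemma ibp_H1 w w' s t s' t' : weight L w w' -> w 0 = 0 -> w L = 0 ->
  H1 L s t -> H1 L s' t' -> leibniz w w' s t s' t' = 0.
Proof.
move=> hw w0 wL hst hst'; have [bw bw' hww] := hw; have [hs ht _] := hst.
have [hs' ht' _] := hst'; apply: leibniz_closure => // e e0.
have [psi [hpsi h1 h2]] := H1_approx L0 hst e0.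
have psiL := L2_cont L (C1_cont hpsi); have dpsiL := L2_cont L (C1_dcont hpsi).
exists psi, (derive1 psi); split => //.
rewrite leibnizC; apply: leibniz_closure => // {h1 h2 e0}e e0.
have [phi [hphi h1 h2]] := H1_approx L0 hst' e0.
exists phi, (derive1 phi); split => //.
  by split; [exact/L2_cont/C1_cont|exact/L2_cont/C1_dcont].
have [h3 h4] := C1M hphi hpsi; have := hww _ h3.
rewrite w0 wL !mul0r subrr => <-.
by rewrite h4; apply: eq_int => x _; ring.
Qed.

Lemma H10_H1 u p : H10 L u p -> H1 L u p.
Proof.
move=> hup; have [hu hp _] := hup; split => // phi ht; have [hphi _] := ht.
have cphi := L2_cont L (C1_cont hphi); have dphi := L2_cont L (C1_dcont hphi).
have := ibp_C1 (weight_cst 1 (ltW L0)) hphi hup.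
rewrite /leibniz => h; apply/eqP; rewrite -addr_eq0 -h -intD; do ?exact: itgM.
by apply/eqP; apply: eq_int => x _; ring.
Qed.

(** Integrate [(x u^2)'], which gives [|u|^2] in terms of the product [x u p]. *)
Lemma poincare u p : H10 L u p -> normL2 u <= 2 * L * normL2 p.
Proof.
move=> hup; have [hu hp _] := hup.
have := ibp (weight_id (ltW L0)) (H10_H1 hup) hup.
have hx : bdd L (fun x : R => x) by have [] := weight_id (ltW L0).
have hle : forall x : R, D x -> `|x| <= L.
  by move=> x /=; rewrite in_itv/= => /andP[x0 xL]; rewrite gtr0_norm// ltW.
have h1 := abs_int_le hx (ltW L0) hle hu hp.
have e : leibniz (fun x => x) (fun=> 1) u p u p =
    2 * I (fun x => x * u x * p x) + normL2 u ^+ 2.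
  rewrite normL2_sq -intZ -?intD; do ?[apply: itgZ]; do ?[by apply: itgM => //; exact: bddM_L2].
  by apply: eq_int => x _; ring.
rewrite e => h2.
have h3 : normL2 u ^+ 2 <= 2 * (L * normL2 u * normL2 p).
  move: h1; rewrite ler_norml => /andP[h1 _]; lra.
have u0 := normL2_ge0 L u; have p0 := normL2_ge0 L p.
have [->|u1] := eqVneq (normL2 u) 0; first by rewrite !mulr_ge0// ltW.
have {}u0 : 0 < normL2 u by rewrite lt_neqAle eq_sym u1.
by rewrite -(ler_pM2l u0); apply: (le_trans _ (le_trans h3 _)); rewrite -?expr2// le_eqVlt;
    apply/orP; left; apply/eqP; ring.
Qed.

Lemma C1_shift f k : C1 f -> C1 (fun x => f (x + k)) /\
  derive1 (fun x => f (x + k)) = (fun x => derive1 f (x + k)).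
Proof.
move=> hf; apply: C1_of => x.
  apply: (@continuous_comp _ _ _ (fun x => x + k) (derive1 f)); last exact: C1_dcont.
  by apply: cvgD => //; exact: cvg_cst.
have h1 : is_derive x 1 (fun y : R => y + k) 1.
  by apply: is_derive_eq; rewrite addr0.
have h2 := C1_is_derive (x + k) hf.
have := @is_derive1_comp _ f (fun y : R => y + k) x (derive1 f (x + k)) 1.
by rewrite mulr1; apply.
Qed.

(** Test functions are C1, so the continuous approximation [g] is smoothed: difference quotients of
    its primitive are averages of [g] over [[x, x + d]]. *)
Lemma dense_rtest f e : L2 f -> 0 < e ->
  exists phi, rtest L phi /\ normL2 (fun x => f x - phi x) < e.
Proof.
move=> hf e0; have e2 : 0 < e / 2 by rewrite divr_gt0.
have [g [hg hge]] := dense_cc hf e2; have [h1 h2] := prim_derive hg.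
have [cg [a [b [a0 bL hz]]]] := hg; have gL := L2_cont L cg.
(* Averaging extends the support to the left by [d n], which has to stay below [a] for the support
   to remain inside the interval. *)
have [N hN] : exists N : nat, N.+1%:R^-1 < a.
  have [N _ /(_ N (leqnn N))] := near_infty_natSinv_lt (PosNum a0); by exists N.
pose d n : R := (n + N).+1%:R^-1.
have d0 n : 0 < d n by rewrite invr_gt0.
have da n : d n < a.
  by apply: le_lt_trans hN; rewrite lef_pV2 ?posrE// ler_nat ltnS leq_addl.
pose phi n x := (d n)^-1 * (prim g (x + d n) - prim g x).
have mvt n x : exists c, [/\ x < c, c < x + d n & phi n x = g c].
  have [|||c hc] := @MVT R (prim g) g x (x + d n).
  - by rewrite ltrDl.
  - by move=> z _; rewrite -{2}h2; exact: C1_is_derive.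
  - by apply: continuous_subspaceT; exact: C1_cont.
  rewrite addrAC subrr add0r => e'; exists c; move: hc; rewrite in_itv/= => /andP[-> ->].
  by split => //; rewrite /phi e' mulrCA mulVf ?mulr1 ?gt_eqF.
have C1phi n : C1 (phi n).
  have [h3 _] := C1_shift (d n) h1; have [h4 _] := C1Z (-1) h1.
  have [h5 _] := C1D h3 h4; have [h6 _] := C1Z (d n)^-1 h5.
  move: h6; congr C1; apply/funext => x; rewrite /phi; ring.
have tphi n : rtest L (phi n).
  split => //; exists (a - d n), b; split; [by rewrite subr_gt0|by []|move=> x].
  rewrite in_itv/= negb_and -!ltNge => hx; have [c [xc cx ->]] := mvt n x.
  by apply: hz; apply: out_itv; case/orP: hx => hx; apply/orP; [left|right]; lra.
have [M [M0 hM]] : exists M, 0 <= M /\ forall x, `|g x| <= M.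
  have [M [M0 hM]] := bdd_bound (bdd_cont L cg); exists M; split => // x.
  case: (boolP (x \in `[a, b])) => hx; last by rewrite hz ?normr0.
  apply: hM; rewrite /= in_itv/=; move: hx; rewrite in_itv/= => /andP[ax xb].
  by rewrite (lt_le_trans a0)// (le_lt_trans xb).
have [|||||n [_ hn]] := @dominated_cvg0 R L (fun n x => g x - phi n x) (fun=> 2 * M) (e / 2).
- by move=> n; apply: measB; apply: meas_cont => //; exact: C1_cont.
- exact: L2_cst.
- move=> n x _; have [c [_ _ ->]] := mvt n x.
  rewrite [leRHS]ger0_norm ?mulr_ge0//; apply: (le_trans (ler_normB _ _)).
  by have := hM x; have := hM c; lra.
- move=> x xD; apply/cvgrPdist_le => r r0.
  have /cvgrPdist_le/(_ _ r0) := cg x.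
  move=> /nbhs_ballP[del /= del0 hdel]; near=> n.
  have [c [xc cx ->]] := mvt n x; rewrite sub0r normrN.
  apply: hdel; rewrite /ball/= ltr_norml; apply/andP; split; last by lra.
  suff : d n < del by lra.
  have dn : d n <= n.+1%:R^-1 by rewrite lef_pV2 ?posrE// ler_nat ltnS leq_addr.
  apply: le_lt_trans dn _; near: n; exact: near_infty_natSinv_lt (PosNum del0).
- by [].
exists (phi n); split => //.
have hphiL := L2_cont L (C1_cont (C1phi n)).
have -> : normL2 (fun x => f x - phi n x) = normL2 (fun x => (f x - g x) + (g x - phi n x)).
  by apply: eq_normL2 => x _; ring.
apply: (le_lt_trans (normL2D (L2B hf gL) (L2B gL hphiL))).
by rewrite [e]splitr ltrD.
Unshelve. all: by end_near. Qed.

(** [g - g'] is orthogonal to all test functions, and these are dense in L2. *)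
Lemma wd_unique f g g' : L2 g -> L2 g' -> wd L f g -> wd L f g' ->
  normL2 (fun x => g x - g' x) = 0.
Proof.
move=> hg hg' h h'; have hgg := L2B hg hg'.
apply/eqP; rewrite -sqrf_eq0 normL2_sq; apply/eqP.
apply: (@eq0_of_le_eps _ (normL2 (fun x => g x - g' x))) => e e0.
have [phi [ht hphi]] := dense_rtest hgg e0; have [hc _] := ht.
have cphi := L2_cont L (C1_cont hc).
have z : I (fun x => (g x - g' x) * phi x) = 0.
  rewrite (@eq_int _ _ _ (fun x => g x * phi x - g' x * phi x)); last by move=> x _; ring.
  rewrite intB; do ?exact: itgM.
  by apply/eqP; rewrite -oppr_eq0 opprB -[I _]opprK -h'// -h// addrC subrr.
rewrite -[X in `|X|]subr0 -z -intB; do ?exact: itgM.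
rewrite (@eq_int _ _ _ (fun x => (g x - g' x) * (g x - g' x - phi x))); last first.
  by move=> x _; ring.
apply: le_trans (normL2_abs_int hgg (L2B hgg cphi)) _.
by rewrite ler_wpM2l ?normL2_ge0// ltW.
Qed.

End Ibp.

(** * The observability estimate for real trajectories *)

(** The components [u_x], [u_t], [y_x], [y_t], in this order. *)
Inductive slot := cP | cV | cQ | cZ.

Lemma itg_bddM (R : realType) (L : R) (m f : R -> R) :
  bdd L m -> itg L f -> itg L (fun x => m x * f x).
Proof.
move=> hm hf; have [M [M0 hM]] := bdd_bound hm; have [mm _] := hm.
apply: (itg_le _ (itgZ M (itg_abs hf))).
  by apply: measM => //; exact: itg_meas.
by move=> x xD; rewrite normrM ler_wpM2r ?hM.
Qed.

Ltac bdd_tac := first [assumption | exact: bdd_cst | exact: bdd_indic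
  | apply: bddM; solve [bdd_tac] | apply: bddD; solve [bdd_tac]
  | apply: bddN; solve [bdd_tac]].

Ltac L2_tac := first [assumption
  | match goal with H : forall i k, L2 _ _ |- _ => solve [apply: H] end
  | apply: bddM_L2; [solve [bdd_tac]|solve [L2_tac]] | apply: L2D; solve [L2_tac]
  | apply: L2N; solve [L2_tac]].

Ltac itg_tac := first [apply: itgM; solve [L2_tac]
  | apply: itg_bddM; [solve [bdd_tac]|solve [itg_tac]]
  | apply: itgD; solve [itg_tac] | apply: itgN; solve [itg_tac]].

(** Gathers a linear combination of integrals into a single integral, so that integral identities
    and inequalities reduce to pointwise ones. *)
Ltac int_tac := repeat first
  [ rewrite -intZ; [|by itg_tac]
  | rewrite -intB; [|by itg_tac|by itg_tac]
  | rewrite -intD; [|by itg_tac|by itg_tac]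
  | rewrite -intN; [|by itg_tac]].

(** * Time derivatives of bilinear integrals *)

Section TimeDerivative.
Context {R : realType} (L : R).
Implicit Types (f g : R -> R -> R) (w u p : R -> R) (e t s h a : R).
Local Notation I := (real_integral L).
Local Notation L2 := (L2 L).
Local Notation normL2 := (normL2 L).

Definition L2deriv f u t :=
  normL2 (fun x => e^-1 * (f (t + e) x - f t x) - u x) @[e --> 0^'] --> (0 : R).

Lemma is_derive_cvg (F : R -> R) t a :
  (fun h => h^-1 * (F (h + t) - F t)) @ 0^' --> a -> is_derive t 1 F a.
Proof.
move=> h; have e : (fun h => h^-1 *: (F (h *: 1 + t) - F t)) = (fun h => h^-1 * (F (h + t) - F t)).
  by apply/funext => x; rewrite /GRing.scale/= mulr1.
by apply: DeriveDef; [rewrite /derivable e; apply: cvgP h|rewrite /derive e; exact: cvg_lim h].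
Qed.

Lemma is_derive_pair w f g u p t : 0 < t -> bdd L w ->
  (forall s, 0 < s -> L2 (f s) /\ L2 (g s)) -> L2 u -> L2 p ->
  L2deriv f u t -> L2deriv g p t ->
  is_derive t 1 (fun s => I (fun x => w x * f s x * g s x))
    (I (fun x => w x * u x * g t x) + I (fun x => w x * f t x * p x)).
Proof.
move=> t0 hw hfg hf' hg' df dg; have [M [M0 hM]] := bdd_bound hw.
have [hf hg] := hfg _ t0.
apply: is_derive_cvg; set A := I _ + _.
pose al h := normL2 (fun x => h^-1 * (f (t + h) x - f t x) - u x).
pose be h := normL2 (fun x => h^-1 * (g (t + h) x - g t x) - p x).
(* The error of the difference quotient has three parts, bounded in this order: the error of [f]
   against [g (t + h)], [u] against the increment of [g], and [f t] against the error of [g]. *)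
pose psi h := M * al h * (normL2 (g t) + `|h| * (be h + normL2 p))
  + M * normL2 u * (`|h| * (be h + normL2 p)) + M * normL2 (f t) * be h.
have psi0 : psi h @[h --> 0^'] --> (0 : R).
  have h0 : (fun h : R => `|h|) @ 0^' --> (0 : R).
    apply/cvgrPdist_le => e e0; near=> h; rewrite sub0r normrN normr_id.
    by near: h; exact: dnbhs0_le.
  have hal : al h @[h --> 0^'] --> (0 : R) by exact: df.
  have hbe : be h @[h --> 0^'] --> (0 : R) by exact: dg.
  have k1 : (fun h : R => `|h| * (be h + normL2 p)) @ 0^' --> 0 * (0 + normL2 p).
    by apply: cvgM; [exact: h0|apply: cvgD; [exact: hbe|exact: cvg_cst]].
  have k2 : (fun h : R => M * al h * (normL2 (g t) + `|h| * (be h + normL2 p))) @ 0^'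
      --> M * 0 * (normL2 (g t) + 0 * (0 + normL2 p)).
    apply: cvgM; first by apply: cvgM; [exact: cvg_cst|exact: hal].
    by apply: cvgD; [exact: cvg_cst|exact: k1].
  have k3 : (fun h : R => M * normL2 u * (`|h| * (be h + normL2 p))) @ 0^'
      --> M * normL2 u * (0 * (0 + normL2 p)).
    by apply: cvgM; [exact: cvg_cst|exact: k1].
  have k4 : (fun h : R => M * normL2 (f t) * be h) @ 0^' --> M * normL2 (f t) * 0.
    by apply: cvgM; [exact: cvg_cst|exact: hbe].
  rewrite mulr0 mul0r in k2; rewrite mul0r mulr0 in k3; rewrite mulr0 in k4.
  have k5 : psi @ 0^' --> (0 + 0 + 0 : R).
    by apply: cvgD; [apply: cvgD; [exact: k2|exact: k3]|exact: k4].
  by rewrite !addr0 in k5; exact: k5.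
apply/cvgrPdist_le => e e0; near=> h.
have hn0 : h != 0 by near: h; exact: nbhs_dnbhs_neq.
have ht : 0 < t + h.
  have : `|h| < t by near: h; apply: dnbhs0_lt.
  by rewrite ltr_norml => /andP[]; lra.
have [hfh hgh] := hfg _ ht.
have hal : L2 (fun x => h^-1 * (f (t + h) x - f t x) - u x) by L2_tac.
have hbe : L2 (fun x => h^-1 * (g (t + h) x - g t x) - p x) by L2_tac.
have dg' : L2 (fun x => g (t + h) x - g t x) by L2_tac.
have gd : normL2 (fun x => g (t + h) x - g t x) <= `|h| * (be h + normL2 p).
  rewrite (@eq_normL2 _ _ _ (fun x => h * ((h^-1 * (g (t + h) x - g t x) - p x) + p x))).
    by rewrite normL2Z ?ler_wpM2l ?normL2D//; L2_tac.
  by move=> x _; field.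
have gh : normL2 (g (t + h)) <= normL2 (g t) + `|h| * (be h + normL2 p).
  rewrite (@eq_normL2 _ _ (g (t + h)) (fun x => g t x + (g (t + h) x - g t x))).
    by apply: le_trans (normL2D hg dg') _; rewrite lerD2l.
  by move=> x _; ring.
apply: (@le_trans _ _ (psi h)); last first.
  apply: le_trans (ler_norm _) _.
  by near: h; apply: cvgr0_norm_le.
rewrite distrC [h + t]addrC.
have -> : h^-1 * (I (fun x => w x * f (t + h) x * g (t + h) x) - I (fun x => w x * f t x * g t
    x)) - A =
  I (fun x => w x * (h^-1 * (f (t + h) x - f t x) - u x) * g (t + h) x)
  + I (fun x => w x * u x * (g (t + h) x - g t x))
  + I (fun x => w x * f t x * (h^-1 * (g (t + h) x - g t x) - p x)).
  rewrite /A; int_tac; apply: eq_int => x _; ring.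
apply: le_trans (ler_normD _ _) _; apply: lerD.
  apply: le_trans (ler_normD _ _) _; apply: lerD.
    apply: le_trans (abs_int_le hw M0 hM hal hgh) _.
    by rewrite ler_wpM2l// mulr_ge0// normL2_ge0.
  apply: le_trans (abs_int_le hw M0 hM hf' dg') _.
  by rewrite ler_wpM2l// mulr_ge0// normL2_ge0.
exact: (abs_int_le hw M0 hM hf hbe).
Unshelve. all: by end_near. Qed.

End TimeDerivative.

(** * Energies and dissipation of the levels *)

Section Core.
Context {R : realType} (L b0 c0 b1 b2 c1 c2 : R).
Implicit Types (f g h m w : R -> R) (e x y : R) (k : slot).

Local Notation mu := (@lebesgue_measure R).
Local Notation D := (`]0, L[%classic : set (measurableTypeR R)).
Local Notation I := (real_integral L).
Local Notation L2 := (L2 L).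
Local Notation normL2 := (normL2 L).

Hypotheses (hb0 : 0 < b0) (hc0 : c0 != 0) (hb1 : 0 < b1) (hb12 : b1 < b2)
  (hbc : b2 < c1) (hc12 : c1 < c2) (hc2 : c2 < L) (hsmall : `|c0| < (c2 - c1)^-1).

Local Ltac hyps := move: (hb0) (hb1) (hb12) (hbc) (hc12) (hc2) => ? ? ? ? ? ?.

Let L0 : 0 < L. Proof. hyps; lra. Qed.

Definition damping : R -> R := fun x => b0 * \1_(`]b1, b2[) x.
Definition coupling : R -> R := fun x => c0 * \1_(`]c1, c2[) x.
Local Notation b := damping.
Local Notation c := coupling.

Let hb : bdd L b. Proof. rewrite /b; bdd_tac. Qed.
Let hc : bdd L c. Proof. rewrite /c; bdd_tac. Qed.

Definition lev := nat -> slot -> R -> R.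
Implicit Types (l : lev) (i j : nat).

Definition stress l i : R -> R := fun x => l i cP x + b x * l i.+1 cP x.
Definition dstress l i : R -> R := fun x => l i.+1 cV x + c x * l i cZ x.
Definition dQ l i : R -> R := fun x => l i.+1 cZ x - c x * l i cV x.

(* [l i] is the i-th time derivative, with components u_x, u_t, y_x, y_t; the
   relations say that u_tx = (u_t)_x and that both wave equations hold. *)
Definition valid l := (forall i k, L2 (l i k)) /\ forall i, (i <= 4)%N ->
  [/\ H10 L (l i cV) (l i.+1 cP), H10 L (l i cZ) (l i.+1 cQ),
      H1 L (stress l i) (dstress l i) & H1 L (l i cQ) (dQ l i)].

Definition en l i := I (fun x => l i cP x * l i cP x + l i cV x * l i cV x
  + l i cQ x * l i cQ x + l i cZ x * l i cZ x).

(** The loss of level [i] involves [u_tx], which is the gradient of the next level: [diss l i.+1] is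
    minus one half of the derivative of [en l i]. *)
Definition diss l i := I (fun x => b x * (l i cP x * l i cP x)).
Definition dissip l := diss l 2 + diss l 3 + diss l 4 + diss l 5.

Lemma en_ge0 l i : 0 <= en l i.
Proof. by apply: int_ge0 => x _; rewrite !addr_ge0 -?expr2 ?sqr_ge0. Qed.

Lemma enE l i : (forall i k, L2 (l i k)) -> en l i = normL2 (l i cP) ^+ 2 +
  normL2 (l i cV) ^+ 2 + normL2 (l i cQ) ^+ 2 + normL2 (l i cZ) ^+ 2.
Proof. move=> hl; rewrite !normL2_sq /en.
by int_tac. Qed.

Lemma normL2_le_en l i k : (forall i k, L2 (l i k)) -> normL2 (l i k) <= Num.sqrt (en l i).
Proof.
move=> hl; rewrite -[leLHS]ger0_norm ?normL2_ge0// -sqrtr_sqr ler_wsqrtr// enE//.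
by case: k; move: (normL2_ge0 L (l i cP)) (normL2_ge0 L (l i cV))
 (normL2_ge0 L (l i cQ)) (normL2_ge0 L (l i cZ)); rewrite -subr_ge0 => *;
 rewrite ?addr_ge0 ?sqr_ge0//; nra.
Qed.

Lemma b_ge0 x : 0 <= b x.
Proof. by rewrite /b indicE; case: (_ \in _); rewrite ?mulr0// mulr1 ltW. Qed.

Lemma b_le x : `|b x| <= b0.
Proof. by rewrite ger0_norm ?b_ge0// /b indicE; case: (_ \in _); rewrite ?mulr0 ?mulr1// ltW. Qed.

Lemma c_le x : `|c x| <= `|c0|.
Proof. by rewrite /c indicE; case: (_ \in _); rewrite ?mulr0 ?mulr1// normr0. Qed.

Lemma diss_ge0 l i : 0 <= diss l i.
Proof. by apply: int_ge0 => x _; rewrite mulr_ge0 ?b_ge0// -expr2 sqr_ge0. Qed.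

Let w1 : weight L (fun=> 1) (fun=> 0). Proof. exact/weight_cst/ltW. Qed.

Lemma stress_L2 l i : (forall i k, L2 (l i k)) -> L2 (stress l i).
Proof. by move=> hl; rewrite /stress; L2_tac. Qed.
Lemma dstress_L2 l i : (forall i k, L2 (l i k)) -> L2 (dstress l i).
Proof. by move=> hl; rewrite /dstress; L2_tac. Qed.
Lemma dQ_L2 l i : (forall i k, L2 (l i k)) -> L2 (dQ l i).
Proof. by move=> hl; rewrite /dQ; L2_tac. Qed.

(* The boundedness of A^-1: test the two equations with u and y. *)
Lemma coercive : exists K, 0 <= K /\ forall l i, valid l -> (0 < i <= 4)%N ->
  en l i <= K * en l i.+1.
Proof.
(* [K1] is the Poincare constant and bounds the velocities, [K2] bounds [y_x], and [K3] bounds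
   [u_x], with [b0] for the viscous part of the stress. *)
pose K1 := 2 * L; pose K2 := K1 * (1 + `|c0| * K1); pose K3 := b0 + K2.
have K10 : 0 <= K1 by rewrite /K1; have := L0; lra.
have K20 : 0 <= K2 by rewrite mulr_ge0// addr_ge0// mulr_ge0.
have K30 : 0 <= K3 by rewrite addr_ge0// ltW.
exists (K3 ^+ 2 + K1 ^+ 2 + K2 ^+ 2 + K1 ^+ 2); split.
  by rewrite !addr_ge0 ?sqr_ge0.
move=> l [//|i] [hl hv] /= i4; have [h1 h2 h3 h4] := hv i.+1 i4.
have [h5 h6 _ _] := hv i (ltnW i4).
set E := Num.sqrt (en l i.+2).
have hE k : normL2 (l i.+2 k) <= E by exact: normL2_le_en.
have E0 : 0 <= E by exact: sqrtr_ge0.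
have EE : en l i.+2 = E ^+ 2 by rewrite sqr_sqrtr ?en_ge0.
have hV : normL2 (l i.+1 cV) <= K1 * E.
  by apply: (le_trans (poincare L0 h1)); rewrite ler_wpM2l.
have hZ : normL2 (l i.+1 cZ) <= K1 * E.
  by apply: (le_trans (poincare L0 h2)); rewrite ler_wpM2l.
have cM k : normL2 (fun x => c x * l i.+1 k x) <= `|c0| * normL2 (l i.+1 k).
  by apply: normL2_bddM => // x _; exact: c_le.
have cancel_sq (a B : R) : 0 <= a -> 0 <= B -> a ^+ 2 <= a * B -> a <= B.
  move=> a0 B0; rewrite expr2; have [->//|an0] := eqVneq a 0.
  by rewrite ler_pM2l// lt_neqAle eq_sym an0.
have hQ : normL2 (l i.+1 cQ) <= K2 * E.
  apply: cancel_sq; [exact: normL2_ge0|exact: mulr_ge0|].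
  (* The test function [l i cZ] is the displacement [y] of level [i.+1]. *)
  have := ibp L0 w1 h4 h6; rewrite /leibniz => h.
  have -> : normL2 (l i.+1 cQ) ^+ 2 = - I (fun x => dQ l i.+1 x * l i cZ x).
    have hd := dQ_L2 i.+1 hl.
    rewrite normL2_sq -[LHS]subr0 -h; int_tac; apply: eq_int => x _; ring.
  apply: (le_trans (ler_norm _)); rewrite normrN.
  apply: (le_trans (normL2_abs_int (dQ_L2 i.+1 hl) (hl _ _))).
  rewrite mulrC; apply: (@le_trans _ _ (K1 * normL2 (l i.+1 cQ) * ((1 + `|c0| * K1) * E))).
    apply: ler_pM; rewrite ?normL2_ge0//; first exact: (poincare L0 h6).
    apply: (le_trans (normL2B (hl _ _) (bddM_L2 hc (hl _ _)))).
    rewrite mulrDl mul1r lerD ?hE//; apply: (le_trans (cM _)).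
    by rewrite -mulrA ler_wpM2l.
  by rewrite le_eqVlt; apply/orP; left; apply/eqP; rewrite /K2; ring.
have hP : normL2 (l i.+1 cP) <= K3 * E.
  apply: cancel_sq; [exact: normL2_ge0|exact: mulr_ge0|].
  have := ibp L0 w1 h3 h5; rewrite /leibniz => h.
  have hs := stress_L2 i.+1 hl; have hds := dstress_L2 i.+1 hl.
  have -> : normL2 (l i.+1 cP) ^+ 2 = - I (fun x => b x * l i.+2 cP x * l i.+1 cP x)
      - I (fun x => dstress l i.+1 x * l i cV x).
    rewrite normL2_sq -[LHS]subr0 -h; int_tac; apply: eq_int => x _; rewrite /stress; ring.
  apply: (le_trans (ler_norm _)); apply: (le_trans (ler_normB _ _)); rewrite normrN.
  rewrite /K3 mulrDl mulrDr lerD//.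
    apply: (le_trans (abs_int_le hb (ltW hb0) _ (hl _ _) (hl _ _))).
      by move=> x _; exact: b_le.
    by rewrite mulrC ler_wpM2l ?normL2_ge0// ler_wpM2l ?hE// ltW.
  apply: (le_trans (normL2_abs_int hds (hl _ _))).
  rewrite mulrC; apply: (@le_trans _ _ (K1 * normL2 (l i.+1 cP) * ((1 + `|c0| * K1) * E))).
    apply: ler_pM; rewrite ?normL2_ge0//; first exact: (poincare L0 h5).
    apply: (le_trans (normL2D (hl _ _) (bddM_L2 hc (hl _ _)))).
    rewrite mulrDl mul1r lerD ?hE//; apply: (le_trans (cM _)).
    by rewrite -mulrA ler_wpM2l.
  by rewrite le_eqVlt; apply/orP; left; apply/eqP; rewrite /K2; ring.
rewrite enE// EE !mulrDl -!exprMn.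
by rewrite !lerD// lerXn2r ?nnegrE ?normL2_ge0// mulr_ge0.
Qed.

(** * Functionals that are harmless after integration in time *)

Definition traj (tr : R -> lev) := (forall t : R, 0 < t -> valid (tr t)) /\
  forall (t : R) i k, 0 < t -> (i <= 4)%N -> L2deriv L (fun s => tr s i k) (tr t i.+1 k) t.

Implicit Types (F G : lev -> R).

(* [G] is the time derivative along trajectories of [F], which the energies of
   the levels 1 to 4 bound. *)
Definition is_time_deriv F G :=
  (forall tr, traj tr -> forall t : R, 0 < t -> is_derive t 1 (fun s => F (tr s)) (G (tr t))) /\
  exists K, 0 <= K /\ forall l, valid l ->
    `|F l| <= K * (en l 1 + en l 2 + en l 3 + en l 4).

Lemma is_time_deriv0 : is_time_deriv (fun=> 0) (fun=> 0).
Proof.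
split; first by move=> l hl t t0; exact: is_derive_cst.
by exists 0; split=> // l _; rewrite normr0 mul0r.
Qed.

Lemma is_time_derivD F G F' G' : is_time_deriv F G -> is_time_deriv F' G' ->
  is_time_deriv (fun l => F l + F' l) (fun l => G l + G' l).
Proof.
move=> [h1 [K [K0 h2]]] [h3 [K' [K'0 h4]]]; split.
  move=> l hl t t0; have := h1 _ hl _ t0; have := h3 _ hl _ t0 => ? ?.
  exact: is_deriveD.
exists (K + K'); split; first exact: addr_ge0.
by move=> l hl; rewrite mulrDl (le_trans (ler_normD _ _))// lerD ?h2 ?h4.
Qed.

Lemma is_time_derivZ e F G : is_time_deriv F G -> is_time_deriv (fun l => e * F l) (fun l => e *
    G l).
Proof.
move=> [h1 [K [K0 h2]]]; split.
  move=> l hl t t0; have := h1 _ hl _ t0 => ?.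
  exact: is_deriveZ.
exists (`|e| * K); split; first by rewrite mulr_ge0.
by move=> l hl; rewrite normrM -mulrA ler_wpM2l ?h2.
Qed.

(* The time derivative costs nothing after integration in time; the fraction
   of the energy is absorbed at the end. *)
Definition negligible (n : lev -> R) := forall e, 0 < e -> exists C F G,
  [/\ 0 <= C, is_time_deriv F G & forall l, valid l -> n l <= e * en l 3 + C * dissip l + G l].

Implicit Types (n q : lev -> R).

Lemma negligible_eps n : (forall e, 0 < e -> exists q, negligible q /\
  forall l, valid l -> n l <= e * en l 3 + q l) -> negligible n.
Proof.
move=> h e e0; have e2 : 0 < e / 2 by rewrite divr_gt0.
have [q [hm hle]] := h _ e2; have [C [F [G [C0 FG hG]]]] := hm _ e2.
exists C, F, G; split => // l hl; apply: (le_trans (hle _ hl)).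
by have := hG _ hl; rewrite {3}[e]splitr mulrDl; lra.
Qed.

Lemma negligible_le n q : (forall l, valid l -> n l <= q l) -> negligible q -> negligible n.
Proof.
move=> h hm; apply: negligible_eps => e e0; exists q; split => // l hl.
by rewrite (le_trans (h _ hl))// lerDr mulr_ge0 ?en_ge0// ltW.
Qed.

Lemma negligibleD n q : negligible n -> negligible q -> negligible (fun l => n l + q l).
Proof.
move=> hn hm e e0; have e2 : 0 < e / 2 by rewrite divr_gt0.
have [C [F [G [C0 FG hG]]]] := hn _ e2; have [C' [F' [G' [C'0 FG' hG']]]] := hm _ e2.
exists (C + C'), (fun l => F l + F' l), (fun l => G l + G' l); split.
- exact: addr_ge0.
- exact: is_time_derivD.
- move=> l hl; have := hG _ hl; have := hG' _ hl.
  have : e * en l 3 = e / 2 * en l 3 + e / 2 * en l 3 by rewrite -mulrDl -splitr.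
  by move: (e / 2 * en l 3) (e * en l 3) => a1 a2 *; lra.
Qed.

Lemma negligibleZ e n : 0 <= e -> negligible n -> negligible (fun l => e * n l).
Proof.
rewrite le_eqVlt => /predU1P[<-|e0] hn.
  move=> d d0; exists 0, (fun=> 0), (fun=> 0); split => //; first exact: is_time_deriv0.
  by move=> l _; rewrite !mul0r !addr0 mulr_ge0 ?en_ge0// ltW.
move=> d d0; have [C [F [G [C0 FG hG]]]] := hn _ (divr_gt0 d0 e0).
exists (e * C), (fun l => e * F l), (fun l => e * G l); split.
- by rewrite mulr_ge0// ltW.
- exact: is_time_derivZ.
- move=> l hl; have := hG _ hl; rewrite -(ler_pM2l e0) => /le_trans; apply.
  rewrite le_eqVlt; apply/orP; left; apply/eqP; field; exact: lt0r_neq0.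
Qed.

Lemma negligible_time_deriv F G : is_time_deriv F G -> negligible G.
Proof.
move=> hF e e0; exists 0, F, G; split => // l hl.
by rewrite mul0r addr0 lerDr mulr_ge0 ?en_ge0// ltW.
Qed.

Lemma negligible_diss i : (2 <= i <= 5)%N -> negligible (fun l => diss l i).
Proof.
move=> hi e e0; exists 1, (fun=> 0), (fun=> 0); split => //; first exact: is_time_deriv0.
move=> l hl; rewrite mul1r addr0 ler_wpDl//; first by rewrite mulr_ge0 ?en_ge0// ltW.
have := (diss_ge0 l 2, diss_ge0 l 3, diss_ge0 l 4, diss_ge0 l 5) => -[[[? ?] ?] ?].
by rewrite /dissip; case: i hi => [|[|[|[|[|[|]]]]]]// _; lra.
Qed.

Definition sq l i k := I (fun x => l i k x * l i k x).

Lemma sq_le_en l i k : (forall i k, L2 (l i k)) -> sq l i k <= en l i.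
Proof.
move=> hl; rewrite /sq -normL2_sq.
rewrite -[leRHS](sqr_sqrtr (en_ge0 l i)) lerXn2r ?nnegrE ?normL2_ge0 ?sqrtr_ge0//.
exact: normL2_le_en.
Qed.

(** Through [coercive], small multiples of components of the levels 1 and 2 can also be absorbed by
    the energy of level 3. *)
Lemma sq_le : exists K, 0 < K /\ forall l i k, valid l -> (1 <= i <= 3)%N ->
  sq l i k <= K * en l 3.
Proof.
have [K [K0 hK]] := coercive.
exists (1 + K + K * K); split; first by rewrite -addrA ltr_pwDl// addr_ge0// mulr_ge0.
move=> l i k hl /andP[i0 i3]; have [hL _] := hl; apply: (le_trans (sq_le_en _ _ hL)).
have h1 := hK l 1 hl isT; have h2 := hK l 2 hl isT.
have e3 := en_ge0 l 3; have e2 := en_ge0 l 2.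
case: i i0 i3 => [|[|[|[|]]]]// _ _; rewrite !mulrDl mul1r -!mulrA.
- apply: (le_trans h1); apply: (le_trans (ler_wpM2l K0 h2)).
  by rewrite lerDr addr_ge0 ?mulr_ge0.
- by apply: (le_trans h2); rewrite addrAC lerDr addr_ge0 ?mulr_ge0.
- by rewrite -addrA lerDl addr_ge0 ?mulr_ge0.
Qed.

Lemma young e x y : 0 < e -> x * y <= e * (x * x) + e^-1 * (y * y).
Proof.
move=> e0; rewrite -subr_ge0.
have -> : e * (x * x) + e^-1 * (y * y) - x * y =
    e * ((x - y / (2 * e)) ^+ 2 + 3 * (y / (2 * e)) ^+ 2).
  by field; rewrite lt0r_neq0.
apply: mulr_ge0; first exact: ltW.
by apply: addr_ge0; [exact: sqr_ge0|rewrite mulr_ge0 ?sqr_ge0].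
Qed.

Definition pair w i k j k' l := I (fun x => w x * l i k x * l j k' x).

Lemma is_time_deriv_pair w i k j k' : bdd L w -> (1 <= i <= 4)%N -> (1 <= j <= 4)%N ->
  is_time_deriv (pair w i k j k') (fun l => pair w i.+1 k j k' l + pair w i k j.+1 k' l).
Proof.
move=> hw i4 j4; split.
  move=> tr [hv hd] t t0; have [hL _] := hv _ t0.
  apply: (@is_derive_pair _ _ w (fun s => tr s i k) (fun s => tr s j k')) => //.
  - by move=> s s0; have [hLs _] := hv _ s0.
  - by apply: hd => //; case/andP: i4.
  - by apply: hd => //; case/andP: j4.
have [M [M0 hM]] := bdd_bound hw; exists (2 * M); split; first exact: mulr_ge0.
move=> l [hL _]; apply: le_trans (abs_int_le hw M0 hM (hL _ _) (hL _ _)) _.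
have := (en_ge0 l 1, en_ge0 l 2, en_ge0 l 3, en_ge0 l 4) => -[[[? ?] ?] ?].
have le_sum (r : nat) : (1 <= r <= 4)%N -> en l r <= en l 1 + en l 2 + en l 3 + en l 4.
  by case: r => [|[|[|[|[|]]]]]// _; lra.
have hle (r : nat) k1 : (1 <= r <= 4)%N -> normL2 (l r k1) ^+ 2 <= en l 1 + en l 2 + en l 3 + en
    l 4.
  move=> hq; apply: le_trans (le_sum _ hq); rewrite normL2_sq; exact: sq_le_en.
have := hle _ k i4; have := hle _ k' j4.
move: (normL2_ge0 L (l i k)) (normL2_ge0 L (l j k')).
move: (normL2 (l i k)) (normL2 (l j k')) (en l 1 + _ + _ + _) => a1 a2 S a10 a20 h1 h2.
rewrite -mulrA [2 * M]mulrC -mulrA ler_wpM2l//.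
have := young a1 a2 ltr01; rewrite invr1 !mul1r -!expr2; lra.
Qed.

(** The integrals of [(w u_t^2)'] and [(w stress^2)'] vanish: this is the multiplier [2 w stress],
    the stress replacing [u_x], which need not be in H1. Completing the viscous product to a time
    derivative costs the term with [l i.+2 cP]. *)
Lemma mult_u w w' l i : weight L w w' -> w 0 = 0 -> w L = 0 -> valid l -> (i <= 4)%N ->
  I (fun x => w' x * (l i cV x * l i cV x + stress l i x * stress l i x))
  + 2 * (pair w i.+1 cV i cP l + pair w i cV i.+1 cP l)
  + 2 * (pair (fun x => w x * b x) i.+1 cV i.+1 cP l
         + pair (fun x => w x * b x) i cV i.+2 cP l) =
  I (fun x => 2 * w x * b x * l i cV x * l i.+2 cP x)
  - I (fun x => 2 * w x * c x * l i cZ x * stress l i x).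
Proof.
move=> hw w0 wL [hl hv] i4; have [h1 h2 h3 h4] := hv i i4; have [bw bw' _] := hw.
have := ibp_H1 L0 hw w0 wL (H10_H1 L0 h1) (H10_H1 L0 h1).
have := ibp_H1 L0 hw w0 wL h3 h3; rewrite /leibniz => e1 e2.
have hs := stress_L2 i hl; have hds := dstress_L2 i hl.
apply/eqP; rewrite -subr_eq0; apply/eqP.
rewrite -[RHS]addr0 -{1}e1 -e2 /pair; int_tac; apply: eq_int => x _.
by rewrite /dstress /stress; ring.
Qed.

(** The same computation with [y_x] itself as the flux, hence without viscous terms. *)
Lemma mult_y w w' l i : weight L w w' -> w 0 = 0 -> w L = 0 -> valid l -> (i <= 4)%N ->
  I (fun x => w' x * (l i cZ x * l i cZ x + l i cQ x * l i cQ x))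
  + 2 * (pair w i.+1 cZ i cQ l + pair w i cZ i.+1 cQ l) =
  I (fun x => 2 * w x * c x * l i cV x * l i cQ x).
Proof.
move=> hw w0 wL [hl hv] i4; have [h1 h2 h3 h4] := hv i i4; have [bw bw' _] := hw.
have := ibp_H1 L0 hw w0 wL (H10_H1 L0 h2) (H10_H1 L0 h2).
have := ibp_H1 L0 hw w0 wL h4 h4; rewrite /leibniz => e1 e2.
have hds := dQ_L2 i hl.
apply/eqP; rewrite -subr_eq0; apply/eqP.
rewrite -[RHS]addr0 -{1}e1 -e2 /pair; int_tac; apply: eq_int => x _.
by rewrite /dQ; ring.
Qed.

(* The first equation times y_t plus the second one times u_t, where the terms
   u_x y_tx and y_x u_tx combine into a time derivative. *)
Lemma mult_cross l i : valid l -> (i <= 4)%N ->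
  I (fun x => c x * (l i cZ x * l i cZ x))
  + (pair (fun=> 1) i.+1 cV i cZ l + pair (fun=> 1) i cV i.+1 cZ l)
  + (pair (fun=> 1) i.+1 cP i cQ l + pair (fun=> 1) i cP i.+1 cQ l)
  + (pair b i.+2 cP i cQ l + pair b i.+1 cP i.+1 cQ l) =
  I (fun x => c x * (l i cV x * l i cV x)) + I (fun x => b x * l i.+2 cP x * l i cQ x).
Proof.
move=> [hl hv] i4; have [h1 h2 h3 h4] := hv i i4.
have e1 := ibp L0 w1 h3 h2; have e2 := ibp L0 w1 h4 h1.
have hs := stress_L2 i hl; have hds := dstress_L2 i hl; have hdq := dQ_L2 i hl.
have h1b : bdd L (fun=> 1 : R) by exact: bdd_cst.
apply/eqP; rewrite -subr_eq0; apply/eqP.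
rewrite -[RHS]addr0 -[X in _ = X + _]e1 -[X in _ = _ + X]e2 /leibniz /pair; int_tac;
    apply: eq_int => x _.
by rewrite /dQ /dstress /stress; ring.
Qed.

Lemma mulrr_ge0 x : 0 <= x * x. Proof. by rewrite -expr2 sqr_ge0. Qed.

Lemma indic_in (x y e : R) : x < e < y -> (\1_(`]x, y[) : R -> R) e = 1.
Proof. by move=> h; rewrite indicE mem_set//= in_itv/= h. Qed.

Lemma indic_out (x y e : R) : (e <= x) || (y <= e) -> (\1_(`]x, y[) : R -> R) e = 0.
Proof.
move=> h; rewrite indicE memNset//= in_itv/=; apply/negP.
by rewrite negb_and -!leNgt.
Qed.

Lemma indic01 (x y e : R) : 0 <= (\1_(`]x, y[) : R -> R) e <= 1.
Proof. by rewrite indicE; case: (_ \in _); rewrite /= ?lexx ?ler01. Qed.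

(** * Localised multipliers in the damped interval *)

Section Plateau.
Variables a1 a2 a3 a4 : R.
Hypotheses (h0 : 0 <= a1) (h1 : a1 < a2) (h2 : a2 < a3) (h3 : a3 < a4) (h4 : a4 < L).

(** A trapezoid, written as a combination of ramps so that [weight_comb] applies; the constant
    cancels the values of the ramps to the left of [a1]. *)
Definition plateau x := ((- (a1 / (a2 - a1)) + a3 / (a4 - a3)) + (a2 - a1)^-1 * ramp a1 a2 x)
  + (- (a4 - a3)^-1) * ramp a3 a4 x.
Definition dplateau : R -> R := fun x => (0 + (a2 - a1)^-1 * \1_(`]a1, a2[) x)
  + (- (a4 - a3)^-1) * \1_(`]a3, a4[) x.

Let h21 : 0 < a2 - a1. Proof. by rewrite subr_gt0. Qed.
Let h43 : 0 < a4 - a3. Proof. by rewrite subr_gt0. Qed.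
Let n21 : a2 - a1 != 0. Proof. exact: lt0r_neq0. Qed.
Let n43 : a4 - a3 != 0. Proof. exact: lt0r_neq0. Qed.

Lemma weight_plateau : weight L plateau dplateau.
Proof.
have [? ? ? ?] := And4 h1 h2 h3 h4; have ? := h0.
apply: weight_comb; last by apply: weight_ramp; lra.
apply: weight_comb; last by apply: weight_ramp; lra.
exact: (weight_cst _ (ltW L0)).
Qed.

Lemma plateau_out x : (x <= a1) || (a4 <= x) -> plateau x = 0 /\ dplateau x = 0.
Proof.
have [? ? ? ?] := And4 h1 h2 h3 h4.
move=> hx; rewrite /plateau /dplateau !indic_out; last 2 first.
- by case/orP: hx => hx; apply/orP; [left|right]; lra.
- by case/orP: hx => hx; apply/orP; [left|right]; lra.
split; last by rewrite !mulr0 !addr0.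
by case/orP: hx => hx; [rewrite !rampl|rewrite !rampr]; try lra; field; rewrite n21 n43.
Qed.

Lemma plateau_in x : a2 <= x <= a3 -> plateau x = 1.
Proof.
have [? ? ? ?] := And4 h1 h2 h3 h4.
move=> /andP[hx hx']; rewrite /plateau (@rampr _ a1 a2)//; last lra.
by rewrite (@rampl _ a3 a4)//; [field; rewrite n21 n43|lra].
Qed.

Lemma plateau_ge0 x : 0 <= plateau x.
Proof.
have [? ? ? ?] := And4 h1 h2 h3 h4.
have [hx|hx] := leP x a1; first by rewrite (plateau_out _).1// hx.
have [hx'|hx'] := leP a4 x; first by rewrite (plateau_out _).1// hx' orbT.
have [hx2|hx2] := leP a2 x.
  have [hx3|hx3] := leP x a3; first by rewrite plateau_in ?hx2.
  rewrite /plateau (@rampr _ a1 a2)//; last lra.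
  rewrite rampm; last lra.
  rewrite (_ : _ + _ = (a4 - x) / (a4 - a3)); last by field; rewrite n21 n43.
  by rewrite divr_ge0//; lra.
rewrite /plateau rampm; last lra.
rewrite rampl; [|lra|lra].
rewrite (_ : _ + _ = (x - a1) / (a2 - a1)); last by field; rewrite n21 n43.
by rewrite divr_ge0//; lra.
Qed.

End Plateau.

Definition be1 := b1 + (b2 - b1) / 3.
Definition be2 := b1 + 2 * ((b2 - b1) / 3).
Definition ga1 := c1 + (c2 - c1) / 3.
Definition ga2 := c1 + 2 * ((c2 - c1) / 3).
Definition theta := plateau b1 be1 be2 b2.
Definition dtheta := dplateau b1 be1 be2 b2.
Definition phi := plateau c1 ga1 ga2 c2.
Definition dphi := dplateau c1 ga1 ga2 c2.
Definition chic : R -> R := \1_(`]c1, c2[).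

Let be12 : [/\ b1 < be1, be1 < be2 & be2 < b2].
Proof. by rewrite /be1 /be2; hyps; split; lra. Qed.
Let ga12 : [/\ c1 < ga1, ga1 < ga2 & ga2 < c2].
Proof. by rewrite /ga1 /ga2; hyps; split; lra. Qed.

Let wtheta : weight L theta dtheta.
Proof. by have [? ? ?] := be12; hyps; apply: weight_plateau => //; lra. Qed.
Let wphi : weight L phi dphi.
Proof. by have [? ? ?] := ga12; hyps; apply: weight_plateau => //; lra. Qed.

Let bth : bdd L theta. Proof. by case: wtheta. Qed.
Let bdth : bdd L dtheta. Proof. by case: wtheta. Qed.
Let bph : bdd L phi. Proof. by case: wphi. Qed.
Let bdph : bdd L dphi. Proof. by case: wphi. Qed.
Let bch : bdd L chic. Proof. exact: bdd_indic. Qed.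

(** The pointwise estimates are settled by this case distinction: as [b2 < c1], at every point the
    family [b], [theta], [dtheta] or the family [c], [chic], [phi], [dphi] vanishes. *)
Variant region_spec x : R -> R -> R -> R -> R -> R -> R -> Prop :=
| RegionB of b1 < x < b2 : region_spec x b0 0 0 (theta x) (dtheta x) 0 0
| RegionC of c1 < x < c2 : region_spec x 0 c0 1 0 0 (phi x) (dphi x)
| RegionO : region_spec x 0 0 0 0 0 0 0.

Lemma regionP x :
  region_spec x (b x) (c x) (chic x) (theta x) (dtheta x) (phi x) (dphi x).
Proof.
have [? ? ?] := be12; have [? ? ?] := ga12; hyps.
have thb : ~~ (b1 < x < b2) -> theta x = 0 /\ dtheta x = 0.
  by rewrite negb_and -!leNgt => h; apply: plateau_out => //; lra.
have phc : ~~ (c1 < x < c2) -> phi x = 0 /\ dphi x = 0.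
  by rewrite negb_and -!leNgt => h; apply: plateau_out => //; lra.
have bo (u v : R) : ~~ (u < x < v) -> (\1_(`]u, v[) : R -> R) x = 0.
  by rewrite negb_and -!leNgt; exact: indic_out.
have [xb|xb] := boolP (b1 < x < b2).
  have nc : ~~ (c1 < x < c2) by move: xb; rewrite negb_and -!leNgt => /andP[? ?]; apply/orP;
      left; lra.
  have [-> ->] := phc nc; rewrite /b /c /chic (bo _ _ nc) mulr0 indic_in// mulr1.
  exact: RegionB.
have [-> ->] := thb xb; rewrite /b bo// mulr0.
have [hcx|hcx] := boolP (c1 < x < c2).
  by rewrite /c /chic indic_in// mulr1; exact: RegionC.
have [-> ->] := phc hcx; rewrite /c /chic bo// mulr0; exact: RegionO.
Qed.

Lemma negligible_sq n i k : (1 <= i <= 3)%N -> (forall e, 0 < e -> exists q, negligible q /\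
  forall l, valid l -> n l <= e * sq l i k + q l) -> negligible n.
Proof.
move=> hi h; have [K [K0 hK]] := sq_le; apply: negligible_eps => e e0.
have [q [hq hle]] := h _ (divr_gt0 e0 K0); exists q; split=> // l hl.
apply: le_trans (hle _ hl) _; rewrite lerD2r.
apply: (le_trans (ler_wpM2l (ltW (divr_gt0 e0 K0)) (hK _ _ k hl hi))).
by rewrite mulrA divfK// lt0r_neq0.
Qed.

Definition sqw w l i k := I (fun x => w x * (l i k x * l i k x)).

(** The first equation is multiplied by [theta u], where the displacement [u] of level [i.+1] is
    [l i cV]. Apart from [theta u_t^2] this leaves a time derivative, products of gradients that are
    damped on the support of [theta], and a term from [dtheta] in which [u] is absorbed by Young's
    inequality. *)
Lemma negligible_theta i : i = 1%N \/ i = 2%N -> negligible (fun l => sqw theta l i.+1 cV).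
Proof.
move=> hi; apply: (@negligible_sq _ i cV) => [|e e0]; first by case: hi => ->.
have [M1 [M10 hM1]] := bdd_bound bth; have [M2 [M20 hM2]] := bdd_bound bdth.
pose K1 := 2 * M1 + M2 ^+ 2 / e.
have K10 : 0 <= K1 by rewrite addr_ge0 ?mulr_ge0 ?sqr_ge0 ?invr_ge0// ltW.
(* [(1 + b0^2) 3] bounds [p^2] and the squared stress by [p^2 + p'^2]; dividing by [b0], the value
   of [b] there, expresses the bound by the dissipation densities. *)
pose C := K1 * (1 + b0 ^+ 2) * 3 / b0.
have C0 : 0 <= C.
  by rewrite /C divr_ge0 ?(ltW hb0)// mulr_ge0// mulr_ge0// addr_ge0 ?sqr_ge0.
have i4 : (i.+1 <= 4)%N by case: hi => ->.
exists (fun l => (C * diss l i.+1 + C * diss l i.+2) +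
  (pair theta i.+2 cV i cV l + pair theta i.+1 cV i.+1 cV l)); split.
  apply: negligibleD.
    by apply: negligibleD; apply: negligibleZ => //; apply: negligible_diss; case: hi => ->.
  by apply/negligible_time_deriv/is_time_deriv_pair => //; case: hi => ->.
move=> l [hl hv]; have [_ _ hS _] := hv _ i4; have [hV _ _ _] := hv _ (ltnW i4).
have hs := stress_L2 i.+1 hl; have hds := dstress_L2 i.+1 hl.
have hI := ibp L0 wtheta hS hV; rewrite -[X in _ <= X]subr0 -[X in _ <= _ - X]hI.
rewrite /leibniz /sqw /sq /diss /pair; int_tac.
apply: int_le; [by itg_tac|by itg_tac|move=> x xD].
rewrite /stress /dstress -subr_ge0.
have := hM1 _ xD; have := hM2 _ xD.
case: regionP => [_|_|] m1 m2; last 2 first.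
- by rewrite (_ : _ - _ = e * (l i cV x * l i cV x));
    [rewrite mulr_ge0 ?(ltW e0)// -expr2 sqr_ge0|ring].
- by rewrite (_ : _ - _ = e * (l i cV x * l i cV x));
    [rewrite mulr_ge0 ?(ltW e0)// -expr2 sqr_ge0|ring].
move: (l i cV x) (l i.+1 cV x) (l i.+1 cP x) (l i.+2 cP x) (l i.+2 cV x) (l i.+1 cZ x) => w v p
    p' v' z.
set th := theta x in m2 *; set dth := dtheta x in m1 *.
pose S := p + b0 * p'.
have e1 : th * S * p + dth * S * w <= e * (w * w) + K1 * (p * p + S * S).
  have y1 : th * (S * p) <= M1 * (p * p + S * S).
    apply: le_trans (ler_norm _) _; rewrite normrM ler_pM//.
    have := young `|S| `|p| ltr01; rewrite -normrM invr1 !mul1r -!expr2 !real_normK ?num_real//.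
    by rewrite addrC.
  have y2 := young w (dth * S) e0.
  have y3 : e^-1 * (dth * S * (dth * S)) <= M2 ^+ 2 / e * (S * S).
    rewrite [leLHS](_ : _ = dth ^+ 2 / e * (S * S)); last by ring.
    rewrite ler_wpM2r// -?expr2 ?sqr_ge0// ler_wpM2r ?invr_ge0 ?(ltW e0)//.
    by rewrite -(real_normK (num_real dth)) lerXn2r ?nnegrE.
  have y4 : 0 <= M1 * (p * p + S * S) by rewrite mulr_ge0// addr_ge0// -expr2 sqr_ge0.
  have y5 : 0 <= M2 ^+ 2 / e * (p * p) by apply: mulr_ge0;
      [rewrite divr_ge0 ?sqr_ge0 ?(ltW e0)|exact: mulrr_ge0].
  have := mulrC w (dth * S); rewrite /K1; lra.
have e2 : p * p + S * S <= (1 + b0 ^+ 2) * 3 * (p * p + p' * p').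
  rewrite -subr_ge0 (_ : _ - _ = (p - b0 * p') ^+ 2 + 3 * b0 ^+ 2 * p ^+ 2 + (3 + b0 ^+ 2) * p'
      ^+ 2).
    apply: addr_ge0; last exact: mulr_ge0 (addr_ge0 (ler0n _ _) (sqr_ge0 _)) (sqr_ge0 _).
    apply: addr_ge0; first exact: sqr_ge0.
    exact: mulr_ge0 (mulr_ge0 (ler0n _ _) (sqr_ge0 _)) (sqr_ge0 _).
  by rewrite /S; ring.
have e3 := ler_wpM2l K10 e2.
have e4 : C * (b0 * (p * p)) + C * (b0 * (p' * p')) = K1 * ((1 + b0 ^+ 2) * 3 * (p * p + p' * p')).
  by rewrite /C; field; exact: lt0r_neq0.
rewrite -/S e4; move: e1 e3; move: (K1 * _) (K1 * _) => a1 a2; rewrite mul0r addr0.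
move=> e1 e3; lra.
Qed.

Let w1b : bdd L (fun=> 1 : R). Proof. exact: bdd_cst. Qed.

Lemma b_sq x : b x * b x = b0 * b x.
Proof. by case: regionP => *; ring. Qed.

(** Young's inequality; [b^2 = b0 b] turns the square of the damped factor into dissipation. *)
Lemma negligible_damped w i j k : bdd L w -> (1 <= i <= 3)%N -> (2 <= j <= 5)%N ->
  negligible (fun l => I (fun x => w x * b x * l i k x * l j cP x)).
Proof.
move=> hw hi hj; apply: (negligible_sq (i := i) (k := k)) => // e e0.
have [M [M0 hM]] := bdd_bound hw.
have C0 : 0 <= e^-1 * M ^+ 2 * b0.
  by rewrite !mulr_ge0 ?invr_ge0 ?sqr_ge0// ltW.
exists (fun l => e^-1 * M ^+ 2 * b0 * diss l j); split.
  by apply: negligibleZ => //; exact: negligible_diss.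
move=> l [hl hv]; rewrite /sq /diss; int_tac.
apply: int_le; [by itg_tac|by itg_tac|move=> x xD].
have := young (l i k x) (w x * b x * l j cP x) e0.
rewrite (_ : w x * b x * l j cP x * (w x * b x * l j cP x) =
  w x ^+ 2 * (b0 * (b x * (l j cP x * l j cP x))));
      last by rewrite [b0 * (b x * _)]mulrA -b_sq; ring.
have h : w x ^+ 2 * (b0 * (b x * (l j cP x * l j cP x))) <=
   M ^+ 2 * (b0 * (b x * (l j cP x * l j cP x))).
  apply: ler_wpM2r; first exact: mulr_ge0 (ltW hb0) (mulr_ge0 (b_ge0 x) (mulrr_ge0 _)).
  by rewrite -(real_normK (num_real (w x))) lerXn2r ?nnegrE ?hM.
have ei : 0 <= e^-1 by rewrite invr_ge0 ltW.
have := ler_wpM2l ei h.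
rewrite (_ : e^-1 * (M ^+ 2 * _) = e^-1 * M ^+ 2 * b0 * (b x * (l j cP x * l j cP x)));
    last by ring.
rewrite (_ : l i k x * _ = w x * b x * l i k x * l j cP x); last by ring.
move: (e^-1 * (w x ^+ 2 * _)) (e^-1 * M ^+ 2 * b0 * _) (e * _) (w x * _ * _ * _) => *; lra.
Qed.

(** A multiplier vanishing at both ends must change the sign of its slope. Those for [u] do so on
    this middle third of the damped interval, where the damping pays for the unwanted terms. *)
Definition ramp_set : R -> R := \1_(`]be1, be2[).
Let bA : bdd L ramp_set. Proof. exact: bdd_indic. Qed.

Lemma ramp_setP x : ramp_set x = 0 \/ [/\ ramp_set x = 1, b x = b0, theta x = 1 & c x = 0].
Proof.
have [? ? ?] := be12; hyps.
have [hx|hx] := boolP (be1 < x < be2); last first.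
  by left; rewrite /ramp_set indic_out//; move: hx; rewrite negb_and -!leNgt.
right; rewrite /ramp_set indic_in//; case/andP: hx => x1 x2.
rewrite {1}/b indic_in ?mulr1; last by apply/andP; split; lra.
have -> : theta x = 1 by apply: plateau_in; rewrite ?ltW//; lra.
by rewrite /c indic_out ?mulr0//; apply/orP; left; lra.
Qed.

Lemma negligible_ramp_set i : i = 1%N \/ i = 2%N -> negligible (fun l => I (fun x =>
  ramp_set x * (l i.+1 cV x * l i.+1 cV x + stress l i.+1 x * stress l i.+1 x))).
Proof.
move=> hi; pose C1 := 2 / b0; pose C2 := 2 * b0.
have C10 : 0 <= C1 by rewrite divr_ge0// ltW.
have C20 : 0 <= C2 by rewrite mulr_ge0// ltW.
apply: (@negligible_le _ (fun l => sqw theta l i.+1 cV + (C1 * diss l i.+1 + C2 * diss l i.+2)));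
    last first.
  apply: negligibleD; first exact: negligible_theta.
  by apply: negligibleD; apply: negligibleZ => //; apply: negligible_diss; case: hi => ->.
move=> l [hl hv]; have hs := stress_L2 i.+1 hl; rewrite /sqw /diss; int_tac.
apply: int_le; [by itg_tac|by itg_tac|move=> x xD].
have th0 : 0 <= theta x.
  by have [? ? ?] := be12; hyps; apply: plateau_ge0 => //; lra.
have hb' := b_ge0 x.
case: (ramp_setP x) => [->|[-> hbx -> _]].
  rewrite mul0r; apply: addr_ge0; first exact: mulr_ge0 th0 (mulrr_ge0 _).
  by apply: addr_ge0; apply: mulr_ge0 => //; exact: mulr_ge0 hb' (mulrr_ge0 _).
rewrite mul1r mul1r lerD2l /stress hbx.
have -> : C1 * (b0 * (l i.+1 cP x * l i.+1 cP x)) = 2 * l i.+1 cP x ^+ 2.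
  by rewrite /C1; field; exact: lt0r_neq0.
rewrite -subr_ge0 (_ : _ - _ = (l i.+1 cP x - b0 * l i.+2 cP x) ^+ 2) ?sqr_ge0//.
by rewrite /C2; ring.
Qed.

(** * The two velocities on the coupling interval *)

Definition kappa := (c0 * (c2 - c1)) ^+ 2.

Lemma kappa_lt1 : kappa < 1.
Proof.
have d0 : 0 < c2 - c1 by rewrite subr_gt0.
have h : `|c0 * (c2 - c1)| < 1.
  by rewrite normrM (gtr0_norm d0) -ltr_pdivlMr// mul1r.
by rewrite /kappa -(real_normK (num_real _)) expr_lt1.
Qed.

Definition coupling_slope := (c2 - be2) / (be2 - be1).
(** Zero up to [be1], rising to [c2 - be2] at [be2], then falling with slope -1 to zero at [c2]. The
    slope -1 gives [u_t^2 + stress^2] the favourable sign all the way from the damped to the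
    coupling interval. *)
Definition coupling_weight x := ((- coupling_slope * be1 + be2) + coupling_slope * ramp be1 be2
    x) + (-1) * ramp be2 c2 x.
Definition dcoupling_weight : R -> R := fun x => (0 + coupling_slope * ramp_set x) + (-1) *
    \1_(`]be2, c2[) x.

Let be21 : 0 < be2 - be1. Proof. by have [_ h _] := be12; rewrite subr_gt0. Qed.

Let wcoupling : weight L coupling_weight dcoupling_weight.
Proof.
have [? ? ?] := be12; hyps.
apply: weight_comb; last by apply: weight_ramp; lra.
apply: weight_comb; last by apply: weight_ramp; lra.
exact: (weight_cst _ (ltW L0)).
Qed.

Lemma coupling_weight0 : coupling_weight 0 = 0.
Proof. by have [? ? ?] := be12; hyps; rewrite /coupling_weight !rampl; try lra; ring. Qed.

Lemma coupling_weightL : coupling_weight L = 0.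
Proof.
have [? ? ?] := be12; hyps; rewrite /coupling_weight !rampr; try lra.
by rewrite /coupling_slope; field; exact: lt0r_neq0.
Qed.

Lemma coupling_weight_c x : c1 < x < c2 -> coupling_weight x = c2 - x.
Proof.
move=> /andP[? ?]; have [? ? ?] := be12; hyps.
rewrite /coupling_weight (@rampr _ be1 be2); try lra; rewrite (@rampm _ be2 c2); try lra.
by rewrite /coupling_slope; field; exact: lt0r_neq0.
Qed.

(* The smallness of c0 enters here: the multiplier is c2 - x on (c1, c2). *)
Lemma negligible_coupling1 i : i = 1%N \/ i = 2%N ->
  negligible (fun l => sqw chic l i.+1 cV - kappa * sqw chic l i.+1 cZ).
Proof.
move=> hi; have [? ? ?] := be12; hyps.
have i4 : (i.+1 <= 4)%N by case: hi => ->.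
have hs0 : 0 <= coupling_slope by apply: divr_ge0; [lra|exact: ltW].
have [bh bdh _] := wcoupling.
have bhb : bdd L (fun x => coupling_weight x * b x) by bdd_tac.
have b2h : bdd L (fun x => (-2) * coupling_weight x) by bdd_tac.
apply: (@negligible_le _ (fun l => coupling_slope * I (fun x => ramp_set x *
     (l i.+1 cV x * l i.+1 cV x + stress l i.+1 x * stress l i.+1 x))
   + (2 * (pair coupling_weight i.+2 cV i.+1 cP l + pair coupling_weight i.+1 cV i.+2 cP l)
     + 2 * (pair (fun x => coupling_weight x * b x) i.+2 cV i.+2 cP l
           + pair (fun x => coupling_weight x * b x) i.+1 cV i.+3 cP l)
     + I (fun x => (-2) * coupling_weight x * b x * l i.+1 cV x * l i.+3 cP x)))).
  move=> l hlv; have [hl _] := hlv; have hs := stress_L2 i.+1 hl.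
  have e := mult_u wcoupling coupling_weight0 coupling_weightL hlv i4.
  have -> : I (fun x => (-2) * coupling_weight x * b x * l i.+1 cV x * l i.+3 cP x) =
     - I (fun x => 2 * coupling_weight x * b x * l i.+1 cV x * l i.+3 cP x).
    by int_tac; apply: eq_int => x _; ring.
  set P1 := _ + pair coupling_weight _ _ _ _ l in e *.
  set P2 := _ + pair (fun x => coupling_weight x * b x) i.+1 cV _ _ l in e *.
  have -> : forall a, 2 * P1 + 2 * P2 - a = - I (fun x => dcoupling_weight x * (l i.+1 cV x * l
      i.+1 cV x + stress l i.+1 x * stress l i.+1 x)) - I (fun x => 2 * coupling_weight x * c x *
      l i.+1 cZ x * stress l i.+1 x) + (I (fun x => 2 * coupling_weight x * b x * l i.+1 cV x * l
      i.+3 cP x) - a).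
    by move=> a; lra.
  rewrite subrr addr0 /sqw; int_tac.
  apply: int_le; [by itg_tac|by itg_tac|move=> x xD].
  rewrite /dcoupling_weight -subr_ge0.
  set v := l i.+1 cV x; set z := l i.+1 cZ x; set S := stress l i.+1 x.
  rewrite (_ : _ - _ = \1_(`]be2, c2[) x * (v * v + S * S) - 2 * coupling_weight x * c x * z * S
     - chic x * (v * v - kappa * (z * z))); last by ring.
  have nn : 0 <= (\1_(`]be2, c2[) : R -> R) x * (v * v + S * S).
    by rewrite mulr_ge0 ?addr_ge0 ?mulrr_ge0//; case/andP: (indic01 be2 c2 x).
  case: regionP => [_|hx|].
  - by rewrite mulr0 !mul0r !subr0.
  - rewrite coupling_weight_c// indic_in; last by case/andP: hx => ? ?; apply/andP; split; lra.
    (* Completing the square in the stress leaves a coefficient of [z^2] that is nonnegative because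
       [c2 - x] is at most [c2 - c1]. *)
    rewrite (_ : _ - _ = (S - (c2 - x) * c0 * z) ^+ 2 + (kappa - ((c2 - x) * c0) ^+ 2) * z ^+ 2).
      apply: addr_ge0; first exact: sqr_ge0.
      apply: mulr_ge0; last exact: sqr_ge0.
      rewrite subr_ge0 /kappa !exprMn mulrC ler_wpM2l ?sqr_ge0//.
      have [a1 a2 a3] : [/\ 0 <= c2 - x, c2 - x <= c2 - c1 & 0 <= c2 - c1].
        by case/andP: hx => ? ?; split; lra.
      by rewrite lerXn2r ?nnegrE.
    by ring.
  - by rewrite mulr0 !mul0r !subr0.
apply: negligibleD; first by apply: negligibleZ => //; exact: negligible_ramp_set.
apply: negligibleD; last by apply: negligible_damped => //; case: hi => ->.
by apply: negligibleD; apply/negligible_time_deriv/is_time_derivZ/is_time_deriv_pair => //;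
    case: hi => ->.
Qed.

(** The cross identity divided by [c0], which is where [c0 != 0] enters: the coupling makes the
    velocity of [y] visible through that of [u]. *)
Lemma negligible_coupling2 i : i = 1%N \/ i = 2%N ->
  negligible (fun l => sqw chic l i.+1 cZ - sqw chic l i.+1 cV).
Proof.
move=> hi; have i4 : (i.+1 <= 4)%N by case: hi => ->.
have bci : bdd L (fun=> c0^-1) by exact: bdd_cst.
apply: (@negligible_le _ (fun l => I (fun x => c0^-1 * b x * l i.+1 cQ x * l i.+3 cP x) +
  (((- c0^-1) * (pair (fun=> 1) i.+2 cV i.+1 cZ l + pair (fun=> 1) i.+1 cV i.+2 cZ l)
  + (- c0^-1) * (pair (fun=> 1) i.+2 cP i.+1 cQ l + pair (fun=> 1) i.+1 cP i.+2 cQ l))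
  + (- c0^-1) * (pair b i.+3 cP i.+1 cQ l + pair b i.+2 cP i.+2 cQ l)))).
  move=> l hlv; have [hl _] := hlv; have := mult_cross hlv i4.
  set P1 := _ + pair _ _ _ _ _ l; set P2 := _ + pair _ _ _ _ _ l.
  set P3 := _ + pair _ _ _ _ _ l.
  have cE k : I (fun x => c x * (l i.+1 k x * l i.+1 k x)) = c0 * sqw chic l i.+1 k.
    by rewrite /sqw; int_tac; apply: eq_int => x _; rewrite /c /chic; ring.
  rewrite !cE.
  have -> : I (fun x => c0^-1 * b x * l i.+1 cQ x * l i.+3 cP x) =
     c0^-1 * I (fun x => b x * l i.+3 cP x * l i.+1 cQ x).
    by int_tac; apply: eq_int => x _; ring.
  move: (sqw _ _ _ _) (sqw _ _ _ _) (I _) P1 P2 P3 => Z V B P1 P2 P3 e.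
  rewrite le_eqVlt; apply/orP; left; apply/eqP.
  have -> : B = c0 * V + P1 + P2 + P3 - c0 * Z by rewrite e; ring.
  by field.
apply: negligibleD; first by apply: negligible_damped => //; case: hi => ->.
by apply: negligibleD; [apply: negligibleD|];
    apply/negligible_time_deriv/is_time_derivZ/is_time_deriv_pair;
  do ?[exact: w1b|exact: hb]; case: hi => ->.
Qed.

(** With [V], [Z] for the squared velocities on the coupling interval, [V - kappa Z] and [Z - V] are
    negligible; so is their sum [(1 - kappa) Z], and [kappa < 1]. *)
Lemma negligible_chic i : i = 1%N \/ i = 2%N ->
  negligible (fun l => sqw chic l i.+1 cZ) /\ negligible (fun l => sqw chic l i.+1 cV).
Proof.
move=> hi; have k1 := kappa_lt1; have h1 := negligible_coupling1 hi;
    have h2 := negligible_coupling2 hi.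
have k0 : 0 <= kappa by exact: sqr_ge0.
have k2 : 0 < 1 - kappa by rewrite subr_gt0.
have hZ : negligible (fun l => sqw chic l i.+1 cZ).
  apply: (@negligible_le _ (fun l => (1 - kappa)^-1 *
    ((sqw chic l i.+1 cV - kappa * sqw chic l i.+1 cZ) + (sqw chic l i.+1 cZ - sqw chic l i.+1
        cV)))).
    move=> l _; rewrite le_eqVlt; apply/orP; left; apply/eqP; field; exact: lt0r_neq0.
  by apply: negligibleZ; [rewrite invr_ge0 ltW|exact: negligibleD].
split => //; apply: (@negligible_le _ (fun l => (sqw chic l i.+1 cV - kappa * sqw chic l i.+1 cZ)
   + kappa * sqw chic l i.+1 cZ)); first by move=> l _; rewrite subrK.
by apply: negligibleD => //; exact: negligibleZ.
Qed.

(** The second equation is multiplied by [phi y], where the displacement [y] of level 3 is [l 2 cZ].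
    Controlling that factor takes [negligible_chic] one level lower, the reason why the preceding
    estimates are proved for two values of [i]. *)
Lemma negligible_phi : negligible (fun l => sqw phi l 3 cQ).
Proof.
apply: (@negligible_sq _ 3 cQ) => // e e0.
have [M1 [M10 hM1]] := bdd_bound bph; have [M2 [M20 hM2]] := bdd_bound bdph.
pose C2 := M1 * `|c0|; pose C3 := M1 * `|c0| + e^-1 * M2 ^+ 2.
have C20 : 0 <= C2 by rewrite mulr_ge0.
have C30 : 0 <= C3 by rewrite /C3 addr_ge0 ?mulr_ge0 ?invr_ge0 ?sqr_ge0// ltW.
have [h3Z h3V] := negligible_chic (or_intror erefl : 2%N = 1%N \/ 2%N = 2%N).
have [h2Z _] := negligible_chic (or_introl erefl : 1%N = 1%N \/ 1%N = 2%N).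
exists (fun l => (M1 * sqw chic l 3 cZ + (C2 * sqw chic l 3 cV + C3 * sqw chic l 2 cZ))
  + (-1) * (pair phi 4 cZ 2 cZ l + pair phi 3 cZ 3 cZ l)); split.
  apply: negligibleD; last by apply/negligible_time_deriv/is_time_derivZ/is_time_deriv_pair.
  by apply: negligibleD; [|apply: negligibleD]; exact: negligibleZ.
move=> l [hl hv]; have [_ _ _ hQ] := hv 3%N isT; have [_ hZ _ _] := hv 2%N isT.
have hdq := dQ_L2 3 hl.
have hI := ibp L0 wphi hQ hZ; rewrite -[X in _ <= X]addr0 -[X in _ <= _ + X]hI.
rewrite /leibniz /sqw /sq /pair; int_tac.
apply: int_le; [by itg_tac|by itg_tac|move=> x xD].
rewrite /dQ -subr_ge0; have := hM1 _ xD; have := hM2 _ xD.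
move: (l 3 cQ x) (l 3 cZ x) (l 3 cV x) (l 2 cZ x) (l 4 cZ x) => q z v z2 z4.
case: regionP => [_|_|] m2 m1.
- by have := mulr_ge0 (ltW e0) (mulrr_ge0 q); lra.
- set ph := phi x in m1 *; set dph := dphi x in m2 *.
  rewrite (_ : _ - _ = e * (q * q) + (M1 * (z * z) + (C2 * (v * v) + C3 * (z2 * z2)))
    - ph * (z * z) - ph * c0 * (v * z2) + dph * q * z2); last by ring.
  have y1 : ph * (z * z) <= M1 * (z * z).
    by rewrite ler_wpM2r ?mulrr_ge0// (le_trans (ler_norm _)).
  have y2 : ph * c0 * (v * z2) <= M1 * `|c0| * (v * v + z2 * z2).
    apply: le_trans (ler_norm _) _; rewrite normrM ler_pM// ?normrM ?ler_wpM2r//.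
    have := young `|v| `|z2| ltr01.
    by rewrite -normrM invr1 !mul1r -!expr2 !real_normK ?num_real// normrM.
  have y3 := young q (- dph * z2) e0.
  have y4 : e^-1 * (- dph * z2 * (- dph * z2)) <= e^-1 * M2 ^+ 2 * (z2 * z2).
    rewrite -[X in _ <= X]mulrA ler_wpM2l ?invr_ge0 ?(ltW e0)//.
    rewrite (_ : - dph * z2 * _ = dph ^+ 2 * (z2 * z2)); last by ring.
    rewrite ler_wpM2r ?mulrr_ge0//.
    by rewrite -(real_normK (num_real dph)) lerXn2r ?nnegrE.
  rewrite (_ : q * (- dph * z2) = - (dph * q * z2)) in y3; last by ring.
  rewrite /C2 /C3 mulrDl; rewrite mulrDr in y2; lra.
- by have := mulr_ge0 (ltW e0) (mulrr_ge0 q); lra.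
Qed.

(** * Global multipliers and the full energy of level 3 *)

Section GlobalMultiplier.
Variables a1 a2 : R.
Hypotheses (h0 : 0 < a1) (h1 : a1 < a2) (h2 : a2 < L).
(** Equal to [x] left of [a1] and to [x - L] right of [a2]: the slope is 1 there, and the descent is
    confined to [(a1, a2)], to be placed where the energy density is already under control. *)
Definition global_weight x := (L / (a2 - a1) * a1 + 1 * x) + (- (L / (a2 - a1))) * ramp a1 a2 x.
Definition dglobal_weight : R -> R := fun x => (0 + 1 * 1) + (- (L / (a2 - a1))) * \1_(`]a1, a2[) x.

Lemma weight_global : weight L global_weight dglobal_weight.
Proof.
apply: weight_comb; last exact: weight_ramp (ltW h0) (ltW h1) h2.
exact: (weight_comb _ (weight_cst _ (ltW L0)) (weight_id (ltW L0))).
Qed.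

Lemma global_weight0 : global_weight 0 = 0.
Proof. by rewrite /global_weight rampl ?ltW//; ring. Qed.

Lemma global_weightL : global_weight L = 0.
Proof.
by rewrite /global_weight rampr ?ltW//; field; rewrite subr_eq0 gt_eqF.
Qed.
End GlobalMultiplier.

(** The descent of the multiplier lies in the middle third of the coupling interval, where [chic]
    controls [y_t] and [phi] controls [y_x]. *)
Lemma negligible_y : negligible (fun l => I (fun x => l 3 cZ x * l 3 cZ x + l 3 cQ x * l 3 cQ x)).
Proof.
have [? ? ?] := ga12; hyps.
have [g0 g1 g2] : [/\ 0 < ga1, ga1 < ga2 & ga2 < L] by split; lra.
have wh := weight_global g0 g1 g2; have [bh bdh _] := wh.
have [M [M0 hM]] := bdd_bound bh.
apply: (@negligible_sq _ 3 cQ) => // e e0.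
pose k := L / (ga2 - ga1).
have k0 : 0 <= k by apply: divr_ge0; [exact: ltW|rewrite subr_ge0 ltW].
pose C := e^-1 * (2 * M * `|c0|) ^+ 2.
have C0 : 0 <= C by rewrite mulr_ge0 ?sqr_ge0 ?invr_ge0 ?(ltW e0).
have [h3Z h3V] := negligible_chic (or_intror erefl : 2%N = 1%N \/ 2%N = 2%N).
exists (fun l => (k * (sqw chic l 3 cZ + sqw phi l 3 cQ) + C * sqw chic l 3 cV)
  + (-2) * (pair (global_weight ga1 ga2) 4 cZ 3 cQ l + pair (global_weight ga1 ga2) 3 cZ 4 cQ
      l)); split.
  apply: negligibleD; last by apply/negligible_time_deriv/is_time_derivZ/is_time_deriv_pair.
  by apply: negligibleD; apply: negligibleZ => //; apply: negligibleD => //; exact: negligible_phi.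
move=> l hlv; have [hl _] := hlv.
have := mult_y wh (global_weight0 g0 g1) (global_weightL g1 g2) hlv (isT : (3 <= 4)%N).
set P1 := _ + pair _ _ _ _ _ _ => e1.
rewrite (_ : -2 * P1 = I (fun x => dglobal_weight ga1 ga2 x * (l 3 cZ x * l 3 cZ x + l 3 cQ x * l
    3 cQ x))
  - I (fun x => 2 * global_weight ga1 ga2 x * c x * l 3 cV x * l 3 cQ x)); last by rewrite -e1;
      ring.
rewrite /sqw /sq; int_tac.
apply: int_le; [by itg_tac|by itg_tac|move=> x xD].
have mx := hM _ xD; rewrite -subr_ge0.
have hind : (\1_(`]ga1, ga2[) : R -> R) x * (l 3 cZ x * l 3 cZ x + l 3 cQ x * l 3 cQ x)
   <= chic x * (l 3 cZ x * l 3 cZ x) + phi x * (l 3 cQ x * l 3 cQ x).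
  have p0 : 0 <= phi x by apply: plateau_ge0 => //; lra.
  have [x0 x1] : 0 <= chic x /\ chic x <= 1 by apply/andP; exact: indic01.
  have [hx|hx] := boolP (ga1 < x < ga2); last first.
    rewrite indic_out; last by move: hx; rewrite negb_and -!leNgt.
    rewrite mul0r; apply: addr_ge0.
      exact: mulr_ge0 x0 (mulrr_ge0 _).
    exact: mulr_ge0 p0 (mulrr_ge0 _).
  have hx' : c1 < x < c2 by case/andP: hx => ? ?; apply/andP; split; lra.
  have -> : phi x = 1.
    by apply: plateau_in; case/andP: hx => ? ?; rewrite ?ltW//; lra.
  by rewrite /chic !indic_in// !mul1r.
move: (l 3 cQ x) (l 3 cZ x) (l 3 cV x) hind => q z v hind.
have := ler_wpM2l k0 hind; rewrite /dglobal_weight -/k.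
set g := (\1_(`]ga1, ga2[) : R -> R) x; move=> e2.
have y1 := young q (2 * global_weight ga1 ga2 x * c x * v) e0.
have y2 : e^-1 * (2 * global_weight ga1 ga2 x * c x * v * (2 * global_weight ga1 ga2 x * c x *
    v)) <= C * (chic x * (v * v)).
  rewrite /C -[X in _ <= X]mulrA ler_wpM2l ?invr_ge0 ?(ltW e0)//.
  case: regionP => *; rewrite ?(mulr0, mul0r) ?mulr0//.
  rewrite mul1r [X in X <= _](_ : _ = (2 * global_weight ga1 ga2 x * c0) ^+ 2 * (v * v));
      last by ring.
  rewrite ler_wpM2r ?mulrr_ge0// -(real_normK (num_real (_ * c0))) lerXn2r ?nnegrE ?mulr_ge0//.
  by rewrite !normrM ger0_norm// ler_wpM2r// ler_wpM2l.
rewrite (_ : q * (2 * _ * _ * v) = 2 * global_weight ga1 ga2 x * c x * v * q) in y1; last by ring.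
move: y1 y2 e2; move: (e^-1 * _) (C * _) (2 * global_weight ga1 ga2 x * c x * v * q) => A1 A2 A3
    y1 y2 e2.
rewrite (_ : _ - _ = e * (q * q) + A2 - A3 + (k * (chic x * (z * z) + phi x * (q * q)) - k * (g *
    (z * z + q * q)))); last by ring.
lra.
Qed.

(** The descent of the multiplier lies in the middle third of the damped interval, covered by
    [negligible_ramp_set]. *)
Lemma negligible_u : negligible (fun l => I (fun x => l 3 cV x * l 3 cV x + stress l 3 x * stress
    l 3 x)).
Proof.
have [? ? ?] := be12; hyps.
have [g0 g1 g2] : [/\ 0 < be1, be1 < be2 & be2 < L] by split; lra.
have wh := weight_global g0 g1 g2; have [bh bdh _] := wh.
have bhb : bdd L (fun x => global_weight be1 be2 x * b x) by bdd_tac.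
have b2h : bdd L (fun x => 2 * global_weight be1 be2 x) by bdd_tac.
have [M [M0 hM]] := bdd_bound bh.
apply: (@negligible_sq _ 3 cP) => // e e0.
pose k := L / (be2 - be1).
have k0 : 0 <= k by apply: divr_ge0; [exact: ltW|rewrite subr_ge0 ltW].
pose C := e^-1 * (2 * M * `|c0|) ^+ 2.
have C0 : 0 <= C by rewrite mulr_ge0 ?sqr_ge0 ?invr_ge0 ?(ltW e0).
have [h3Z h3V] := negligible_chic (or_intror erefl : 2%N = 1%N \/ 2%N = 2%N).
have hr := negligible_ramp_set (or_intror erefl : 2%N = 1%N \/ 2%N = 2%N).
exists (fun l => (k * I (fun x => ramp_set x * (l 3 cV x * l 3 cV x + stress l 3 x * stress l 3 x))
  + C * sqw chic l 3 cZ)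
  + ((-2) * (pair (global_weight be1 be2) 4 cV 3 cP l + pair (global_weight be1 be2) 3 cV 4 cP l)
   + (-2) * (pair (fun x => global_weight be1 be2 x * b x) 4 cV 4 cP l
           + pair (fun x => global_weight be1 be2 x * b x) 3 cV 5 cP l)
   + I (fun x => 2 * global_weight be1 be2 x * b x * l 3 cV x * l 5 cP x))); split.
  apply: negligibleD; first by apply: negligibleD; exact: negligibleZ.
  apply: negligibleD; last exact: negligible_damped.
  by apply: negligibleD; apply/negligible_time_deriv/is_time_derivZ/is_time_deriv_pair.
move=> l hlv; have [hl _] := hlv; have hs := stress_L2 3 hl.
have := mult_u wh (global_weight0 g0 g1) (global_weightL g1 g2) hlv (isT : (3 <= 4)%N).
set P1 := _ + pair (global_weight be1 be2) _ _ _ _ _;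
    set P2 := _ + pair (fun x => global_weight be1 be2 x * b x) 3 _ _ _ _.
set B := I (fun x => 2 * global_weight be1 be2 x * b x * l 3 cV x * l 5 cP x) => e1.
rewrite (_ : -2 * P1 + -2 * P2 + B = I (fun x => dglobal_weight be1 be2 x * (l 3 cV x * l 3 cV x
    + stress l 3 x * stress l 3 x))
  + I (fun x => 2 * global_weight be1 be2 x * c x * l 3 cZ x * stress l 3 x)); last by lra.
rewrite /sqw /sq; int_tac.
apply: int_le; [by itg_tac|by itg_tac|move=> x xD].
have mx := hM _ xD; rewrite -subr_ge0.
(* As [b] and [c] have disjoint supports, the coupling term contains [u_x] instead of the stress and
   can be absorbed by [sq l 3 cP]. *)
have hS : c x * stress l 3 x = c x * l 3 cP x.
  by rewrite /stress; case: regionP => *; ring.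
rewrite (_ : 2 * global_weight be1 be2 x * c x * l 3 cZ x * stress l 3 x =
  2 * global_weight be1 be2 x * l 3 cZ x * (c x * stress l 3 x)); last by ring.
rewrite hS; move: (stress l 3 x) (l 3 cP x) (l 3 cZ x) (l 3 cV x) => S p z v.
rewrite /dglobal_weight -/k -/ramp_set.
have y1 := young p (- (2 * global_weight be1 be2 x * c x * z)) e0.
have y2 : e^-1 * (- (2 * global_weight be1 be2 x * c x * z) * - (2 * global_weight be1 be2 x * c
    x * z)) <= C * (chic x * (z * z)).
  rewrite mulrNN /C -[X in _ <= X]mulrA ler_wpM2l ?invr_ge0 ?(ltW e0)//.
  case: regionP => *; rewrite ?(mulr0, mul0r) ?mulr0//.
  rewrite mul1r [X in X <= _](_ : _ = (2 * global_weight be1 be2 x * c0) ^+ 2 * (z * z));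
      last by ring.
  rewrite ler_wpM2r ?mulrr_ge0// -(real_normK (num_real (_ * c0))) lerXn2r ?nnegrE ?mulr_ge0//.
  by rewrite !normrM ger0_norm// ler_wpM2r// ler_wpM2l.
rewrite (_ : p * (- _) = - (2 * global_weight be1 be2 x * z * (c x * p))) in y1; last by ring.
move: y1 y2; move: (e^-1 * _) (C * _) (2 * global_weight be1 be2 x * z * (c x * p)) => A1 A2 A3
    y1 y2.
rewrite (_ : _ - _ = e * (p * p) + A2 + A3); last by ring.
lra.
Qed.

Lemma negligible_en : negligible (fun l => en l 3).
Proof.
have b00 : 0 <= 2 * b0 by rewrite mulr_ge0// ltW.
apply: (@negligible_le _ (fun l => (2 * I (fun x => l 3 cV x * l 3 cV x + stress l 3 x * stress l
    3 x)
   + (2 * b0) * diss l 4) + I (fun x => l 3 cZ x * l 3 cZ x + l 3 cQ x * l 3 cQ x))).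
  move=> l [hl _]; have hs := stress_L2 3 hl; rewrite /en /diss; int_tac.
  apply: int_le; [by itg_tac|by itg_tac|move=> x xD].
  (* This recovers [u_x] from the stress: [u_x^2] is at most [2 stress^2 + 2 b^2 u_tx^2], and
     [b^2 = b0 b]. *)
  rewrite -subr_ge0 (_ : _ - _ = l 3 cV x * l 3 cV x + (l 3 cP x + 2 * b x * l 4 cP x) ^+ 2
     + 2 * (b0 * b x - b x * b x) * (l 4 cP x * l 4 cP x)); last by rewrite /stress; ring.
  by rewrite b_sq subrr mulr0 mul0r addr0 addr_ge0 ?mulrr_ge0 ?sqr_ge0.
apply: negligibleD; last exact: negligible_y.
by apply: negligibleD; apply: negligibleZ => //; [exact: negligible_u|exact: negligible_diss].
Qed.

(** * Energy balance and integration in time *)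

Lemma en_pair l i : (forall i k, L2 (l i k)) -> en l i = pair (fun=> 1) i cP i cP l
  + pair (fun=> 1) i cV i cV l + pair (fun=> 1) i cQ i cQ l + pair (fun=> 1) i cZ i cZ l.
Proof.
by move=> hl; have h1b := w1b; rewrite /en /pair; int_tac; apply: eq_int => x _; ring.
Qed.

(** Each equation is tested with its own velocity; the two coupling terms are opposite and only the
    viscous term survives. *)
Lemma diss_pair l i : valid l -> (i <= 4)%N ->
  pair (fun=> 1) i.+1 cP i cP l + pair (fun=> 1) i.+1 cV i cV l
  + pair (fun=> 1) i.+1 cQ i cQ l + pair (fun=> 1) i.+1 cZ i cZ l = - diss l i.+1.
Proof.
move=> [hl hv] i4; have [h1 h2 h3 h4] := hv i i4; have h1b := w1b.
have e1 := ibp L0 w1 h3 h1; have e2 := ibp L0 w1 h4 h2.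
have hs := stress_L2 i hl; have hds := dstress_L2 i hl; have hdq := dQ_L2 i hl.
apply/eqP; rewrite -subr_eq0; apply/eqP.
rewrite -[RHS]addr0 -[X in _ = X + _]e1 -[X in _ = _ + X]e2 /leibniz /pair /diss; int_tac.
by apply: eq_int => x _; rewrite /dQ /dstress /stress; ring.
Qed.

Lemma pairC w i k j k' l : pair w i k j k' l = pair w j k' i k l.
Proof. by apply: eq_int => x _; ring. Qed.

Lemma en_derive tr (t : R) i : traj tr -> 0 < t -> (1 <= i <= 4)%N ->
  is_derive t 1 (fun s => en (tr s) i) (- 2 * diss (tr t) i.+1).
Proof.
move=> htr t0 hi; have [hv _] := htr; have i4 : (i <= 4)%N by case/andP: hi.
have hp k := (is_time_deriv_pair k k w1b hi hi).1 tr htr t t0.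
have hP := hp cP; have hV := hp cV; have hQ := hp cQ; have hZ := hp cZ.
have hd := is_deriveD (is_deriveD (is_deriveD hP hV) hQ) hZ.
apply: (@near_eq_is_derive _ _ _ (fun s => pair (fun=> 1) i cP i cP (tr s)
  + pair (fun=> 1) i cV i cV (tr s) + pair (fun=> 1) i cQ i cQ (tr s)
  + pair (fun=> 1) i cZ i cZ (tr s))).
  near=> s; rewrite en_pair//; have s0 : 0 < s by near: s; exact: lt_nbhsr.
  by have [hl _] := hv _ s0.
apply: is_derive_eq.
have := diss_pair (hv _ t0) i4; rewrite !(pairC _ i _ i.+1); lra.
Unshelve. all: by end_near. Qed.

Lemma mvt_le (f df : R -> R) (p q K : R) : 0 < p -> p < q ->
  (forall x, 0 < x -> is_derive x 1 f (df x)) ->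
  (forall x, p < x < q -> K <= df x) -> K * (q - p) <= f q - f p.
Proof.
move=> p0 pq hf hK.
have hd x : x \in `]p, q[ -> is_derive x 1 f (df x).
  by move=> /[!in_itv]/= /andP[px _]; apply: hf; exact: lt_trans px.
have hc' : {within `[p, q], continuous f}.
  apply: continuous_in_subspaceT => x /[!inE]/= /[!in_itv]/= /andP[px _].
  have := hf x (lt_le_trans p0 px) => ?.
  by apply: differentiable_continuous; apply/derivable1_diffP.
have [x] := MVT pq hd hc'.
by rewrite in_itv/= => /hK ? ->; rewrite ler_wpM2r// subr_ge0 ltW.
Qed.

Lemma en_noninc tr i (s t : R) : traj tr -> (1 <= i <= 4)%N -> 0 < s -> s <= t ->
  en (tr t) i <= en (tr s) i.
Proof.
move=> htr hi s0; rewrite le_eqVlt => /predU1P[->//|st].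
have := @mvt_le (fun r => - en (tr r) i) (fun r => 2 * diss (tr r) i.+1) s t 0 s0 st.
rewrite mul0r => h; suff : 0 <= - en (tr t) i - - en (tr s) i by lra.
apply: h => x hx; last by rewrite mulr_ge0 ?diss_ge0.
have := en_derive htr hx hi => h; have := is_deriveN h.
by rewrite mulNr opprK.
Qed.

Theorem traj_decay : exists K, 0 <= K /\ forall tr, traj tr -> forall t : R, 0 < t ->
  t * en (tr t) 3 <= K * (en (tr (t / 2)) 3 + en (tr (t / 2)) 4).
Proof.
have half0 : 0 < 2^-1 :> R by rewrite invr_gt0.
have [C [F [G [C0 [hFG [K1 [K10 hF]]] hG]]]] := negligible_en half0.
have [K [K0 hK]] := coercive.
(* [2 K1 + C] bounds [Psi] by the energies of the levels 1 to 4, and [K K + K + 1] bounds these by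
   the levels 3 and 4. *)
pose A := (2 * K1 + C) * (K * K + K + 1).
have A0 : 0 <= A by rewrite /A mulr_ge0 ?addr_ge0 ?mulr_ge0.
exists (4 * A); split; first by rewrite mulr_ge0.
move=> tr htr t t0; have [hv _] := htr.
pose Sen l := en l 1 + en l 2 + en l 3 + en l 4.
(* With [e = 1/2] the derivative of [Psi] is at least the energy of level 3: the factor 2 clears the
   half, and [- C Sen] contributes exactly [2 C dissip]. *)
pose Psi s := 2 * F (tr s) - C * Sen (tr s).
have hPsi s : 0 < s -> `|Psi s| <= A * (en (tr s) 3 + en (tr s) 4).
  move=> s0; have hs := hv _ s0; have hl := hF _ hs.
  have := hK _ 1%N hs isT; have := hK _ 2%N hs isT.
  have := (en_ge0 (tr s) 1, en_ge0 (tr s) 2, en_ge0 (tr s) 3, en_ge0 (tr s) 4) => -[[[e1 e2] e3]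
      e4] h2 h1.
  have hS : Sen (tr s) <= (K * K + K + 1) * (en (tr s) 3 + en (tr s) 4).
    rewrite /Sen; have h3 := ler_wpM2l K0 h2.
    have := mulr_ge0 K0 e4; have := mulr_ge0 (mulr_ge0 K0 K0) e4; lra.
  have S0 : 0 <= Sen (tr s) by rewrite /Sen !addr_ge0.
  apply: (@le_trans _ _ ((2 * K1 + C) * Sen (tr s))).
    apply: (le_trans (ler_normB _ _));
        rewrite normrM [X in _ + X]normrM (ger0_norm C0) (ger0_norm S0).
    rewrite normr_nat [X in _ <= X]mulrDl lerD2r -mulrA.
    by rewrite ler_wpM2l.
  by rewrite /A -mulrA ler_wpM2l// addr_ge0// mulr_ge0.
have t20 : 0 < t / 2 by rewrite divr_gt0.
have t2t : t / 2 < t by lra.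
pose dPsi s := 2 * G (tr s) - C * (- 2 * diss (tr s) 2 + - 2 * diss (tr s) 3 + - 2 * diss (tr s)
    4 + - 2 * diss (tr s) 5).
have dP x : 0 < x -> is_derive x 1 Psi (dPsi x).
  move=> x0; have d0 := hFG _ htr _ x0.
  have d1 := @en_derive tr x 1%N htr x0 isT; have d2 := @en_derive tr x 2%N htr x0 isT.
  have d3 := @en_derive tr x 3%N htr x0 isT; have d4 := @en_derive tr x 4%N htr x0 isT.
  exact: (is_deriveB (is_deriveZ 2 d0) (is_deriveZ C (is_deriveD (is_deriveD (is_deriveD d1 d2)
      d3) d4))).
have := mvt_le t20 t2t dP => /(_ (en (tr t) 3)) h.
have {}h : en (tr t) 3 * (t - t / 2) <= Psi t - Psi (t / 2).
  apply: h => x /andP[x1 x2]; have x0 := lt_trans t20 x1.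
  apply: le_trans (en_noninc htr (isT : (1 <= 3 <= 4)%N) x0 (ltW x2)) _.
  by have := hG _ (hv _ x0); rewrite /dPsi /dissip; lra.
have p1 := hPsi _ t0; have p2 := hPsi _ t20.
have n3 := en_noninc htr (isT : (1 <= 3 <= 4)%N) t20 (ltW t2t).
have n4 := en_noninc htr (isT : (1 <= 4 <= 4)%N) t20 (ltW t2t).
have n5 : A * (en (tr t) 3 + en (tr t) 4) <= A * (en (tr (t / 2)) 3 + en (tr (t / 2)) 4).
  by rewrite ler_wpM2l// lerD.
move: p1 p2; rewrite !ler_norml => /andP[? ?] /andP[? ?]; lra.
Qed.

End Core.

(** * Real and imaginary parts *)

Section ComplexParts.
Context {R : realType} (L : R).
Implicit Types (f g u : cfun R) (p q : R -> R) (b : bool) (r : R) (z w : R[i]).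
Local Notation I := (real_integral L).
Local Notation L2 := (L2 L).
Local Notation normL2 := (normL2 L).

Definition cpart b z : R := if b then complex.Re z else complex.Im z.
Definition part b f : R -> R := fun x => cpart b (f x).

Lemma cpart_inj z w : (forall b, cpart b z = cpart b w) -> z = w.
Proof.
by case: z w => [? ?] [? ?] h; have := h true; have := h false => /= -> ->.
Qed.

Lemma cpartD b z w : cpart b (z + w) = cpart b z + cpart b w.
Proof. by case: b; case: z w => [? ?] [? ?]. Qed.
Lemma cpartN b z : cpart b (- z) = - cpart b z.
Proof. by case: b; case: z => [? ?]. Qed.
Lemma cpartB b z w : cpart b (z - w) = cpart b z - cpart b w.
Proof. by rewrite cpartD cpartN. Qed.
Lemma cpartZ b r z : cpart b (r%:C%C * z) = r * cpart b z.
Proof. by case: b; case: z => [? ?] /=; ring. Qed.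
Lemma modulus_sq z : modulus z ^+ 2 = cpart true z ^+ 2 + cpart false z ^+ 2.
Proof. by case: z => p q; rewrite sqr_sqrtr// addr_ge0 ?sqr_ge0. Qed.

Lemma cpart_int b f : cpart b (complex_integral L f) = I (part b f).
Proof. by case: b. Qed.

Lemma inL2P f : inL2 L f <-> forall b, L2 (part b f).
Proof.
have e x : modulus (f x) ^+ 2 = part true f x * part true f x + part false f x * part false f x.
  by rewrite modulus_sq !expr2.
split=> [[m1 m2 hi] b|h].
  have mb : meas L (part b f) by case: b.
  split=> //; apply: (@itg_le _ _ _ (fun x => modulus (f x) ^+ 2)) => //.
    exact: measM.
  move=> x _; rewrite e ger0_norm ?mulrr_ge0//.
  by case: b {mb}; rewrite ?lerDl ?lerDr mulrr_ge0.
have [m1 i1] := h true; have [m2 i2] := h false; split=> //.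
apply: (@eq_itg _ L (fun x => part true f x * part true f x + part false f x * part false f x))
    => //.
exact: itgD.
Qed.

Definition ceq f g := forall b, normL2 (fun x => part b f x - part b g x) = 0.

Definition cH1 f g := forall b, H1 L (part b f) (part b g).
Definition cH10 f g := forall b, H10 L (part b f) (part b g).

Definition cpx p q : cfun R := fun x => (p x +i* q x)%C.

Lemma rtest_cpx p q : rtest L p -> rtest L q -> test_function L (cpx p q).
Proof.
move=> [hp [a1 [b1 [a10 b1L h1]]]] [hq [a2 [b2 [a20 b2L h2]]]].
split=> //; exists (Num.min a1 a2), (Num.max b1 b2); split.
- by rewrite lt_min a10.
- by rewrite gt_max b1L.
- move=> x hx; rewrite /cpx h1 ?h2//; apply: contra hx; rewrite !in_itv/= => /andP[x1 x2];
  by rewrite ge_min le_max x1 x2 ?orbT.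
Qed.

Lemma test_part b phi : test_function L phi -> rtest L (part b phi).
Proof.
move=> [h1 h2 [al [be [a0 bL h]]]]; split; first by case: b.
by exists al, be; split=> // x /h hx; rewrite /part hx; case: b.
Qed.

Lemma part_cderive b phi : part b (cderive phi) = derive1 (part b phi).
Proof. by case: b. Qed.

Lemma part_cpx0 b p f x : part b (fun x => f x * cpx p (fun=> 0) x) x = part b f x * p x.
Proof. by rewrite /part /cpx; case: b; case: (f x) => ? ? /=; ring. Qed.

Lemma part_mul b f g x : part b (fun x => f x * g x) x =
  if b then part true f x * part true g x - part false f x * part false g x
  else part true f x * part false g x + part false f x * part true g x.
Proof. by rewrite /part; case: b; case: (f x) (g x) => ? ? [? ?] /=; ring. Qed.

Hypothesis L0 : 0 < L.

Lemma rtest_0 : rtest L (fun=> 0 : R).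
Proof. by split; [case: (C1_cst (0 : R))|exists (L / 2), (L / 2); split => //; have := L0;
    lra]. Qed.

Lemma derive1_0 : derive1 (fun=> 0 : R) = (fun=> 0 : R).
Proof. by case: (C1_cst (0 : R)). Qed.

(** Real test functions separate the two parts; conversely, the pairing with a complex test function
    expands into four real ones. *)
Lemma weak_derivativeP f g : inL2 L f -> inL2 L g ->
  weak_derivative L f g <-> forall b, wd L (part b f) (part b g).
Proof.
move=> /inL2P hf /inL2P hg; split=> [h b phi hphi|h phi hphi].
  have /(congr1 (cpart b)) := h _ (rtest_cpx hphi rtest_0); rewrite cpartN !cpart_int.
  have -> : cderive (cpx phi (fun=> 0)) = cpx (derive1 phi) (fun=> 0).
    by apply/funext => x; rewrite /cderive/= derive1_0.
  rewrite (@eq_int _ _ _ (fun x => part b f x * derive1 phi x)) => [->|x _]; last exact: part_cpx0.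
  by congr (- _); apply: eq_int => x _; exact: part_cpx0.
have hp b := test_part b hphi.
have hL b : L2 (part b phi) by case: (rtest_H10 (hp b)).
have hdL b : L2 (derive1 (part b phi)) by case: (rtest_H10 (hp b)).
have key b b' := h b _ (hp b').
have hf1 := hf true; have hf2 := hf false; have hg1 := hg true; have hg2 := hg false.
have hp1 := hL true; have hp2 := hL false; have hd1 := hdL true; have hd2 := hdL false.
apply: cpart_inj => b; rewrite cpartN !cpart_int.
rewrite (eq_int (fun x _ => part_mul b f (cderive phi) x)).
rewrite (eq_int (fun x _ => part_mul b g phi x)) !part_cderive.
case: b.
  rewrite !intB; try by itg_tac.
  by rewrite !key opprB [RHS]addrC opprK.
rewrite !intD; try by itg_tac.
by rewrite !key opprD.
Qed.

Lemma cH1P f g : cH1 f g <-> [/\ inL2 L f, inL2 L g & weak_derivative L f g].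
Proof.
split=> [h|[hf hg hfg] b].
  have hf : inL2 L f by apply/inL2P => b; case: (h b).
  have hg : inL2 L g by apply/inL2P => b; case: (h b).
  by split => //; apply/weak_derivativeP => // b; case: (h b).
by split; [move/inL2P: hf|move/inL2P: hg|exact: (weak_derivativeP hf hg).1].
Qed.

Lemma has_L2_derivativeP f : inL2 L f -> has_L2_derivative L f -> cH1 f (wderiv L f).
Proof.
move=> hf hd; have [hg hfg] := xgetPex (0 : cfun R) hd.
by apply/cH1P.
Qed.

Lemma inH1_cH1 f : inH1 L f -> cH1 f (wderiv L f).
Proof. by case; exact: has_L2_derivativeP. Qed.

Lemma normL2_sym p q : L2 p -> L2 q ->
  normL2 (fun x => p x - q x) = normL2 (fun x => q x - p x).
Proof.
move=> hp hq; rewrite -normL2N; last exact: L2B.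
by apply: eq_normL2 => x _; rewrite opprB.
Qed.

Lemma normL2_tri p q h : L2 p -> L2 q -> L2 h ->
  normL2 (fun x => p x - h x) <= normL2 (fun x => p x - q x) + normL2 (fun x => q x - h x).
Proof.
move=> hp hq hh; rewrite -(@eq_normL2 _ _ (fun x => (p x - q x) + (q x - h x))).
  by apply: normL2D; exact: L2B.
by move=> x _; rewrite addrA subrK.
Qed.

Lemma normL2_tri0 p q h : L2 p -> L2 q -> L2 h ->
  normL2 (fun x => p x - q x) = 0 -> normL2 (fun x => q x - h x) = 0 ->
  normL2 (fun x => p x - h x) = 0.
Proof.
move=> hp hq hh e1 e2; apply/eqP; rewrite eq_le normL2_ge0 andbT.
by have := normL2_tri hp hq hh; rewrite e1 e2 addr0.
Qed.

(** [wderiv] picks some weak derivative; by uniqueness it differs from [g] by norm 0. *)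
Lemma cH1_inH1 f g : cH1 f g -> inH1 L f /\ ceq g (wderiv L f).
Proof.
move=> h; have [hf hg hfg] := (cH1P f g).1 h.
have h1 : inH1 L f by split => //; exists g.
have h2 := inH1_cH1 h1; split=> // b.
by have [_ g1 w1] := h b; have [_ g2 w2] := h2 b; exact: wd_unique w1 w2.
Qed.

Lemma wd_eq p p' q q' : L2 p -> L2 p' -> L2 q -> L2 q' ->
  normL2 (fun x => p x - p' x) = 0 -> normL2 (fun x => q x - q' x) = 0 ->
  wd L p q -> wd L p' q'.
Proof.
move=> hp hp' hq hq' ep eq h phi hphi.
have [hL hdL _] := rtest_H10 hphi.
have e1 := normL2_eq0_int (L2B hp hp') hdL ep.
have e2 := normL2_eq0_int (L2B hq hq') hL eq.
have := h _ hphi.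
rewrite (@eq_int _ _ (fun x => p x * _) (fun x => (p x - p' x) * derive1 phi x + p' x * derive1
    phi x)); last by move=> x _; rewrite -mulrDl subrK.
rewrite (@eq_int _ _ (fun x => q x * _) (fun x => (q x - q' x) * phi x + q' x * phi x));
    last by move=> x _; rewrite -mulrDl subrK.
have hp'' := L2B hp hp'; have hq'' := L2B hq hq'.
by rewrite !intD ?e1 ?e2 ?add0r//; itg_tac.
Qed.

Lemma H1_eq p p' q q' : L2 p' -> L2 q' ->
  normL2 (fun x => p x - p' x) = 0 -> normL2 (fun x => q x - q' x) = 0 ->
  H1 L p q -> H1 L p' q'.
Proof. by move=> hp' hq' e1 e2 [hp hq h]; split=> //; exact: wd_eq h. Qed.

Lemma H10_eq p q q' : L2 q' -> normL2 (fun x => q x - q' x) = 0 ->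
  H10 L p q -> H10 L p q'.
Proof.
move=> hq' e0 [hp hq h]; split=> // e /h[phi [hphi h1 h2]]; exists phi; split=> //.
have [hL hdL _] := rtest_H10 hphi; apply: le_lt_trans h2.
apply: le_trans (normL2_tri hq' hq hdL) _.
by rewrite normL2_sym// e0 add0r.
Qed.

Lemma normL2_eq p q : L2 p -> L2 q -> normL2 (fun x => p x - q x) = 0 ->
  normL2 p = normL2 q.
Proof.
have le p' q' : L2 p' -> L2 q' -> normL2 (fun x => p' x - q' x) = 0 -> normL2 p' <= normL2 q'.
  move=> hp hq e0; rewrite (@eq_normL2 _ _ _ (fun x => (p' x - q' x) + q' x)) => [|x _];
      last by rewrite subrK.
  by apply: le_trans (normL2D (L2B hp hq) hq) _; rewrite e0 add0r.
move=> hp hq e0; apply/eqP; rewrite eq_le !le//.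
by rewrite normL2_sym.
Qed.

Lemma int_modulus f : inL2 L f ->
  I (fun x => modulus (f x) ^+ 2) = normL2 (part true f) ^+ 2 + normL2 (part false f) ^+ 2.
Proof.
move=> /inL2P h; have h1 := h true; have h2 := h false.
rewrite !normL2_sq -intD; try by itg_tac.
by apply: eq_int => x _; rewrite modulus_sq !expr2.
Qed.

Lemma cH1B f f' g g' : cH1 f f' -> cH1 g g' -> cH1 (f - g) (f' - g').
Proof.
move=> hf hg b; have := wdB (hf b) (hg b).
rewrite (_ : part b (f - g) = fun x => part b f x - part b g x); last first.
  by apply/funext => x; rewrite /part cpartB.
by rewrite (_ : part b (f' - g') = fun x => part b f' x - part b g' x)//;
  apply/funext => x; rewrite /part cpartB.
Qed.

Lemma partB b f g x : part b (f - g) x = part b f x - part b g x.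
Proof. exact: cpartB. Qed.

Lemma test_cH1 phi : test_function L phi -> cH1 phi (cderive phi).
Proof. by move=> hphi b; rewrite part_cderive; exact/(H10_H1 L0)/rtest_H10/test_part. Qed.

Lemma H1normE f g phi : cH1 f g -> test_function L phi -> H1norm L (f - phi) = Num.sqrt
  (normL2 (fun x => part true f x - part true phi x) ^+ 2
   + normL2 (fun x => part false f x - part false phi x) ^+ 2
   + (normL2 (fun x => part true g x - derive1 (part true phi) x) ^+ 2
   + normL2 (fun x => part false g x - derive1 (part false phi) x) ^+ 2)).
Proof.
move=> h hphi; have hd := cH1B h (test_cH1 hphi); have [hi he] := cH1_inH1 hd.
have [hi1 hi2 _] := (cH1P _ _).1 (inH1_cH1 hi).
rewrite /H1norm !int_modulus//.
have e1 b : normL2 (part b (f - phi)) = normL2 (fun x => part b f x - part b phi x).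
  by apply: eq_normL2 => x _; exact: partB.
have e2 b : normL2 (part b (wderiv L (f - phi))) =
    normL2 (fun x => part b g x - derive1 (part b phi) x).
  have [_ h1 _] := hd b; have /inL2P h2 := hi2.
  rewrite -(normL2_eq h1 (h2 b) (he b)); apply: eq_normL2 => x _.
  by rewrite partB part_cderive.
by rewrite !e1 !e2.
Qed.

Lemma sqrt_sum4_lt (x y z w e : R) : 0 <= x -> 0 <= y -> 0 <= z -> 0 <= w ->
  Num.sqrt (x ^+ 2 + y ^+ 2 + (z ^+ 2 + w ^+ 2)) < e -> [/\ x < e, y < e, z < e & w < e].
Proof.
move=> x0 y0 z0 w0 h;
    have hle (t : R) : 0 <= t -> t ^+ 2 <= x ^+ 2 + y ^+ 2 + (z ^+ 2 + w ^+ 2) -> t < e.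
  by move=> t0 ht; apply: le_lt_trans h; rewrite -[t]ger0_norm// -sqrtr_sqr ler_wsqrtr.
move: (sqr_ge0 x) (sqr_ge0 y) (sqr_ge0 z) (sqr_ge0 w) => x2 y2 z2 w2.
split; apply: hle => //; move: x2 y2 z2 w2; clear;
  by move: (x ^+ 2) (y ^+ 2) (z ^+ 2) (w ^+ 2) => *; lra.
Qed.

Lemma inH10_cH10 f : inH10 L f -> cH10 f (wderiv L f).
Proof.
move=> [h1 h2] b; have hc := inH1_cH1 h1; have [hf hg _] := hc b; split=> // e /h2[phi [hphi]].
rewrite (H1normE hc hphi).
move=> /(sqrt_sum4_lt (normL2_ge0 _ _) (normL2_ge0 _ _) (normL2_ge0 _ _) (normL2_ge0 _ _))[s1 s2
    s3 s4].
exists (part b phi); split; first exact: test_part.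
  by case: b {hf hg}; [exact: s1|exact: s2].
by case: b {hf hg}; [exact: s3|exact: s4].
Qed.

Lemma quarter_sum (e x y z w : R) : 0 < e -> w <= (e / 4) ^+ 2 -> z <= (e / 4) ^+ 2 ->
  y <= (e / 4) ^+ 2 -> x <= (e / 4) ^+ 2 -> x + z + (y + w) < e ^+ 2.
Proof.
move=> e0; have -> : (e / 4) ^+ 2 = e ^+ 2 / 16 by field.
by have := exprn_gt0 2 e0; lra.
Qed.

Lemma cH10_inH10 f g : cH10 f g -> inH10 L f /\ ceq g (wderiv L f).
Proof.
move=> h; have h1 : cH1 f g by move=> b; exact: H10_H1.
have [i1 i2] := cH1_inH1 h1; split=> //; split=> // e e0.
(* Four norms below [e / 4] give an H1 norm of at most [e / 2]. *)
have e4 : 0 < e / 4 by rewrite divr_gt0.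
have [_ _ ht] := h true; have [_ _ hf] := h false.
have [p [hp p1 p2]] := ht _ e4; have [q [hq q1 q2]] := hf _ e4.
have hphi := rtest_cpx hp hq; exists (cpx p q); split=> //.
rewrite (H1normE h1 hphi) -(ger0_norm (ltW e0)) -sqrtr_sqr ltr_sqrt ?exprn_gt0//.
have hs (x : R) : 0 <= x -> x < e / 4 -> x ^+ 2 <= (e / 4) ^+ 2.
  by move=> x0 xe; rewrite lerXn2r ?nnegrE// ltW// (le_lt_trans x0).
have := hs _ (normL2_ge0 _ _) p1; have := hs _ (normL2_ge0 _ _) p2.
have := hs _ (normL2_ge0 _ _) q1; have := hs _ (normL2_ge0 _ _) q2 => {hs} r1 r2 r3 r4.
change (part true (cpx p q)) with p; change (part false (cpx p q)) with q.
exact: (quarter_sum e0 r1 r2 r3 r4).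
Qed.

End ComplexParts.

(** * The energy space in real coordinates *)

Section StateSpace.
Context {R : realType} (L : R).
Implicit Types (f g u v y z : cfun R) (p q : R -> R) (b : bool) (r e : R) (U V W : state R) (k :
    slot).
Local Notation I := (real_integral L).
Local Notation L2 := (L2 L).
Local Notation normL2 := (normL2 L).
Local Notation X := (inEnergySpace L).
Hypothesis L0 : 0 < L.

(** A state as the energy norm sees it: [u] and [y] enter only through their derivatives. *)
Definition coord U k : cfun R := let: (u, v, y, z) := U in
  match k with cP => wderiv L u | cV => v | cQ => wderiv L y | cZ => z end.

Definition real_coord U b k : R -> R := part b (coord U k).

Lemma wderiv_L2 f b : inH10 L f -> L2 (part b (wderiv L f)).
Proof. by move=> h; case: (inH10_cH10 L0 h b). Qed.

Lemma real_coord_L2 U b k : X U -> L2 (real_coord U b k).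
Proof.
case: U => [[[u v] y] z] [hu /inL2P hv hy /inL2P hz].
by case: k => /=; [exact: wderiv_L2|exact: hv|exact: wderiv_L2|exact: hz].
Qed.

Lemma C1_comb r p q : C1 p -> C1 q -> C1 (fun x => r * p x + q x) /\
  derive1 (fun x => r * p x + q x) = (fun x => r * derive1 p x + derive1 q x).
Proof.
move=> hp hq; have [z1 z2] := C1Z r hp; have [d1 d2] := C1D z1 hq.
by split=> //; rewrite d2 z2.
Qed.

Lemma rtest_comb r p q : rtest L p -> rtest L q -> rtest L (fun x => r * p x + q x).
Proof.
move=> [hp [a1 [b1 [a10 b1L h1]]]] [hq [a2 [b2 [a20 b2L h2]]]].
split; first by case: (C1_comb r hp hq).
exists (Num.min a1 a2), (Num.max b1 b2); split.
- by rewrite lt_min a10.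
- by rewrite gt_max b1L.
- move=> x hx; rewrite h1 ?h2 ?mulr0 ?addr0//; apply: contra hx; rewrite !in_itv/= => /andP[x1 x2];
  by rewrite ge_min le_max x1 x2 ?orbT.
Qed.

Lemma H10_comb r p p' q q' : H10 L p p' -> H10 L q q' ->
  H10 L (fun x => r * p x + q x) (fun x => r * p' x + q' x).
Proof.
move=> [hp hp' h1] [hq hq' h2]; split; [exact: L2D (L2Z r hp) hq|exact: L2D (L2Z r hp') hq'|].
move=> e e0; have r1 : 0 < `|r| + 1 by rewrite ltr_wpDl.
pose d := e / (`|r| + 1).
have d0 : 0 < d by rewrite divr_gt0.
have dE : `|r| * d + d = e by rewrite /d; field; exact: lt0r_neq0.
have [phi [t1 x1 y1]] := h1 _ d0; have [psi [t2 x2 y2]] := h2 _ d0.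
have [a1 a1' _] := rtest_H10 t1; have [a2 a2' _] := rtest_H10 t2.
have key s t s' t' : L2 s -> L2 t -> L2 s' -> L2 t' ->
    normL2 (fun x => s x - s' x) < d -> normL2 (fun x => t x - t' x) < d ->
    normL2 (fun x => (r * s x + t x) - (r * s' x + t' x)) < e.
  move=> hs ht hs' ht' z1 z2.
  rewrite (@eq_normL2 _ _ _ (fun x => r * (s x - s' x) + (t x - t' x))); last by move=> x _; ring.
  apply: le_lt_trans (normL2D (L2Z r (L2B hs hs')) (L2B ht ht')) _.
  rewrite normL2Z; last exact: L2B.
  by rewrite -dE ler_ltD// ler_wpM2l// ltW.
exists (fun x => r * phi x + psi x); split; first exact: rtest_comb.
  exact: (key _ _ _ _ hp hq a1 a2 x1 x2).
have [_ ->] := C1_comb r t1.1 t2.1; exact: (key _ _ _ _ hp' hq' a1' a2' y1 y2).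
Qed.

Lemma part_comb b r f g : part b (r%:C%C *: f + g) = fun x => r * part b f x + part b g x.
Proof. by apply/funext => x; rewrite /part cpartD cpartZ. Qed.

Lemma inL2_comb r f g : inL2 L f -> inL2 L g -> inL2 L (r%:C%C *: f + g).
Proof.
move=> /inL2P hf /inL2P hg; apply/inL2P => b; rewrite part_comb.
exact: L2D (L2Z r (hf b)) (hg b).
Qed.

Lemma inH10_comb r f g : inH10 L f -> inH10 L g -> inH10 L (r%:C%C *: f + g) /\
  ceq L (r%:C%C *: wderiv L f + wderiv L g) (wderiv L (r%:C%C *: f + g)).
Proof.
move=> hf hg; apply: cH10_inH10 => // b; rewrite !part_comb.
by apply: H10_comb; exact: inH10_cH10.
Qed.

Lemma state_combE (r : R) u v y z u' v' y' z' : r%:C%C *: ((u, v, y, z) : state R) + (u', v', y',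
    z') =
  (r%:C%C *: u + u', r%:C%C *: v + v', r%:C%C *: y + y', r%:C%C *: z + z').
Proof. by []. Qed.

Lemma space_comb r U V : X U -> X V -> X (r%:C%C *: U + V).
Proof.
case: U V => [[[u v] y] z] [[[u' v'] y'] z'] [hu hv hy hz] [hu' hv' hy' hz'].
rewrite state_combE.
split; [exact: (inH10_comb r hu hu').1|exact: inL2_comb|exact: (inH10_comb r hy hy').1|exact:
    inL2_comb].
Qed.

Lemma normL2_self p q : (forall x, p x = q x) -> normL2 (fun x => p x - q x) = 0.
Proof.
move=> h; rewrite (@eq_normL2 _ _ _ (fun=> 0)); last by move=> x _; rewrite h subrr.
by rewrite normL2_cst// normr0 mul0r.
Qed.

(** Linearity up to norm 0 is all one can ask for, the derivative of a sum being chosen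
    independently of those of its terms. *)
Lemma real_coord_comb r U V b k : X U -> X V ->
  normL2 (fun x => (r * real_coord U b k x + real_coord V b k x) - real_coord (r%:C%C *: U + V) b
      k x) = 0.
Proof.
case: U V => [[[u v] y] z] [[[u' v'] y'] z'] [hu hv hy hz] [hu' hv' hy' hz'].
rewrite state_combE; case: k; rewrite /real_coord/coord.
- by have [_ /(_ b)] := inH10_comb r hu hu'; rewrite part_comb.
- by apply: normL2_self => x; rewrite part_comb.
- by have [_ /(_ b)] := inH10_comb r hy hy'; rewrite part_comb.
- by apply: normL2_self => x; rewrite part_comb.
Qed.

Lemma normL2_real_coord_comb r U V b k : X U -> X V ->
  normL2 (real_coord (r%:C%C *: U + V) b k) = normL2 (fun x => r * real_coord U b k x +
      real_coord V b k x).
Proof.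
move=> hU hV; apply/esym/normL2_eq; last exact: real_coord_comb.
- exact: L2D (L2Z r (real_coord_L2 b k hU)) (real_coord_L2 b k hV).
- exact/real_coord_L2/space_comb.
Qed.

Definition part_norm U b := normL2 (real_coord U b cP) + normL2 (real_coord U b cV)
  + normL2 (real_coord U b cQ) + normL2 (real_coord U b cZ).

(* Equivalent to the energy norm, with an immediate triangle inequality. *)
Definition state_norm U := part_norm U true + part_norm U false.

Lemma state_norm_ge0 U : 0 <= state_norm U.
Proof. by rewrite /state_norm /part_norm !addr_ge0 ?normL2_ge0. Qed.

Lemma sum8_le (a1 a2 a3 a4 a5 a6 a7 a8 b1 b2 b3 b4 b5 b6 b7 b8
    c1 c2 c3 c4 c5 c6 c7 c8 : R) :
  a1 <= b1 + c1 -> a2 <= b2 + c2 -> a3 <= b3 + c3 -> a4 <= b4 + c4 ->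
  a5 <= b5 + c5 -> a6 <= b6 + c6 -> a7 <= b7 + c7 -> a8 <= b8 + c8 ->
  a1 + a2 + a3 + a4 + (a5 + a6 + a7 + a8) <=
  b1 + b2 + b3 + b4 + (b5 + b6 + b7 + b8) + (c1 + c2 + c3 + c4 + (c5 + c6 + c7 + c8)).
Proof. lra. Qed.

Lemma Re_dot (z1 z2 z3 z4 : R[i]) (a1 a2 a3 a4 a5 a6 a7 a8 : R) :
  complex.Re z1 = a2 + a6 -> complex.Re z2 = a1 + a5 ->
  complex.Re z3 = a4 + a8 -> complex.Re z4 = a3 + a7 ->
  complex.Re (z1 + 1%:C%C * z2 + z3 + z4) = a1 + a2 + a3 + a4 + (a5 + a6 + a7 + a8).
Proof.
by case: z1 z2 z3 z4 => [x1 y1] [x2 y2] [x3 y3] [x4 y4] /= -> -> -> ->; ring.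
Qed.

Lemma sqr8_ge0 (n1 n2 n3 n4 n5 n6 n7 n8 : R) : 0 <= n1 ^+ 2 + n2 ^+ 2 + n3 ^+ 2 + n4 ^+ 2
  + (n5 ^+ 2 + n6 ^+ 2 + n7 ^+ 2 + n8 ^+ 2).
Proof. by rewrite !addr_ge0 ?sqr_ge0. Qed.

Lemma sum8Z r (a1 a2 a3 a4 a5 a6 a7 a8 : R) :
  r * a1 + r * a2 + r * a3 + r * a4 + (r * a5 + r * a6 + r * a7 + r * a8) =
  r * (a1 + a2 + a3 + a4 + (a5 + a6 + a7 + a8)).
Proof. by rewrite !mulrDr. Qed.

Lemma sum_sqr_equiv (s : seq R) (N : R) : (forall x, x \in s -> 0 <= x) -> 0 <= N ->
  N ^+ 2 = \sum_(x <- s) x ^+ 2 ->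
  N <= \sum_(x <- s) x /\ \sum_(x <- s) x <= (size s)%:R * N.
Proof.
move=> s0 N0 NE; split.
  have [S0 hS] : 0 <= \sum_(x <- s) x /\ \sum_(x <- s) x ^+ 2 <= (\sum_(x <- s) x) ^+ 2.
    elim: s s0 {NE} => [|x s IH] s0; first by rewrite !big_nil expr0n.
    have x0 : 0 <= x by apply: s0; rewrite mem_head.
    have [y ys|S0 hS] := IH; first by apply: s0; rewrite inE ys orbT.
    rewrite !big_cons; split; first exact: addr_ge0.
    by rewrite sqrrD -addrA lerD2l ler_wpDl// mulrn_wge0// mulr_ge0.
  by rewrite -(ler_pXn2r (ltn0Sn 1)) ?nnegrE// NE.
have -> : (size s)%:R * N = \sum_(x <- s) N.
  by rewrite big_const_seq count_predT iter_addr_0 mulr_natl.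
rewrite big_seq [leRHS]big_seq; apply: ler_sum => x xs.
have x0 := s0 _ xs; rewrite -(ler_pXn2r (ltn0Sn 1)) ?nnegrE// NE (big_rem x xs)/= lerDl.
by apply: sumr_ge0 => y _; exact: sqr_ge0.
Qed.

(** Four components with two parts each: the origin of the 8 in the bound on the semigroup and of
    the 64 in the final constants. *)
Lemma sqrt8_equiv (n1 n2 n3 n4 n5 n6 n7 n8 N : R) :
  0 <= n1 -> 0 <= n2 -> 0 <= n3 -> 0 <= n4 -> 0 <= n5 -> 0 <= n6 -> 0 <= n7 -> 0 <= n8 ->
  0 <= N ->
  N ^+ 2 = n1 ^+ 2 + n2 ^+ 2 + n3 ^+ 2 + n4 ^+ 2 + (n5 ^+ 2 + n6 ^+ 2 + n7 ^+ 2 + n8 ^+ 2) ->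
  N <= n1 + n2 + n3 + n4 + (n5 + n6 + n7 + n8) /\
  n1 + n2 + n3 + n4 + (n5 + n6 + n7 + n8) <= 8 * N.
Proof.
move=> h1 h2 h3 h4 h5 h6 h7 h8 N0 NE.
have [||] := @sum_sqr_equiv [:: n1; n2; n3; n4; n5; n6; n7; n8] N _ N0.
- by move=> x; rewrite !inE; do 7!(case/orP => [/eqP->//|]); move/eqP->.
- by rewrite NE !big_cons big_nil; ring.
by rewrite !big_cons big_nil !addr0 !addrA.
Qed.

Lemma real_coord_le U b k : normL2 (real_coord U b k) <= state_norm U.
Proof.
have h k' b' := normL2_ge0 L (real_coord U b' k').
move: (h cP true) (h cV true) (h cQ true) (h cZ true) (h cP false) (h cV false) (h cQ false) (h
    cZ false).
rewrite /state_norm /part_norm; clear h.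
case: b; case: k; move: (normL2 (real_coord U true cP)) (normL2 (real_coord U true cV))
 (normL2 (real_coord U true cQ)) (normL2 (real_coord U true cZ)) (normL2 (real_coord U false cP))
 (normL2 (real_coord U false cV)) (normL2 (real_coord U false cQ)) (normL2 (real_coord U false
     cZ)); clear; move=> *; lra.
Qed.

Lemma space0 : X 0.
Proof.
have h0 : part true (0 : cfun R) = (fun=> 0) /\ part false (0 : cfun R) = (fun=> 0) by [].
have hc : cH10 L (0 : cfun R) 0.
  have := rtest_H10 (rtest_0 L0); rewrite derive1_0 => h b.
  by have -> : part b (0 : cfun R) = (fun=> 0) by case: b.
have [h10 _] := cH10_inH10 L0 hc.
have hL2 : inL2 L (0 : cfun R) by case: h10 => -[].
by split.
Qed.

Lemma state_normD U V : X U -> X V -> state_norm (U + V) <= state_norm U + state_norm V.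
Proof.
move=> hU hV; have h b k : normL2 (real_coord (U + V) b k) <= normL2 (real_coord U b k) + normL2
    (real_coord V b k).
  rewrite -[U in real_coord (U + _)]scale1r (normL2_real_coord_comb 1)//.
  have hL := real_coord_L2 b k hU; apply: le_trans (normL2D (L2Z 1 hL) (real_coord_L2 b k hV)) _.
  by rewrite normL2Z// normr1 mul1r.
exact: (sum8_le (h true cP) (h true cV) (h true cQ) (h true cZ)
  (h false cP) (h false cV) (h false cQ) (h false cZ)).
Qed.

Lemma state_normZ r U : X U -> state_norm (r%:C%C *: U) = `|r| * state_norm U.
Proof.
move=> hU; have h b k : normL2 (real_coord (r%:C%C *: U) b k) = `|r| * normL2 (real_coord U b k).
  have hL := real_coord_L2 b k hU; have h0 := real_coord_L2 b k space0.
  have e0 : normL2 (real_coord 0 b k) = 0.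
    apply/eqP; rewrite eq_le normL2_ge0 andbT.
    (* The derivative chosen for 0 is some null function; writing 0 as [-1] times 0 plus 0 shows
       that its norm is 0. *)
    have := normL2_real_coord_comb (-1) b k space0 space0; rewrite scaler0 add0r => ->.
    rewrite (@eq_normL2 _ _ _ (fun=> 0)); last by move=> x _; ring.
    by rewrite normL2_cst// normr0 mul0r.
  rewrite -[_ *: U]addr0 normL2_real_coord_comb//; last exact: space0.
  rewrite -normL2Z//; apply: normL2_eq; [exact: L2D (L2Z r hL) h0|exact: L2Z|].
  by rewrite (@eq_normL2 _ _ _ (real_coord 0 b k))// => x _; ring.
by rewrite /state_norm /part_norm !h sum8Z.
Qed.

Lemma energy_normE U : X U -> energy_norm L 1 U = Num.sqrt
  (normL2 (real_coord U true cP) ^+ 2 + normL2 (real_coord U true cV) ^+ 2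
  + normL2 (real_coord U true cQ) ^+ 2 + normL2 (real_coord U true cZ) ^+ 2
  + (normL2 (real_coord U false cP) ^+ 2 + normL2 (real_coord U false cV) ^+ 2
  + normL2 (real_coord U false cQ) ^+ 2 + normL2 (real_coord U false cZ) ^+ 2)).
Proof.
move=> hU; have hL b k := real_coord_L2 b k hU; rewrite /energy_norm; congr Num.sqrt.
have int_conj f : inL2 L f -> complex.Re (complex_integral L (fun x => f x * conjc (f x))) =
    normL2 (part true f) ^+ 2 + normL2 (part false f) ^+ 2.
  move=> hf; rewrite -int_modulus//=; apply: eq_int => x _; rewrite modulus_sq.
  by case: (f x) => p q /=; ring.
case: U hU hL => [[[u v] y] z] [hu hv hy hz] hL; rewrite /energy_dot.
have wu : inL2 L (wderiv L u) by apply/inL2P => b; exact: wderiv_L2.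
have wy : inL2 L (wderiv L y) by apply/inL2P => b; exact: wderiv_L2.
exact: (Re_dot (int_conj _ hv) (int_conj _ wu) (int_conj _ hz) (int_conj _ wy)).
Qed.

Lemma state_norm_equiv U : X U -> energy_norm L 1 U <= state_norm U /\ state_norm U <= 8 *
    energy_norm L 1 U.
Proof.
move=> hU; have h b k := normL2_ge0 L (real_coord U b k).
set N := energy_norm L 1 U.
have N0 : 0 <= N by exact: sqrtr_ge0.
have NE := sqr_sqrtr (@sqr8_ge0 (normL2 (real_coord U true cP)) (normL2 (real_coord U true cV))
    (normL2 (real_coord U true cQ)) (normL2 (real_coord U true cZ)) (normL2 (real_coord U false
    cP)) (normL2 (real_coord U false cV)) (normL2 (real_coord U false cQ)) (normL2 (real_coord U
    false cZ))).
rewrite -(energy_normE hU) -/N in NE.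
exact: (sqrt8_equiv (h true cP) (h true cV) (h true cQ) (h true cZ)
  (h false cP) (h false cV) (h false cQ) (h false cZ) N0 NE).
Qed.

End StateSpace.

(** * Contraction semigroups and their generators *)

Section Semigroup.
Context {R : realType} {E : lmodType R[i]} (X : E -> Prop) (nrm : E -> R).
Variables (S : R -> E -> E) (dom : E -> Prop) (A : E -> E) (B : R).
Implicit Types (U V W F G : E) (r s t h e : R).
Local Notation "r *; U" := (r%:C%C *: U) (at level 40).

(** [nrm] is a seminorm on [X], to be [state_norm]. As it is only equivalent to the energy norm,
    contractivity becomes the bound [B]. *)
Hypotheses (B0 : 0 <= B) (nrm_ge0 : forall U, 0 <= nrm U)
  (X_comb : forall r U V, X U -> X V -> X (r *; U + V))
  (X_0 : X 0)
  (nrmD : forall U V, X U -> X V -> nrm (U + V) <= nrm U + nrm V)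
  (nrmZ : forall r U, X U -> nrm (r *; U) = `|r| * nrm U)
  (S_X : forall t U, 0 <= t -> X U -> X (S t U))
  (S_comb : forall t r U V, 0 <= t -> X U -> X V ->
     nrm (S t (r *; U + V) - (r *; S t U + S t V)) = 0)
  (S_D : forall s t U, 0 <= s -> 0 <= t -> X U -> nrm (S (s + t) U - S s (S t U)) = 0)
  (S_le : forall t U, 0 <= t -> X U -> nrm (S t U) <= B * nrm U)
  (S_cont : forall U, X U -> nrm (S t U - U) @[t --> 0^'+] --> (0 : R))
  (gen : forall U F, X U -> X F ->
    (nrm (h^-1 *; (S h U - U) - F) @[h --> 0^'+] --> (0 : R)) <->
    (dom U /\ nrm (F - A U) = 0))
  (dom_X : forall U, dom U -> X U) (A_X : forall U, dom U -> X (A U)).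

Lemma opp_scale U : (-1) *; U = - U.
Proof. by rewrite (_ : (-1)%:C%C = -1 :> R[i]) ?scaleN1r// rmorphN rmorph1. Qed.

Lemma one_scale U : 1 *; U = U.
Proof. by rewrite (_ : 1%:C%C = 1 :> R[i]) ?scale1r. Qed.

Lemma X_D U V : X U -> X V -> X (U + V).
Proof. by move=> hU hV; rewrite -[U]one_scale; exact: X_comb. Qed.
Lemma X_Z r U : X U -> X (r *; U).
Proof. by move=> hU; rewrite -[_ *: _]addr0; exact: X_comb. Qed.
Lemma X_N U : X U -> X (- U).
Proof. by move=> hU; rewrite -opp_scale; exact: X_Z. Qed.
Lemma X_B U V : X U -> X V -> X (U - V).
Proof. by move=> hU hV; apply: X_D => //; exact: X_N. Qed.

Lemma nrmN U : X U -> nrm (- U) = nrm U.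
Proof. by move=> hU; rewrite -opp_scale nrmZ// normrN1 mul1r. Qed.

Lemma nrm0 : nrm 0 = 0.
Proof. by have := nrmZ 0 X_0; rewrite scaler0 normr0 mul0r. Qed.

(** Equality in the energy space. Membership in [X] is carried along because [nrm] is a seminorm
    only there. *)
Definition eqv U V := [/\ X U, X V & nrm (U - V) = 0].

Lemma nrm_eq0_le U a : a = 0 -> nrm U <= a -> nrm U = 0.
Proof. by move=> -> h; apply/eqP; rewrite eq_le h nrm_ge0. Qed.

Lemma eqv_refl U : X U -> eqv U U.
Proof. by move=> hU; split=> //; rewrite subrr nrm0. Qed.

Lemma eqv_sym U V : eqv U V -> eqv V U.
Proof. by move=> [hU hV e]; split=> //; rewrite -opprB nrmN//; exact: X_B. Qed.

Lemma eqv_trans V U W : eqv U V -> eqv V W -> eqv U W.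
Proof.
move=> [hU hV e1] [_ hW e2]; split=> //; apply: (@nrm_eq0_le _ (0 + 0)); first exact: addr0.
rewrite -{1}e1 -e2 -[U - W](subrKA V); apply: nrmD; exact: X_B.
Qed.

Lemma eqvD U V U' V' : eqv U U' -> eqv V V' -> eqv (U + V) (U' + V').
Proof.
move=> [hU hU' e1] [hV hV' e2]; split; [exact: X_D|exact: X_D|].
apply: (@nrm_eq0_le _ (0 + 0)); first exact: addr0.
rewrite -{1}e1 -e2 opprD addrACA; apply: nrmD; exact: X_B.
Qed.

Lemma eqvZ r U V : eqv U V -> eqv (r *; U) (r *; V).
Proof.
move=> [hU hV e1]; split; [exact: X_Z|exact: X_Z|].
by rewrite -scalerBr nrmZ ?e1 ?mulr0//; exact: X_B.
Qed.

Lemma eqvN U V : eqv U V -> eqv (- U) (- V).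
Proof. by rewrite -!opp_scale; exact: eqvZ. Qed.

Lemma eqvB U V U' V' : eqv U U' -> eqv V V' -> eqv (U - V) (U' - V').
Proof. by move=> h1 /eqvN; exact: eqvD. Qed.

Lemma eqv_nrm U V : eqv U V -> nrm U = nrm V.
Proof.
have le U' V' : eqv U' V' -> nrm U' <= nrm V'.
  move=> [hU hV e]; rewrite -{1}[U'](subrK V').
  by apply: le_trans (nrmD (X_B hU hV) hV) _; rewrite e add0r.
by move=> h; apply/eqP; rewrite eq_le !le//; exact: eqv_sym.
Qed.

Lemma S_lin t r U V : 0 <= t -> X U -> X V -> eqv (S t (r *; U + V)) (r *; S t U + S t V).
Proof.
by move=> t0 hU hV; split; [exact/S_X/X_comb|apply: X_comb; exact: S_X|exact: S_comb].
Qed.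

Lemma S_0 t : 0 <= t -> eqv (S t 0) 0.
Proof.
move=> t0; split; [exact: S_X|exact: X_0|rewrite subr0].
by apply: (@nrm_eq0_le _ (B * nrm 0)); [rewrite nrm0 mulr0|exact: S_le].
Qed.

Lemma S_Z t r U : 0 <= t -> X U -> eqv (S t (r *; U)) (r *; S t U).
Proof.
move=> t0 hU; have := S_lin r t0 hU X_0; rewrite addr0 => /eqv_trans; apply.
rewrite -[X in eqv _ X]addr0; apply: eqvD; last exact: S_0.
exact/eqv_refl/X_Z/S_X.
Qed.

Lemma S_B t U V : 0 <= t -> X U -> X V -> eqv (S t (U - V)) (S t U - S t V).
Proof.
move=> t0 hU hV; have := S_lin (-1) t0 hV hU; rewrite !opp_scale.
by rewrite addrC [X in eqv _ X]addrC.
Qed.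

Lemma S_eqv t U V : 0 <= t -> eqv U V -> eqv (S t U) (S t V).
Proof.
move=> t0 [hU hV e]; have h := S_B t0 hU hV; split; [exact: S_X|exact: S_X|].
apply: (@nrm_eq0_le _ (B * nrm (U - V))); first by rewrite e mulr0.
by rewrite -(eqv_nrm h); apply: S_le => //; exact: X_B.
Qed.

Lemma S_add s t U : 0 <= s -> 0 <= t -> X U -> eqv (S (s + t) U) (S s (S t U)).
Proof.
by move=> s0 t0 hU; split; [apply: S_X => //; exact: addr_ge0|exact/S_X/S_X|exact: S_D].
Qed.

Lemma S_comm s t U : 0 <= s -> 0 <= t -> X U -> eqv (S s (S t U)) (S t (S s U)).
Proof.
move=> s0 t0 hU; apply: (eqv_trans (eqv_sym (S_add s0 t0 hU))).
by rewrite addrC; exact: S_add.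
Qed.

Definition dq h U := h^-1 *; (S h U - U).

Lemma dq_X h U : 0 <= h -> X U -> X (dq h U).
Proof. by move=> h0 hU; apply/X_Z/X_B => //; exact: S_X. Qed.

Lemma S_dq t h U : 0 <= t -> 0 <= h -> X U -> eqv (S t (dq h U)) (dq h (S t U)).
Proof.
move=> t0 h0 hU; have hS := S_X h0 hU.
apply: (eqv_trans (S_Z h^-1 t0 (X_B hS hU))); apply: eqvZ.
apply: (eqv_trans (S_B t0 hS hU)); apply: eqvB; last exact/eqv_refl/S_X.
exact: S_comm.
Qed.

Lemma S_dqB t h U F : 0 <= t -> 0 <= h -> X U -> X F ->
  eqv (S t (dq h U - F)) (dq h (S t U) - S t F).
Proof.
move=> t0 h0 hU hF; apply: (eqv_trans (S_B t0 (dq_X h0 hU) hF)).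
by apply: eqvB; [exact: S_dq|exact/eqv_refl/S_X].
Qed.

Lemma cvg_at_right0 (g k : R -> R) (K : R) : 0 <= K -> (forall h, 0 < h -> 0 <= k h <= K * g h) ->
  g h @[h --> 0^'+] --> (0 : R) -> k h @[h --> 0^'+] --> (0 : R).
Proof.
move=> K0 hk hg; apply: (@squeeze_cvgr _ _ _ _ (fun=> 0) (fun h => K * g h)).
- by near=> h; apply: hk; near: h; exact: nbhs_right_gt.
- exact: cvg_cst.
- by rewrite -[X in _ --> X](mulr0 K); apply: cvgM; [exact: cvg_cst|exact: hg].
Unshelve. all: by end_near. Qed.

(** Difference quotients commute with [S t], so those of [S t U] tend to [S t (A U)], and [gen]
    turns this limit into membership in the domain. *)
Lemma dom_S t U : 0 <= t -> dom U -> dom (S t U) /\ eqv (A (S t U)) (S t (A U)).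
Proof.
move=> t0 hU; have xU := dom_X hU; have xA := A_X hU.
have [_ /(_ (conj hU _))] := gen xU xA; rewrite subrr nrm0 => /(_ erefl) hg.
have [h1 _] := gen (S_X t0 xU) (S_X t0 xA).
have [h2 h3] : dom (S t U) /\ nrm (S t (A U) - A (S t U)) = 0.
  apply: h1; apply: cvg_at_right0 B0 _ hg => h h0; rewrite nrm_ge0/=.
  have hq := S_dqB t0 (ltW h0) xU xA; rewrite -/(dq _ _) -(eqv_nrm hq).
  by apply: S_le => //; apply: X_B => //; exact: dq_X (ltW h0) _.
by split=> //; apply: eqv_sym; split=> //; [exact: S_X|exact: A_X].
Qed.

(** The operator being abstract here, its linearity is read off from the difference quotients
    through [gen]. *)
Lemma dom_comb r U V : dom U -> dom V ->
  dom (r *; U + V) /\ eqv (A (r *; U + V)) (r *; A U + A V).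
Proof.
move=> hU hV; have [xU xAU xV xAV] := And4 (dom_X hU) (A_X hU) (dom_X hV) (A_X hV).
have [_ /(_ (conj hU _))] := gen xU xAU; rewrite subrr nrm0 => /(_ erefl) gU.
have [_ /(_ (conj hV _))] := gen xV xAV; rewrite subrr nrm0 => /(_ erefl) gV.
have xW := X_comb r xU xV; have xAW := X_comb r xAU xAV.
have [h1 _] := gen xW xAW.
have [h2 h3] : dom (r *; U + V) /\ nrm (r *; A U + A V - A (r *; U + V)) = 0.
  apply: h1; apply: (@cvg_at_right0 (fun h => `|r| * nrm (dq h U - A U) + nrm (dq h V - A V)) _ 1
      ler01).
    move=> h h0; rewrite nrm_ge0/= mul1r.
    have xdU := X_B (dq_X (ltW h0) xU) xAU; have xdV := X_B (dq_X (ltW h0) xV) xAV.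
    rewrite -nrmZ//; apply: le_trans (nrmD (X_Z r xdU) xdV).
    rewrite -/(dq _ _) le_eqVlt; apply/orP; left; apply/eqP/eqv_nrm.
    have sU := S_X (ltW h0) xU; have sV := S_X (ltW h0) xV.
    apply: (@eqv_trans (h^-1 *; ((r *; S h U + S h V) - (r *; U + V)) - (r *; A U + A V))).
      apply: eqvB; last exact: eqv_refl.
      by apply/eqvZ/eqvB; [exact: S_lin (ltW h0) _ _|exact: eqv_refl].
    rewrite (_ : h^-1 *; _ - _ = r *; (dq h U - A U) + (dq h V - A V)).
      by apply/eqv_refl/X_D; [exact: X_Z|].
    rewrite [- (r *; U + V)]opprD [- (r *; A U + A V)]opprD addrACA -scalerBr scalerDr.
    by rewrite addrACA scalerA [(_ * r%:C)%C]mulrC -scalerA -scalerBr.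
  have k : (fun h => `|r| * nrm (dq h U - A U) + nrm (dq h V - A V)) @ 0^'+ --> `|r| * 0 + 0.
    by apply: cvgD; [apply: cvgM; [exact: cvg_cst|exact: gU]|exact: gV].
  by rewrite mulr0 addr0 in k; exact: k.
by split=> //; apply: eqv_sym; split=> //; exact: A_X.
Qed.

Lemma dom_0 U : dom U -> dom 0 /\ eqv (A 0) 0.
Proof.
move=> hU; have := dom_comb (-1) hU hU; rewrite !opp_scale !addNr; exact.
Qed.

Lemma dom_dq h U : 0 <= h -> dom U -> dom (dq h U) /\ eqv (A (dq h U)) (dq h (A U)).
Proof.
move=> h0 hU; have [hS eS] := dom_S h0 hU; have [h00 e00] := dom_0 hU.
have := dom_comb (-1) hU hS; rewrite !opp_scale ![- _ + _]addrC => -[hB eB].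
have := dom_comb h^-1 hB h00; rewrite addr0 => -[hZ eZ]; split=> //.
apply: (eqv_trans eZ); rewrite -[X in eqv _ X]addr0; apply: eqvD => //; apply: eqvZ.
by apply: (eqv_trans eB); apply: eqvB => //; exact/eqv_refl/A_X.
Qed.

Lemma at_right_le (g : R -> R) e : g h @[h --> 0^'+] --> (0 : R) -> 0 < e ->
  exists d, 0 < d /\ forall h, 0 < h < d -> g h <= e.
Proof.
move=> hg e0.
have : \forall h \near 0^'+, `|g h| <= e by exact: cvgr0_norm_le.
rewrite near_withinE => /nbhs_ballP[d/= d0 hd]; exists d; split=> // h /andP[h0 h1].
apply: le_trans (ler_norm _) _; apply: hd => //.
by rewrite /ball/= sub0r normrN ger0_norm// ltW.
Qed.

(** For [e < 0] put [k = - e] and [s = t - k]: the left quotient at [t] is the right quotient at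
    [s], and its error splits into [S s (dq k U - A U)] and [S s (A U - S k (A U))]. For [e > 0] the
    first term suffices. *)
Lemma S_derive_bound t e U : 0 < t -> dom U -> e != 0 -> `|e| < t ->
  nrm (e^-1 *; (S (t + e) U - S t U) - S t (A U)) <=
  B * nrm (dq `|e| U - A U) + B * nrm (S `|e| (A U) - A U).
Proof.
move=> t0 hU; rewrite neq_lt => /orP[e0|e0] et; have xU := dom_X hU; have xA := A_X hU.
  move: et; rewrite ltr0_norm//; set k := - e => et.
  have k0 : 0 < k by rewrite /k oppr_gt0.
  pose s := t + e; have s0 : 0 <= s by rewrite /s; move: et; rewrite /k; lra.
  have tE : t = s + k by rewrite /s /k addrK.
  have xD := X_B (dq_X (ltW k0) xU) xA.
  have e1 := S_dqB s0 (ltW k0) xU xA.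
  have e2 : eqv (S s (A U - S k (A U))) (S s (A U) - S t (A U)).
    rewrite tE; apply: (eqv_trans (S_B s0 xA (S_X (ltW k0) xA))).
    by apply: eqvB; [exact/eqv_refl/S_X|exact/eqv_sym/S_add/xA/ltW].
  have xE := X_B xA (S_X (ltW k0) xA).
  rewrite -[X in _ + _ * X]nrmN ?opprB; last by apply: X_B => //; exact: S_X (ltW k0) _.
  apply: (le_trans _ (lerD (S_le s0 xD) (S_le s0 xE))).
  apply: (le_trans _ (nrmD (S_X s0 xD) (S_X s0 xE))).
  rewrite le_eqVlt; apply/orP; left; apply/eqP/eqv_nrm/eqv_sym.
  apply: (eqv_trans (eqvD e1 e2)); rewrite addrA subrK -/s.
  apply: eqvB; last exact/eqv_refl/S_X/xA/ltW.
  rewrite /dq (_ : e^-1 *; _ = k^-1 *; (S t U - S s U)); last first.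
    by rewrite /k invrN rmorphN scaleNr -scalerN opprB.
  apply: eqvZ; apply: eqvB; last exact/eqv_refl/S_X.
  by rewrite tE addrC; exact/eqv_sym/S_add/xU/s0/ltW.
move: et; rewrite gtr0_norm// => et.
have xD := X_B (dq_X (ltW e0) xU) xA.
apply: (@le_trans _ _ (B * nrm (dq e U - A U))); last by rewrite lerDl mulr_ge0.
apply: (le_trans _ (S_le (ltW t0) xD)).
rewrite le_eqVlt; apply/orP; left; apply/eqP/eqv_nrm/eqv_sym.
apply: (eqv_trans (S_dqB (ltW t0) (ltW e0) xU xA)).
apply: eqvB; last exact/eqv_refl/S_X/xA/ltW.
apply: eqvZ; apply: eqvB; last exact/eqv_refl/S_X/xU/ltW.
by rewrite addrC; apply: eqv_sym; apply: S_add => //; exact: ltW.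
Qed.

Lemma S_derive t U : 0 < t -> dom U ->
  nrm (h^-1 *; (S (t + h) U - S t U) - S t (A U)) @[h --> 0^'] --> (0 : R).
Proof.
move=> t0 hU; have xU := dom_X hU; have xA := A_X hU.
have [_ /(_ (conj hU _))] := gen xU xA; rewrite subrr nrm0 => /(_ erefl) hg.
apply/cvgrPdist_le => e e0.
pose d := e / (2 * (B + 1)).
have B1 : 0 < B + 1 by rewrite ltr_wpDl.
have d0 : 0 < d by rewrite divr_gt0// mulr_gt0.
have [d1 [d10 h1]] := at_right_le hg d0.
have [d2 [d20 h2]] := at_right_le (S_cont xA) d0.
near=> h; rewrite sub0r normrN ger0_norm//.
have hn0 : h != 0 by near: h; exact: nbhs_dnbhs_neq.
have n0 : 0 < `|h| by rewrite normr_gt0.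
have ht : `|h| < t by near: h; exact: dnbhs0_lt.
have hd1 : `|h| < d1 by near: h; exact: dnbhs0_lt.
have hd2 : `|h| < d2 by near: h; exact: dnbhs0_lt.
apply: (le_trans (S_derive_bound t0 hU hn0 ht)).
have p1 := h1 `|h|; have p2 := h2 `|h|; rewrite n0 hd1 in p1; rewrite n0 hd2 in p2.
have {}p1 := ler_wpM2l B0 (p1 isT); have {}p2 := ler_wpM2l B0 (p2 isT).
apply: (le_trans (lerD p1 p2)).
have -> : e = (B + 1) * d + (B + 1) * d by rewrite /d; field; exact: lt0r_neq0.
by rewrite lerD// ler_wpM2r ?lerDl// ltW.
Unshelve. all: by end_near. Qed.

Hypothesis A_surj : forall U, X U -> exists W, dom W /\ eqv (A W) U.

Lemma dq_eqv h U V : 0 <= h -> eqv U V -> eqv (dq h U) (dq h V).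
Proof. by move=> h0 e; apply/eqvZ/eqvB => //; exact: S_eqv. Qed.

Definition chain (Y : nat -> E) := [/\ forall i, X (Y i),
  forall i, (i <= 4)%N -> dom (Y i) & forall i, (i <= 4)%N -> eqv (A (Y i)) (Y i.+1)].

Lemma dom_dq_chain h U V : 0 <= h -> dom U -> eqv (A U) V -> eqv (A (dq h U)) (dq h V).
Proof.
by move=> h0 hU e; apply: (eqv_trans (dom_dq h0 hU).2); exact: dq_eqv.
Qed.

Lemma eqv_nrmB U V W : eqv U V -> X W -> nrm (W - U) = nrm (W - V).
Proof. by move=> e hW; apply: eqv_nrm; apply: eqvB => //; exact: eqv_refl. Qed.

(** The levels 0 to 5 are [dq h] applied to [A^-4 U], ..., [A^-1 U], [U], [A U]. Level 3 is thus
    close to [U] and level 4 close to [A U], and level 4 lies in the domain although [A U] may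
    not. *)
Lemma chain_approx U e : dom U -> 0 < e ->
  exists Y, [/\ chain Y, nrm (Y 3 - U) <= e & nrm (Y 4 - A U) <= e].
Proof.
move=> hU e0; have xU := dom_X hU.
have [W1 [d1 a1]] := A_surj xU; have x1 := dom_X d1.
have [W2 [d2 a2]] := A_surj x1; have x2 := dom_X d2.
have [W3 [d3 a3]] := A_surj x2; have x3 := dom_X d3.
have [W4 [d4 a4]] := A_surj x3; have x4 := dom_X d4.
have xA1 := A_X d1; have xAU := A_X hU.
have [_ /(_ (conj d1 _))] := gen x1 xA1; rewrite subrr nrm0 => /(_ erefl) g1.
have [_ /(_ (conj hU _))] := gen xU xAU; rewrite subrr nrm0 => /(_ erefl) g0.
have [p [p0 hp]] := at_right_le g1 e0; have [q [q0 hq]] := at_right_le g0 e0.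
pose h := Num.min p q / 2.
have m0 : 0 < Num.min p q by rewrite lt_min p0.
have h0 : 0 < h by rewrite divr_gt0.
have hm : h < Num.min p q by rewrite /h; lra.
have [hp' hq'] : h < p /\ h < q by move: hm; rewrite lt_min => /andP[].
exists (fun i => match i with 0 => dq h W4 | 1 => dq h W3 | 2 => dq h W2 | 3 => dq h W1
  | 4 => dq h U | _ => dq h (A U) end); split.
- have hh := ltW h0; split.
  + by case=> [|[|[|[|[|i]]]]] /=; exact: dq_X.
  + by case=> [|[|[|[|[|i]]]]] //= _; apply: (dom_dq hh _).1.
  + case=> [|[|[|[|[|i]]]]] //= _; apply: dom_dq_chain => //; exact: eqv_refl.
- have := hp h; rewrite h0 hp' => /(_ isT).
  by rewrite -/(dq h W1) (eqv_nrmB a1 (dq_X (ltW h0) x1)).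
- by have := hq h; rewrite h0 hq' => /(_ isT).
Qed.

Lemma le_of_quadratic_error (a b k : R) : 0 <= k -> (forall e, 0 < e -> a <= b + k * (e * e)) ->
    a <= b.
Proof.
move=> k0 h; apply/ler_addgt0Pr => e e0.
have k1 : 0 < k + 1 by rewrite ltr_wpDl.
pose d := Num.min 1 (e / (k + 1)).
have d0 : 0 < d by rewrite lt_min ltr01 divr_gt0.
have d1 : d <= 1 by rewrite ge_min lexx.
have d2 : d <= e / (k + 1) by rewrite ge_min lexx orbT.
apply: (le_trans (h _ d0)); rewrite lerD2l.
apply: (@le_trans _ _ ((k + 1) * (e / (k + 1)))); last by rewrite mulrC divfK// lt0r_neq0.
apply: ler_pM => //; first by rewrite mulr_ge0// ltW.
  by rewrite lerDl.
apply: le_trans d2; rewrite -[leRHS]mul1r ler_wpM2r//; exact: ltW.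
Qed.

Lemma sqrD_le (a b e : R) : 0 <= a -> 0 <= b -> 0 <= e -> a <= b + e ->
  a ^+ 2 <= 2 * b ^+ 2 + 2 * (e * e).
Proof.
move=> a0 b0 e0 h; apply: (@le_trans _ _ ((b + e) ^+ 2)).
  by rewrite lerXn2r ?nnegrE// addr_ge0.
have := sqr_ge0 (b - e); rewrite !expr2; lra.
Qed.

Lemma nrm_triB U V : X U -> X V -> nrm U <= nrm V + nrm (V - U).
Proof.
move=> hU hV; rewrite -[nrm (V - U)]nrmN; last exact: X_B.
rewrite opprB; have := nrmD hV (X_B hU hV); by rewrite addrC subrK.
Qed.

(** What the observability estimate takes as input; the time derivatives are two-sided, hence
    restricted to [t > 0]. *)
Definition solution_chain (Y : nat -> E) := [/\ forall i, X (Y i),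
  forall i t, (i <= 4)%N -> 0 <= t ->
    dom (S t (Y i)) /\ nrm (A (S t (Y i)) - S t (Y i.+1)) = 0 &
  forall i t, (i <= 4)%N -> 0 < t ->
    nrm (h^-1 *; (S (t + h) (Y i) - S t (Y i)) - S t (Y i.+1)) @[h --> 0^'] --> (0 : R)].

Lemma chain_solution Y : chain Y -> solution_chain Y.
Proof.
move=> [xY dY aY]; split=> // i t i4 t0.
  have [h1 h2] := dom_S t0 (dY _ i4); split=> //.
  by have [_ _] := eqv_trans h2 (S_eqv t0 (aY _ i4)).
have e := S_eqv (ltW t0) (aY _ i4).
have := S_derive t0 (dY _ i4); apply: cvg_trans; apply: near_eq_cvg; near=> h.
have ht : 0 <= t + h.
  have : `|h| < t by near: h; exact: dnbhs0_lt.
  by rewrite ltr_norml => /andP[h1 _]; lra.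
apply: eqv_nrmB e _; apply/X_Z/X_B; first exact: S_X.
by apply: S_X => //; exact: ltW.
Unshelve. all: by end_near. Qed.

Theorem decay_of_chain_decay K : 0 <= K ->
  (forall Y, solution_chain Y -> forall t, 0 < t -> t * nrm (S t (Y 3)) ^+ 2 <=
     K * (nrm (S (t / 2) (Y 3)) ^+ 2 + nrm (S (t / 2) (Y 4)) ^+ 2)) ->
  forall U, dom U -> forall t, 0 < t ->
    t * nrm (S t U) ^+ 2 <= 4 * K * B ^+ 2 * (nrm U ^+ 2 + nrm (A U) ^+ 2).
Proof.
move=> K0 hY U hU t t0; have xU := dom_X hU; have xA := A_X hU.
have B2 : 0 <= B ^+ 2 by exact: sqr_ge0.
(* The coefficients of [e^2]: the first comes from the norms of [Y 3] and [Y 4], the second from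
   replacing [U] by [Y 3] at time [t]. *)
apply: (@le_of_quadratic_error _ _ (8 * K * B ^+ 2 + 2 * t * B ^+ 2)).
  by rewrite addr_ge0 ?mulr_ge0// ltW.
move=> e e0; have [Y [cY y3 y4]] := chain_approx hU e0; have [xY _ _] := cY.
have th0 : 0 <= t / 2 by rewrite divr_ge0// ltW.
have h1 := hY _ (chain_solution cY) _ t0.
have h2 i : nrm (S (t / 2) (Y i)) ^+ 2 <= B ^+ 2 * nrm (Y i) ^+ 2.
  by rewrite -exprMn lerXn2r ?nnegrE ?mulr_ge0//; exact: S_le.
have h3 : nrm (Y 3) ^+ 2 <= 2 * nrm U ^+ 2 + 2 * (e * e).
  apply: sqrD_le => //; first exact: ltW.
  have := nrm_triB (xY 3%N) xU; rewrite -(nrmN (X_B xU (xY 3%N))) opprB.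
  by move=> /le_trans; apply; rewrite lerD2l.
have h4 : nrm (Y 4) ^+ 2 <= 2 * nrm (A U) ^+ 2 + 2 * (e * e).
  apply: sqrD_le => //; first exact: ltW.
  have := nrm_triB (xY 4%N) xA; rewrite -(nrmN (X_B xA (xY 4%N))) opprB.
  by move=> /le_trans; apply; rewrite lerD2l.
have h5 : nrm (S t U) ^+ 2 <= 2 * nrm (S t (Y 3)) ^+ 2 + 2 * (B * e * (B * e)).
  have t0' := ltW t0; apply: sqrD_le => //; first by rewrite mulr_ge0// ltW.
  apply: (le_trans (nrm_triB (S_X t0' xU) (S_X t0' (xY 3%N)))); rewrite lerD2l.
  rewrite -(eqv_nrm (S_B t0' (xY 3%N) xU)).
  by apply: (le_trans (S_le t0' (X_B (xY 3%N) xU))); rewrite ler_wpM2l.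
have := ler_wpM2l (ltW t0) h5; have := ler_wpM2l K0 (lerD (h2 3%N) (h2 4%N)).
have := ler_wpM2l (mulr_ge0 K0 B2) (lerD h3 h4).
move: h1; move: (nrm (S t (Y 3)) ^+ 2) (nrm (S t U) ^+ 2) (nrm (S (t / 2) (Y 3)) ^+ 2)
  (nrm (S (t / 2) (Y 4)) ^+ 2) (nrm (Y 3) ^+ 2) (nrm (Y 4) ^+ 2) (nrm U ^+ 2) (nrm (A U) ^+ 2).
move=> a1 a2 a3 a4 a5 a6 a7 a8 e1 e2 e3 e4; lra.
Qed.

End Semigroup.

(** * The wave operator *)

Section Generator.
Context {R : realType} (L : R).
Implicit Types (f g u v y z : cfun R) (p q s : R -> R) (i : bool) (r e : R) (U V W : state R) (k
    : slot).
Local Notation I := (real_integral L).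
Local Notation L2 := (L2 L).
Local Notation normL2 := (normL2 L).
Local Notation X := (inEnergySpace L).
Local Notation nrm := (state_norm L).
Local Notation rcoord := (real_coord L).
Hypothesis L0 : 0 < L.
Variables b c : R -> R.
Hypotheses (hb : bdd L b) (hc : bdd L c).
Local Notation dom := (domA L 1 b (fun=> 0)).
Local Notation A := (opA L 1 b c (fun=> 0)).

Lemma normL2_real_coordB U V i k : X U -> X V ->
  normL2 (rcoord (U - V) i k) = normL2 (fun x => rcoord U i k x - rcoord V i k x).
Proof.
move=> hU hV; have hu := real_coord_L2 L0 i k hU; have hv := real_coord_L2 L0 i k hV.
rewrite -(opp_scale V) addrC (normL2_real_coord_comb L0 (-1) i k hV hU).
by apply: eq_normL2 => x _; rewrite mulN1r addrC.
Qed.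

Lemma state_normB_eq0 U V : X U -> X V ->
  (forall i k, normL2 (fun x => rcoord U i k x - rcoord V i k x) = 0) <-> nrm (U - V) = 0.
Proof.
move=> hU hV; split=> [h|h i k].
  by rewrite /state_norm /part_norm !normL2_real_coordB// !h !addr0.
apply/eqP; rewrite eq_le normL2_ge0 andbT -normL2_real_coordB// -h; exact: real_coord_le.
Qed.

Lemma part_opA_cV i u v z x : part i (fun x => wderiv L (stress_u L 1 b u v) x - (c x)%:C%C * z x) x
  = part i (wderiv L (stress_u L 1 b u v)) x - c x * part i z x.
Proof. by rewrite /part cpartB cpartZ. Qed.

Lemma part_opA_cZ i v y z x : part i (fun x => wderiv L (stress_y L (fun=> 0) y z) x + (c x)%:C%C
    * v x) x
  = part i (wderiv L (stress_y L (fun=> 0) y z)) x + c x * part i v x.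
Proof. by rewrite /part cpartD cpartZ. Qed.

Lemma part_stress_u i u v x : part i (stress_u L 1 b u v) x =
  part i (wderiv L u) x + b x * part i (wderiv L v) x.
Proof. by rewrite /part /stress_u cpartD !cpartZ mul1r. Qed.

Lemma part_stress_y i y z x : part i (stress_y L (fun=> 0) y z) x = part i (wderiv L y) x.
Proof. by rewrite /part /stress_y cpartD !cpartZ mul0r addr0. Qed.

Lemma stress_u_inL2 u v : inH10 L u -> inH10 L v -> inL2 L (stress_u L 1 b u v).
Proof.
move=> hu hv; apply/inL2P => i.
apply: (@eq_L2 _ _ (fun x => part i (wderiv L u) x + b x * part i (wderiv L v) x)).
  by move=> x _; rewrite part_stress_u.
exact: L2D (wderiv_L2 L0 i hu) (bddM_L2 hb (wderiv_L2 L0 i hv)).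
Qed.

Lemma stress_y_inL2 y z : inH10 L y -> inL2 L (stress_y L (fun=> 0) y z).
Proof.
move=> hy; apply/inL2P => i; apply: (@eq_L2 _ _ (part i (wderiv L y))).
  by move=> x _; rewrite part_stress_y.
exact: wderiv_L2.
Qed.

Lemma dom_stress_u u v y z : dom (u, v, y, z) ->
  cH1 L (stress_u L 1 b u v) (wderiv L (stress_u L 1 b u v)).
Proof.
move=> [[hu _ hy _] [hv hz h1 h2]]; apply: has_L2_derivativeP => //.
exact: stress_u_inL2.
Qed.

Lemma dom_stress_y u v y z : dom (u, v, y, z) ->
  cH1 L (stress_y L (fun=> 0) y z) (wderiv L (stress_y L (fun=> 0) y z)).
Proof.
move=> [[hu _ hy _] [hv hz h1 h2]]; apply: has_L2_derivativeP => //.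
exact: stress_y_inL2.
Qed.

Lemma inH10_L2 f i : inH10 L f -> L2 (part i f).
Proof. by move=> h; case: (inH10_cH10 L0 h i). Qed.

Lemma opA_X U : dom U -> X (A U).
Proof.
case: U => [[[u v] y] z] hU; have [[hu _ hy _] [hv hz _ _]] := hU; split=> //.
  apply/inL2P => i; apply: (eq_L2 (fun x _ => esym (part_opA_cV i u v z x))).
  have [_ h _] := dom_stress_u hU i.
  exact: L2B h (bddM_L2 hc (inH10_L2 i hz)).
apply/inL2P => i; apply: (eq_L2 (fun x _ => esym (part_opA_cZ i v y z x))).
have [_ h _] := dom_stress_y hU i.
exact: L2D h (bddM_L2 hc (inH10_L2 i hv)).
Qed.

(** These are the relations of [valid] between consecutive levels. They tolerate changes of [V] of
    norm 0, so the next level may stand for [A U]. *)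
Lemma dom_relations U V i : dom U -> X V -> nrm (A U - V) = 0 ->
  [/\ H10 L (rcoord U i cV) (rcoord V i cP), H10 L (rcoord U i cZ) (rcoord V i cQ),
    H1 L (fun x => rcoord U i cP x + b x * rcoord V i cP x)
         (fun x => rcoord V i cV x + c x * rcoord U i cZ x) &
    H1 L (rcoord U i cQ) (fun x => rcoord V i cZ x - c x * rcoord U i cV x)].
Proof.
move=> hU hV e0; have xU : X U by case: U hU {e0} => [[[u v] y] z] [].
have e := (state_normB_eq0 (opA_X hU) hV).2 e0.
have LV k := real_coord_L2 L0 i k hV; have LU k := real_coord_L2 L0 i k xU.
case: U hU xU LU e {e0} => [[[u v] y] z] hU xU LU e; have [[hu _ hy _] [hv hz _ _]] := hU.
have eP : normL2 (fun x => part i (wderiv L v) x - rcoord V i cP x) = 0 := e i cP.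
have eQ : normL2 (fun x => part i (wderiv L z) x - rcoord V i cQ x) = 0 := e i cQ.
have su := dom_stress_u hU i; have sy := dom_stress_y hU i.
split.
- exact: H10_eq (LV cP) eP (inH10_cH10 L0 hv i).
- exact: H10_eq (LV cQ) eQ (inH10_cH10 L0 hz i).
- apply: H1_eq su; [exact: L2D (LU cP) (bddM_L2 hb (LV cP))|exact: L2D (LV cV) (bddM_L2 hc (LU
    cZ))| |].
    rewrite (@eq_normL2 _ _ _ (fun x => b x * (part i (wderiv L v) x - rcoord V i cP x))).
      have [M [M0 hM]] := bdd_bound hb.
      have hd := L2B (wderiv_L2 L0 i hv) (LV cP).
      apply/eqP; rewrite eq_le normL2_ge0 andbT.
      by apply: le_trans (normL2_bddM hb M0 hM hd) _; rewrite eP mulr0.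
    by move=> x _; rewrite part_stress_u /real_coord /=; ring.
  apply: etrans (e i cV); apply: eq_normL2 => x _.
  have -> : rcoord (A (u, v, y, z)) i cV x = _ := part_opA_cV i u v z x.
  by rewrite opprD addrA addrAC.
- apply: H1_eq sy; [exact: LU cQ|exact: L2B (LV cZ) (bddM_L2 hc (LU cV))| |].
    by apply: (normL2_self L0) => x; exact: part_stress_y.
  apply: etrans (e i cZ); apply: eq_normL2 => x _.
  have -> : rcoord (A (u, v, y, z)) i cZ x = _ := part_opA_cZ i v y z x.
  have sub_subr (x1 x2 x3 : R) : x1 - (x2 - x3) = x1 + x3 - x2 by rewrite opprB addrA.
  exact: sub_subr.
Qed.

Lemma H1_prim0_sub s r : L2 s -> H1 L (fun x => prim0 L s x - r) s.
Proof.
move=> hs; have h1 : H1 L (prim0 L s) s by split;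
    [exact/bdd_L2/bdd_prim0|exact: hs|exact: prim0_wd].
have h2 : H1 L (fun=> r) (fun=> 0 : R).
  split; [exact: L2_cst|exact: L2_cst|].
  have [c1 c2] := C1_cst r.
  by move=> phi hphi; have := C1_ibp L0 c1 hphi; rewrite c2.
have := wdB h1 h2; apply: H1_eq => //; first exact: L2B (bdd_L2 (bdd_prim0 L0 hs)) (L2_cst L r).
  by apply: (normL2_self L0).
by apply: (normL2_self L0) => x; rewrite subr0.
Qed.

Definition mean p := I p / L.

Lemma int_sub_mean p : L2 p -> I (fun x => p x - mean p) = 0.
Proof.
move=> hp; rewrite intB; [|exact: L2_itg|exact: itg_cst].
have [c1 e1] := @C1_id R; have := ftc (ltW L0) c1; rewrite e1 subr0 => e2.
rewrite (@eq_int _ _ (fun=> mean p) (fun x => mean p * 1)); last by move=> x _; rewrite mulr1.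
by rewrite intZ ?e2 /mean ?divfK ?subrr ?lt0r_neq0//; exact: itg_cst.
Qed.

Let subrDr (x y z : R) : x - z - y = x - (y + z).
Proof. by rewrite opprD addrA addrAC. Qed.
Let subrBr (x y z : R) : x + z - y = x - (y - z).
Proof. by rewrite opprB addrA. Qed.

(** Two integrations. For [W = (w1, u, w3, y)] the stress must have derivative [s = v + c y], so
    [w1'] is [G], a primitive of [s] minus [b u'], up to a constant. Taking the mean of [G] as this
    constant makes [w1] vanish at both ends; [w3] is found in the same way from [t]. *)
Lemma opA_surj U : X U -> exists W, dom W /\ nrm (A W - U) = 0.
Proof.
case: U => [[[u v] y] z] xU; have [hu /inL2P hv hy /inL2P hz] := xU.
have lu i : L2 (part i u) by exact: inH10_L2.
have ly i : L2 (part i y) by exact: inH10_L2.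
pose s i x := part i v x + c x * part i y x.
have ls i : L2 (s i) by exact: L2D (hv i) (bddM_L2 hc (ly i)).
pose G i x := prim0 L (s i) x - b x * part i (wderiv L u) x.
have lG i : L2 (G i).
  exact: L2B (bdd_L2 (bdd_prim0 L0 (ls i))) (bddM_L2 hb (wderiv_L2 L0 i hu)).
pose t i x := part i z x - c x * part i u x.
have lt i : L2 (t i) by exact: L2B (hz i) (bddM_L2 hc (lu i)).
have lT i : L2 (prim0 L (t i)) by exact: bdd_L2 (bdd_prim0 L0 (lt i)).
have prim_H10 p : L2 p -> H10 L (prim0 L (fun x => p x - mean p)) (fun x => p x - mean p).
  move=> hp; apply: prim0_H10 => //; last exact: int_sub_mean.
  exact: L2B hp (L2_cst L _).
pose lift (p : bool -> R -> R) : cfun R := cpx (p true) (p false).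
have partl (q : bool -> R -> R) i : part i (lift q) = q i by case: i.
pose w1 := lift (fun i => prim0 L (fun x => G i x - mean (G i))).
pose g1 := lift (fun i x => G i x - mean (G i)).
pose w3 := lift (fun i => prim0 L (fun x => prim0 L (t i) x - mean (prim0 L (t i)))).
pose g3 := lift (fun i x => prim0 L (t i) x - mean (prim0 L (t i))).
have [hw1 e1] : inH10 L w1 /\ ceq L g1 (wderiv L w1).
  by apply: cH10_inH10 => // i; rewrite !partl; exact: prim_H10.
have [hw3 e3] : inH10 L w3 /\ ceq L g3 (wderiv L w3).
  by apply: cH10_inH10 => // i; rewrite !partl; exact: prim_H10.
have lw1 i := wderiv_L2 L0 i hw1; have lw3 i := wderiv_L2 L0 i hw3.
have lst i := stress_u_inL2 hw1 hu.
have [hs1 hs2] : inH1 L (stress_u L 1 b w1 u) /\ ceq L (lift s) (wderiv L (stress_u L 1 b w1 u)).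
  apply: cH1_inH1 => // i; rewrite partl.
  have /inL2P lst' := stress_u_inL2 hw1 hu.
  apply: H1_eq (lst' i) (ls i) _ _ (H1_prim0_sub (mean (G i)) (ls i)); last exact: normL2_self.
  apply: etrans (e1 i); rewrite partl; apply: eq_normL2 => x _; rewrite part_stress_u /G.
  move: (prim0 L (s i) x) (mean _) (b x * _) (part i _ x) => x1 x2 x3 x4; ring.
have [ht1 ht2] : inH1 L (stress_y L (fun=> 0) w3 y) /\ ceq L (lift t) (wderiv L (stress_y L
    (fun=> 0) w3 y)).
  apply: cH1_inH1 => // i; rewrite partl.
  have /inL2P lst' := stress_y_inL2 y hw3.
  apply: H1_eq (lst' i) (lt i) _ _ (H1_prim0_sub (mean (prim0 L (t i))) (lt i));
      last exact: normL2_self.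
  apply: etrans (e3 i); rewrite partl; apply: eq_normL2 => x _; by rewrite part_stress_y.
have hW : dom (w1, u, w3, y).
  split; first by split; [exact: hw1|exact: hu.1.1|exact: hw3|exact: hy.1.1].
  by split; [exact: hu|exact: hy|exact: hs1.2|exact: ht1.2].
have xA := opA_X hW; exists (w1, u, w3, y); split; first exact: hW.
apply/(state_normB_eq0 xA xU) => i.
have [_ lws _] := inH1_cH1 L0 hs1 i; have [_ lwt _] := inH1_cH1 L0 ht1 i.
case.
- exact: (normL2_self L0).
- apply: etrans (hs2 i); rewrite partl (normL2_sym (ls i) lws).
  apply: eq_normL2 => x _; apply: etrans (subrDr _ _ _).
  congr (_ - _); exact: part_opA_cV.
- exact: (normL2_self L0).
- apply: etrans (ht2 i); rewrite partl (normL2_sym (lt i) lwt).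
  apply: eq_normL2 => x _; apply: etrans (subrBr _ _ _).
  congr (_ - _); exact: part_opA_cZ.
Qed.

End Generator.

(** * The decay estimate *)

Section Assembly.
Context {R : realType} (L : R).
Implicit Types (U V W : state R) (r t h e : R) (i : bool) (k : slot).
Local Notation I := (real_integral L).
Local Notation L2 := (L2 L).
Local Notation normL2 := (normL2 L).
Local Notation X := (inEnergySpace L).
Local Notation nrm := (state_norm L).
Local Notation rcoord := (real_coord L).
Local Notation N := (energy_norm L 1).

Section Quotient.
Hypothesis L0 : 0 < L.

Lemma subB_cancel (x y z : R) : x - y - (z - y) = x - z.
Proof. by rewrite opprB addrA subrK. Qed.
Lemma opp_comb (x y z : R) : x - y - z = -1 * y + x - z.
Proof. by rewrite mulN1r [- y + x]addrC. Qed.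
Lemma comb_rearrange (r p u q : R) : r * u - (r * p + q) = - r * (p - u) - q.
Proof. ring. Qed.

(** Transfers the convergence of difference quotients of states to their coordinates, which are
    linear only up to norm 0. *)
Lemma normL2_real_coord_quotient r U V W i k : X U -> X V -> X W ->
  normL2 (fun x => r * (rcoord U i k x - rcoord V i k x) - rcoord W i k x) =
  normL2 (rcoord (r%:C%C *: (U - V) - W) i k).
Proof.
move=> hU hV hW; have lU := real_coord_L2 L0 i k hU; have lV := real_coord_L2 L0 i k hV.
have lW := real_coord_L2 L0 i k hW.
have xP : X (U - V) by rewrite -(opp_scale V) addrC; exact: space_comb.
have xQ : X (r%:C%C *: (U - V)) by rewrite -[_ *: _]addr0; exact/space_comb/space0.
have xQW : X (r%:C%C *: (U - V) - W) by rewrite -(opp_scale W) addrC; exact: space_comb.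
have lP := real_coord_L2 L0 i k xP; have lQ := real_coord_L2 L0 i k xQ.
have l0 := real_coord_L2 L0 i k (space0 L0).
rewrite (normL2_real_coordB L0 i k xQ hW).
have lUV := L2B lU lV.
apply: normL2_eq; [exact: L2B (L2Z r lUV) lW|exact: L2B|].
rewrite (@eq_normL2 _ _ _ (fun x => r * (rcoord U i k x - rcoord V i k x) - rcoord (r%:C%C *: (U
    - V)) i k x)); last first.
  by move=> x _; exact: subB_cancel.
have e0 : normL2 (rcoord 0 i k) = 0.
  by rewrite -(subrr U) (normL2_real_coordB L0 i k hU hU); exact: (normL2_self L0).
have e1 := real_coord_comb L0 r i k xP (space0 L0); rewrite addr0 in e1.
have e2 : normL2 (fun x => rcoord (U - V) i k x - (rcoord U i k x - rcoord V i k x)) = 0.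
  have := real_coord_comb L0 (-1) i k hV hU; rewrite opp_scale addrC => e2.
  rewrite (normL2_sym lP lUV); apply: etrans e2; apply: eq_normL2 => x _; exact: opp_comb.
have e3 : normL2 (fun x => r * (rcoord U i k x - rcoord V i k x)
    - (r * rcoord (U - V) i k x + rcoord 0 i k x)) = 0.
  apply/eqP; rewrite eq_le normL2_ge0 andbT.
  rewrite (@eq_normL2 _ _ _ (fun x => (- r) * (rcoord (U - V) i k x
    - (rcoord U i k x - rcoord V i k x)) - rcoord 0 i k x)); last first.
    by move=> x _; exact: comb_rearrange.
  apply: le_trans (normL2B (L2Z (- r) (L2B lP lUV)) l0) _.
  by rewrite (normL2Z _ (L2B lP lUV)) e2 e0 mulr0 addr0.
exact: (normL2_tri0 (L2Z r lUV) (L2D (L2Z r lP) l0) lQ e3 e1).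
Qed.

End Quotient.

Definition sq1 U i := normL2 (rcoord U i cP) ^+ 2 + normL2 (rcoord U i cV) ^+ 2
  + normL2 (rcoord U i cQ) ^+ 2 + normL2 (rcoord U i cZ) ^+ 2.

Lemma energy_norm_sq U : 0 < L -> X U -> N U ^+ 2 = sq1 U true + sq1 U false.
Proof.
move=> L0 hU; rewrite (energy_normE L0 hU); exact: (sqr_sqrtr (sqr8_ge0 _ _ _ _ _ _ _ _)).
Qed.

Lemma sum4_half (x1 x2 x3 x4 a1 a2 a3 a4 a5 a6 a7 a8 : R) :
  x1 = a2 + a6 -> x2 = a1 + a5 -> x3 = a4 + a8 -> x4 = a3 + a7 ->
  2^-1 * (x1 + x2 + x3 + x4) = 2^-1 * (a1 + a2 + a3 + a4 + (a5 + a6 + a7 + a8)).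
Proof. by move=> -> -> -> ->; congr (_ * _); ring. Qed.

Lemma energyE U : 0 < L -> X U -> energy L 1 U = 2^-1 * N U ^+ 2.
Proof.
move=> L0 xU; rewrite (energy_norm_sq L0 xU); case: U xU => [[[u v] y] z] [hu hv hy hz].
have wu : inL2 L (wderiv L u) by apply/inL2P => i; exact: wderiv_L2.
have wy : inL2 L (wderiv L y) by apply/inL2P => i; exact: wderiv_L2.
have iv : itg L (fun x => modulus (v x) ^+ 2) by case: hv.
have iz : itg L (fun x => modulus (z x) ^+ 2) by case: hz.
have iu : itg L (fun x => modulus (wderiv L u x) ^+ 2) by case: wu.
have iy : itg L (fun x => modulus (wderiv L y x) ^+ 2) by case: wy.
rewrite /energy (@eq_int _ _ _ (fun x => modulus (v x) ^+ 2 + modulus (wderiv L u x) ^+ 2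
    + modulus (z x) ^+ 2 + modulus (wderiv L y x) ^+ 2)); last by move=> x _; rewrite mul1r.
rewrite (intD (itgD (itgD iv iu) iz) iy) (intD (itgD iv iu) iz) (intD iv iu).
exact: (sum4_half (int_modulus hv) (int_modulus wu) (int_modulus hz) (int_modulus wy)).
Qed.

Lemma energy_eqE U V : 0 < L -> X U -> X V -> energy_eq L 1 U V <-> nrm (U - V) = 0.
Proof.
move=> L0 hU hV; have xB : X (U - V) by rewrite -(opp_scale V) addrC; exact: space_comb.
have [h1 h2] := state_norm_equiv L0 xB; rewrite /energy_eq; split=> h.
  by apply/eqP; rewrite eq_le state_norm_ge0 andbT; move: h2; rewrite h mulr0.
by apply/eqP; rewrite eq_le sqrtr_ge0 andbT; move: h1; rewrite h.
Qed.

Lemma energy_norm_cvg (f : R -> state R) : 0 < L -> (forall h, 0 < h -> X (f h)) ->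
  (N (f h) @[h --> 0^'+] --> (0 : R)) <-> (nrm (f h) @[h --> 0^'+] --> (0 : R)).
Proof.
move=> L0 hf; split=> hg.
  apply: (@cvg_at_right0 _ _ _ 8 _ _ hg) => // h /hf xh.
  by have [_ h2] := state_norm_equiv L0 xh; rewrite state_norm_ge0.
apply: (@cvg_at_right0 _ _ _ 1 _ _ hg) => // h /hf xh.
by have [h1 _] := state_norm_equiv L0 xh; rewrite sqrtr_ge0 mul1r.
Qed.

Lemma energy_norm_ge0 U : 0 <= N U.
Proof. exact: sqrtr_ge0. Qed.

(** Adds the real and the imaginary part, then passes from the energy norm [n] to the state norm
    [m], at the cost [64 = 8^2]. *)
Lemma sum_decay (t K p q p3 q3 p4 q4 n n3 n4 m m3 m4 : R) : 0 <= t -> 0 <= K ->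
  t * p <= K * (p3 + p4) -> t * q <= K * (q3 + q4) ->
  n ^+ 2 = p + q -> n3 ^+ 2 = p3 + q3 -> n4 ^+ 2 = p4 + q4 ->
  0 <= m -> 0 <= n -> 0 <= n3 -> 0 <= n4 -> m <= 8 * n -> n3 <= m3 -> n4 <= m4 ->
  t * m ^+ 2 <= 64 * K * (m3 ^+ 2 + m4 ^+ 2).
Proof.
move=> t0 K0 h1 h2 e e3 e4 m0 n0 n30 n40 u u3 u4.
have v : m ^+ 2 <= 64 * n ^+ 2.
  by rewrite (_ : 64 * n ^+ 2 = (8 * n) ^+ 2); [rewrite lerXn2r ?nnegrE ?mulr_ge0|ring].
have v3 : n3 ^+ 2 <= m3 ^+ 2 by rewrite lerXn2r ?nnegrE// (le_trans n30).
have v4 : n4 ^+ 2 <= m4 ^+ 2 by rewrite lerXn2r ?nnegrE// (le_trans n40).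
have w := ler_wpM2l t0 v; have w' := ler_wpM2l K0 (lerD v3 v4).
move: w w'; rewrite e e3 e4; move: (m ^+ 2) (m3 ^+ 2) (m4 ^+ 2) => a1 a2 a3 w w'; lra.
Qed.

(** [4 K 8^2] is the constant of [decay_of_chain_decay] for [B = 8], and 64 the price of returning
    to the energy norm on the right. The [+ 1] makes the final constant positive even for
    [K = 0]. *)
Lemma final_bound (t K nS nU nA mS mU mA : R) : 0 < t -> 0 <= K ->
  0 <= nS -> 0 <= nU -> 0 <= nA -> 0 <= mU -> 0 <= mA ->
  nS <= mS -> mU <= 8 * nU -> mA <= 8 * nA ->
  t * mS ^+ 2 <= 4 * K * 8 ^+ 2 * (mU ^+ 2 + mA ^+ 2) ->
  2^-1 * nS ^+ 2 <= (2^-1 * (4 * K * 8 ^+ 2) * 64 + 1) / t * (nU + nA) ^+ 2.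
Proof.
move=> t0 K0 nS0 nU0 nA0 mU0 mA0 h1 h2 h3 h.
rewrite -(ler_pM2l t0) (_ : t * (_ / t * _) = (2^-1 * (4 * K * 8 ^+ 2) * 64 + 1) * (nU + nA) ^+
    2); last first.
  by field; exact: lt0r_neq0.
have v1 : nS ^+ 2 <= mS ^+ 2 by rewrite lerXn2r ?nnegrE// (le_trans nS0).
have sq8 (m n : R) : 0 <= m -> 0 <= n -> m <= 8 * n -> m ^+ 2 <= 64 * n ^+ 2.
  move=> m0 n0 u.
  by rewrite (_ : 64 * n ^+ 2 = (8 * n) ^+ 2); [rewrite lerXn2r ?nnegrE ?mulr_ge0|ring].
have v2 := sq8 _ _ mU0 nU0 h2; have v3 := sq8 _ _ mA0 nA0 h3.
have v4 : nU ^+ 2 + nA ^+ 2 <= (nU + nA) ^+ 2.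
  by have := mulr_ge0 nU0 nA0; rewrite !expr2; lra.
pose M := 4 * K * 8 ^+ 2; rewrite -/M in h *.
have M0 : 0 <= M by rewrite !mulr_ge0// sqr_ge0.
have w1 := ler_wpM2l (ltW t0) v1; have w2 := ler_wpM2l M0 (lerD v2 v3).
have w3 := ler_wpM2l M0 v4; have w4 := sqr_ge0 (nU + nA).
move: h w1 w2 w3 w4; clearbody M;
    move: (nS ^+ 2) (mS ^+ 2) (mU ^+ 2) (mA ^+ 2) (nU ^+ 2) (nA ^+ 2) ((nU + nA) ^+ 2).
move=> a1 a2 a3 a4 a5 a6 a7 h w1 w2 w3 w4; lra.
Qed.

Section Decay.
Variables (b0 c0 b1 b2 c1 c2 : R).
Hypotheses (hb0 : 0 < b0) (hc0 : c0 != 0) (hb1 : 0 < b1) (hb12 : b1 < b2)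
  (hbc : b2 < c1) (hc12 : c1 < c2) (hc2 : c2 < L) (hsmall : `|c0| < (c2 - c1)^-1).
Local Notation b := (damping b0 b1 b2).
Local Notation c := (coupling c0 c1 c2).
Local Notation dom := (domA L 1 b (fun=> 0)).
Local Notation A := (opA L 1 b c (fun=> 0)).
Variable S : R -> state R -> state R.
Hypotheses (hS : C0_contraction_semigroup L 1 S) (hgen : generates L 1 dom A S).

Let L0 : 0 < L. Proof. by move: hb1 hb12 hbc hc12 hc2 => ? ? ? ? ?; lra. Qed.
Let hb : bdd L b. Proof. rewrite /damping; bdd_tac. Qed.
Let hc : bdd L c. Proof. rewrite /coupling; bdd_tac. Qed.

Let S_X t U : 0 <= t -> X U -> X (S t U).
Proof. by case: hS => h _; exact: h. Qed.

Let S_comb t r U V : 0 <= t -> X U -> X V ->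
  nrm (S t (r%:C%C *: U + V) - (r%:C%C *: S t U + S t V)) = 0.
Proof.
move=> t0 hU hV; have x1 := S_X t0 (space_comb L0 r hU hV).
have x2 := space_comb L0 r (S_X t0 hU) (S_X t0 hV).
by apply: (energy_eqE L0 x1 x2).1; case: hS => _ [h _]; exact: h.
Qed.

Let S_D s t U : 0 <= s -> 0 <= t -> X U -> nrm (S (s + t) U - S s (S t U)) = 0.
Proof.
move=> s0 t0 hU; have x1 := S_X (addr_ge0 s0 t0) hU; have x2 := S_X s0 (S_X t0 hU).
by apply: (energy_eqE L0 x1 x2).1; case: hS => _ [_ [_ [h _]]]; exact: h.
Qed.

Let S_le t U : 0 <= t -> X U -> nrm (S t U) <= 8 * nrm U.
Proof.
move=> t0 hU; have [_ h2] := state_norm_equiv L0 (S_X t0 hU); have [h1 _] := state_norm_equiv L0 hU.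
apply: (le_trans h2); rewrite ler_wpM2l//; apply: le_trans h1.
by case: hS => _ [_ [_ [_ [h _]]]]; exact: h.
Qed.

Let X_B U V : X U -> X V -> X (U - V).
Proof. by move=> hU hV; rewrite -(opp_scale V) addrC; exact: space_comb. Qed.

Let X_Z r U : X U -> X (r%:C%C *: U).
Proof. by move=> hU; have := space_comb L0 r hU (space0 L0); rewrite addr0. Qed.

Let S_cont U : X U -> nrm (S t U - U) @[t --> 0^'+] --> (0 : R).
Proof.
move=> hU; apply: (@energy_norm_cvg (fun t => S t U - U) L0 _).1.
  by move=> h h0; exact: X_B (S_X (ltW h0) hU) hU.
by case: hS => _ [_ [_ [_ [_ h]]]]; exact: h.
Qed.

Let dom_X U : dom U -> X U.
Proof. by case: U => [[[u v] y] z] []. Qed.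

Let A_X U : dom U -> X (A U).
Proof. exact: opA_X. Qed.

Let gen U F : X U -> X F ->
  (nrm ((h^-1)%:C%C *: (S h U - U) - F) @[h --> 0^'+] --> (0 : R)) <->
  (dom U /\ nrm (F - A U) = 0).
Proof.
move=> hU hF; have key h : 0 < h -> X ((h^-1)%:C%C *: (S h U - U) - F).
  move=> h0; apply: X_B hF; exact: X_Z (X_B (S_X (ltW h0) hU) hU).
split=> [g|[h1 h2]].
  have [h1 h2] := (hgen hU hF).1 ((energy_norm_cvg L0 key).2 g).
  by split; [exact: h1|exact: (energy_eqE L0 hF (A_X h1)).1 h2].
apply: (energy_norm_cvg L0 key).1; apply: (hgen hU hF).2; split; first exact: h1.
exact: (energy_eqE L0 hF (A_X h1)).2 h2.
Qed.

Let A_surj U : X U -> exists W, dom W /\ eqv X nrm (A W) U.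
Proof.
move=> hU; have [W [h1 h2]] := opA_surj L0 hb hc hU; exists W; split=> //.
by split=> //; exact: A_X.
Qed.

Let ge0_8 : 0 <= 8 :> R. Proof. exact: ler0n. Qed.

(** The coefficients are real, so each of the two parts is a trajectory of the real system. *)
Definition chain_traj (Y : nat -> state R) i : R -> lev (R := R) :=
  fun t j k => rcoord (S t (Y j)) i k.

Lemma chain_traj_traj Y i : solution_chain X nrm S dom A Y ->
  traj L b0 c0 b1 b2 c1 c2 (chain_traj Y i).
Proof.
move=> [xY aY dY]; split=> [t t0|t j k t0 j4].
  split=> [j k|j j4]; first exact/(real_coord_L2 L0)/S_X/xY/ltW.
  have [h1 h2] := aY _ _ j4 (ltW t0).
  exact: (dom_relations L0 hb hc i h1 (S_X (ltW t0) (xY j.+1)) h2).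
apply: (@squeeze_cvgr _ _ _ _ (fun=> 0) _ _ _ _ _ (dY _ _ j4 t0)); last exact: cvg_cst.
near=> h.
have ht : 0 <= t + h.
  have : `|h| < t by near: h; exact: dnbhs0_lt.
  by rewrite ltr_norml => /andP[h1 _]; lra.
have x1 := S_X ht (xY j); have x2 := S_X (ltW t0) (xY j); have x3 := S_X (ltW t0) (xY j.+1).
rewrite normL2_ge0 /chain_traj (normL2_real_coord_quotient L0 h^-1 i k x1 x2 x3).
exact: real_coord_le.
Unshelve. all: by end_near. Qed.

Lemma chain_decay : exists K, 0 <= K /\ forall Y, solution_chain X nrm S dom A Y ->
  forall t, 0 < t -> t * nrm (S t (Y 3)) ^+ 2 <=
     K * (nrm (S (t / 2) (Y 3)) ^+ 2 + nrm (S (t / 2) (Y 4)) ^+ 2).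
Proof.
have [K [K0 hK]] := traj_decay hb0 hc0 hb1 hb12 hbc hc12 hc2 hsmall.
exists (64 * K); split; first by rewrite mulr_ge0.
move=> Y hY t t0; have [xY _ _] := hY.
have t20 : 0 < t / 2 by rewrite divr_gt0.
have enS i s j : 0 < s -> en L (chain_traj Y i s) j = sq1 (S s (Y j)) i.
  move=> s0; apply: enE => j' k; exact/(real_coord_L2 L0)/S_X/xY/ltW.
have hi i : t * sq1 (S t (Y 3)) i <= K * (sq1 (S (t / 2) (Y 3)) i + sq1 (S (t / 2) (Y 4)) i).
  by have := hK _ (chain_traj_traj i hY) _ t0; rewrite !enS.
have xt := S_X (ltW t0) (xY 3%N); have xt3 := S_X (ltW t20) (xY 3%N);
    have xt4 := S_X (ltW t20) (xY 4%N).
have nt := energy_norm_sq L0 xt; have nt3 := energy_norm_sq L0 xt3;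
    have nt4 := energy_norm_sq L0 xt4.
have [_ u1] := state_norm_equiv L0 xt.
have [u2 _] := state_norm_equiv L0 xt3; have [u3 _] := state_norm_equiv L0 xt4.
exact: (sum_decay (ltW t0) K0 (hi true) (hi false) nt nt3 nt4 (state_norm_ge0 L _)
    (energy_norm_ge0 _)
  (energy_norm_ge0 _) (energy_norm_ge0 _) u1 u2 u3).
Qed.

Theorem energy_decay : exists C : R, 0 < C /\ forall U, dom U -> forall t, 0 < t ->
  energy L 1 (S t U) <= C / t * graph_norm L 1 b c (fun=> 0) U ^+ 2.
Proof.
have [K [K0 hK]] := chain_decay.
have hd := decay_of_chain_decay ge0_8 (state_norm_ge0 L) (@space_comb _ _ L0)
  (space0 L0) (@state_normD _ _ L0) (@state_normZ _ _ L0) S_X S_comb S_D S_le S_cont gen dom_X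
      A_X A_surj K0 hK.
exists (2^-1 * (4 * K * 8 ^+ 2) * 64 + 1); split.
  by rewrite ltr_wpDl ?ltr01// !mulr_ge0 ?invr_ge0.
move=> U hU t t0; have xU := dom_X hU; have xA := A_X hU; have xS := S_X (ltW t0) xU.
rewrite (energyE L0 xS) /graph_norm.
have [h1 _] := state_norm_equiv L0 xS; have [_ h2] := state_norm_equiv L0 xU.
have [_ h3] := state_norm_equiv L0 xA.
exact: (final_bound t0 K0 (energy_norm_ge0 _) (energy_norm_ge0 _) (energy_norm_ge0 _)
  (state_norm_ge0 L _) (state_norm_ge0 L _) h1 h2 h3 (hd U hU t t0)).
Qed.

End Decay.

End Assembly.

Unset Implicit Arguments.

Theorem theorem2p7 (R : realType) (L a b0 c0 b1 b2 c1 c2 : R)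
    (b c d : R -> R) (S : R -> state R -> state R)
    (hb0 : 0 < b0) (hc0 : c0 != 0)
    (hb1 : 0 < b1) (hb12 : b1 < b2) (hbc : b2 < c1) (hc12 : c1 < c2)
    (hc2 : c2 < L)
    (hb : b = fun x => b0 * \1_(`]b1, b2[) x)
    (hc : c = fun x => c0 * \1_(`]c1, c2[) x)
    (hd : d = fun _ => 0)
    (ha : a = 1)
    (hsmall : `|c0| < (c2 - c1)^-1)
    (hS : C0_contraction_semigroup L a S)
    (hgen : generates L a (domA L a b d) (opA L a b c d) S) :
  exists C : R, 0 < C /\
    forall U0 : state R, domA L a b d U0 ->
    forall t : R, 0 < t ->
      energy L a (S t U0) <= C / t * graph_norm L a b c d U0 ^+ 2.
Proof.
subst a b c d.
exact: (energy_decay hb0 hc0 hb1 hb12 hbc hc12 hc2 hsmall hS hgen).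
Qed.
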